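(* The bicategory $\mathbf{LieGpoid}_{\mathrm{ana}}$ of Lie groupoids, Lie anafunctors and transformations is an essentially full sub-bicategory of the bicategory $\mathbf{DGpoid}_{\mathrm{ana}}$ of diffeological groupoids, anafunctors and transformations. Moreover, the restriction to Hausdorff and/or second-countable Lie groupoids forms an essentially full sub-bicategory of $\mathbf{LieGpoid}_{\mathrm{ana}}$, and hence also of $\mathbf{DGpoid}_{\mathrm{ana}}$.
   Context: Diffeology. A parametrisation of a set $X$ is a map $p\colon U_p\to X$ from an open subset $U_p$ of some $\mathbb{R}^n$, $n\ge 0$. A diffeology on $X$ is a set of parametrisations, called plots, containing all constant parametrisations, such that a parametrisation that restricts to a plot on each member of an open cover of its domain is a plot, and such that $p\circ f$ is a plot for every plot $p$ and every smooth map $f\colon V\to U_p$ from an open subset $V$ of some $\mathbb{R}^m$. A map $F\colon X\to Y$ of diffeological spaces is smooth if $F\circ p$ is a plot of $Y$ for every plot $p$ of $X$; a diffeomorphism is a smooth bijection with smooth inverse. A subset of $X$ carries the plots of $X$ with image in it; products carry the parametrisations whose components are plots; fibre products carry the subset diffeology of the product. A smooth surjection $F\colon X\to Y$ is a subduction if for every plot $p$ of $Y$ there are an open cover $\{U_\alpha\}$ of $U_p$ and plots $q_\alpha\colon U_\alpha\to X$ with $p|_{U_\alpha}=F\circ q_\alpha$. Manifolds are smooth, Hausdorff and second-countable unless stated otherwise, and are regarded as diffeological spaces whose plots are the smooth parametrisations. Diffeological groupoids. A diffeological groupoid $\mathcal G=(\mathcal G_1\rightrightarrows\mathcal G_0)$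 is a small groupoid whose sets of objects $\mathcal G_0$ and arrows $\mathcal G_1$ are diffeological spaces such that the source $s$, target $t$, unit $x\mapsto u_x$, multiplication ($gh$ defined when $s(g)=t(h)$) and inversion are smooth. A functor $\varphi\colon\mathcal G\to\mathcal H$ is smooth if its map on arrows is smooth (then so is its map on objects $\varphi_0$; we also write $\varphi$ for the maps on objects and arrows). A natural transformation $S\colon\varphi\Rightarrow\varphi'$ between smooth functors $\mathcal G\to\mathcal H$ is smooth if $\mathcal G_0\to\mathcal H_1$, $x\mapsto S_x$, is smooth. Pullbacks $\mathcal G\times_{\varphi,\psi}\mathcal H$ of smooth functors are strict: objects and arrows are the fibre products of the objects and of the arrows. Weak equivalences. A smooth functor $\varphi\colon\mathcal G\to\mathcal H$ is a weak equivalence if (i) $\Psi_\varphi\colon\{(x,h)\in\mathcal G_0\times\mathcal H_1:\varphi(x)=t(h)\}\to\mathcal H_0$, $(x,h)\mapsto s(h)$, is a subduction and (ii) $\Phi_\varphi\colon\mathcal G_1\to\{(x,x',h)\in\mathcal G_0\times\mathcal G_0\times\mathcal H_1: s(h)=\varphi(x),\,t(h)=\varphi(x')\}$, $g\mapsto(s(g),t(g),\varphi(g))$, is a diffeomorphism. It is a subductive weak equivalence if moreover $\varphi_0$ is a subduction. The bicategory $\mathbf{DGpoid}_{\mathrm{ana}}$. Objects: diffeological groupoids. A $1$-cell $\mathcal G\to\mathcal H$ is an anafunctor: a pair of smooth functors $\mathcal G\xleftarrow{\varphi}\mathcal K\xrightarrow{\psi}\mathcal H$ with $\varphi$ a subductive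 weak equivalence. The identity of $\mathcal G$ is $\mathcal G\xleftarrow{=}\mathcal G\xrightarrow{=}\mathcal G$. The composition of $\mathcal G\xleftarrow{\varphi}\mathcal L\xrightarrow{\psi}\mathcal H$ and $\mathcal H\xleftarrow{\chi}\mathcal M\xrightarrow{\omega}\mathcal K$ is $\mathcal G\xleftarrow{\varphi\circ\mathrm{pr}_1}\mathcal L\times_{\psi,\chi}\mathcal M\xrightarrow{\omega\circ\mathrm{pr}_2}\mathcal K$. A $2$-cell (transformation) from $\mathcal G\xleftarrow{\varphi}\mathcal K\xrightarrow{\psi}\mathcal H$ to $\mathcal G\xleftarrow{\varphi'}\mathcal K'\xrightarrow{\psi'}\mathcal H$ is a smooth natural transformation $S\colon\psi\circ\mathrm{pr}_1\Rightarrow\psi'\circ\mathrm{pr}_2$ of functors $\mathcal K\times_{\varphi,\varphi'}\mathcal K'\to\mathcal H$. The identity $2$-cell of $\mathcal G\xleftarrow{\varphi}\mathcal K\xrightarrow{\psi}\mathcal H$ is $(y_1,y_2)\mapsto\psi(\Phi_\varphi^{-1}(y_1,y_2,u_{\varphi(y_1)}))$. Vertical composition of $S$ (from $\mathcal K$ to $\mathcal K'$) with $T$ (from $\mathcal K'$ to $\mathcal K''$): $(k,k'')\mapsto T_{(k',k'')}S_{(k,k')}$ for any $k'\in\mathcal K'_0$ with $\varphi'(k')=\varphi(k)$ (independent of $k'$). Horizontal composition of $S\colon(\mathcal G\xleftarrow{\varphi}\mathcal L\xrightarrow{\psi}\mathcal H)\Rightarrow(\mathcal G\xleftarrow{\varphi'}\mathcal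 L'\xrightarrow{\psi'}\mathcal H)$ and $T\colon(\mathcal H\xleftarrow{\chi}\mathcal M\xrightarrow{\omega}\mathcal K)\Rightarrow(\mathcal H\xleftarrow{\chi'}\mathcal M'\xrightarrow{\omega'}\mathcal K)$: $((l,m),(l',m'))\mapsto\omega'(\Phi_{\chi'}^{-1}(m'',m',S_{(l,l')}))\,T_{(m,m'')}$ for any $m''\in\mathcal M'_0$ with $\chi'(m'')=\chi(m)$ (independent of $m''$). An isomorphism $\alpha\colon\mathcal K\to\mathcal K'$ with $\varphi'\alpha=\varphi$, $\psi'\alpha=\psi$ induces the $2$-cell $(k,k')\mapsto\psi'(\Phi_{\varphi'}^{-1}(\alpha(k),k',u_{\varphi'(k')}))$; associators and unitors are the $2$-cells so induced by the canonical isomorphisms $(\mathcal L\times\mathcal M)\times\mathcal N\cong\mathcal L\times(\mathcal M\times\mathcal N)$, $\mathcal G\times_{\mathcal G}\mathcal K\cong\mathcal K$, $\mathcal K\times_{\mathcal H}\mathcal H\cong\mathcal K$ of (strict) pullbacks. Lie groupoids. A Lie groupoid is a diffeological groupoid $\mathcal G$ with $\mathcal G_0$ a manifold and $\mathcal G_1$ a smooth manifold not required to be Hausdorff or second-countable, and $s,t$ submersions. It is called Hausdorff (resp. second-countable) if $\mathcal G_1$ is. A weak equivalence $\varphi\colon\mathcal G\to\mathcal H$ between Lie groupoids is Lie if $\Phi_\varphi$ and $\Psi_\varphi$ are smooth maps between manifolds and $\Psi_\varphi$ is a submersion; it is surjective submersive if it is Lie and $\varphi_0$ is a surjective submersion.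 An anafunctor $\mathcal G\xleftarrow{\varphi}\mathcal K\xrightarrow{\psi}\mathcal H$ between Lie groupoids is Lie if $\varphi$ is a surjective submersive weak equivalence (in particular $\mathcal K$ is Lie). $\mathbf{LieGpoid}_{\mathrm{ana}}$ has Lie groupoids as objects, Lie anafunctors as $1$-cells, transformations between these as $2$-cells, and all compositions, associators and unitors given by the same formulas as in $\mathbf{DGpoid}_{\mathrm{ana}}$. The restriction to Hausdorff and/or second-countable Lie groupoids is defined in the same way, with all groupoids involved (including the middle groupoids of anafunctors) required to have the given properties. A sub-bicategory (closed under all the structure, so that the inclusion is a pseudofunctor) is essentially full if every $1$-cell of the ambient bicategory between two objects of the sub-bicategory admits an invertible $2$-cell to a $1$-cell of the sub-bicategory, and all $2$-cells of the ambient bicategory between $1$-cells of the sub-bicategory belong to it; that is, the inclusion induces an equivalence on each hom-category. *)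

(* Defs.v *)
From HB Require Import structures.
From mathcomp Require Import all_boot all_order all_algebra.
From mathcomp Require Import all_classical all_reals.
From mathcomp Require Import topology normedtype derive.

Set Implicit Arguments.
Unset Strict Implicit.
Unset Printing Implicit Defensive.

Import Order.TTheory GRing.Theory Num.Theory.
Import numFieldNormedType.Exports.

Local Open Scope classical_set_scope.
Local Open Scope ring_scope.

Section SmoothMaps.
Variable R : realType.

(* [F] is a total function, but only its germs at points of the open set [V]
   matter. *)
Fixpoint Ck_on (k m n : nat) (V : set 'rV[R]_m) (F : 'rV[R]_m -> 'rV[R]_n)
    : Prop :=
  if k is k'.+1 then
    (forall x, V x -> differentiable F x) /\
    (forall i : 'I_m, Ck_on k' V (fun x => 'D_(delta_mx 0 i) F x))
  else forall x, V x -> {for x, continuous F}.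

Definition smooth_on (m n : nat) (V : set 'rV[R]_m)
    (F : 'rV[R]_m -> 'rV[R]_n) : Prop :=
  forall k, Ck_on k V F.

Lemma smooth_on_cst m n (V : set 'rV[R]_m) (c : 'rV[R]_n) :
  smooth_on V (cst c).
Proof.
move=> k; elim: k c => [|k IHk] c /=; first by move=> x _; exact: cst_continuous.
split=> [x _|i]; first exact: differentiable_cst.
have -> : (fun x => 'D_(delta_mx 0 i) (cst c) x) = cst 0 :> ('rV[R]_m -> _).
  by apply/funext => x /=; rewrite derive_cst.
exact: IHk.
Qed.

Lemma smooth_on_id m (V : set 'rV[R]_m) : smooth_on V id.
Proof.
case=> [|k] /=; first by move=> x _; exact: cvg_id.
split=> [x _|i]; first exact: ex_diff.
have -> : (fun x => 'D_(delta_mx 0 i) id x) = cst (delta_mx 0 i)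
    :> ('rV[R]_m -> _).
  by apply/funext => x /=; rewrite derive_id.
exact: smooth_on_cst.
Qed.

End SmoothMaps.

Section SetType.
Variable T : Type.

Definition set_mk (U : set T) (x : T) (Ux : U x) : U :=
  exist _ x (mem_set Ux).

Definition set_incl (U V : set T) (VU : V `<=` U) (v : V) : U :=
  set_mk (VU _ (set_valP v)).

End SetType.

Section Diffeology.
Variable R : realType.

Record dspace := DSpace {
  dcar :> Type;
  plot : forall (n : nat) (U : set 'rV[R]_n), (U -> dcar) -> Prop;
  plot_open : forall n (U : set 'rV[R]_n) (p : U -> dcar), plot p -> open U;
  plot_cst : forall n (U : set 'rV[R]_n) (x : dcar),
    open U -> plot (fun _ : U => x);
  (* an open cover of [U] is given by one member around each point of [U] *)
  plot_local : forall n (U : set 'rV[R]_n) (p : U -> dcar), open U ->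
    (forall u : U, exists (V : set 'rV[R]_n) (VU : V `<=` U),
      [/\ open V, V (set_val u) & plot (p \o set_incl VU)]) ->
    plot p;
  plot_comp : forall n m (U : set 'rV[R]_n) (V : set 'rV[R]_m)
    (p : U -> dcar) (F : 'rV[R]_m -> 'rV[R]_n)
    (FVU : forall v : V, U (F (set_val v))),
    plot p -> open V -> smooth_on V F -> plot (fun v : V => p (set_mk (FVU v)))
}.

Arguments plot _ {n U}.

Definition smooth (X Y : dspace) (F : X -> Y) : Prop :=
  forall n (U : set 'rV[R]_n) (p : U -> X), plot X p -> plot Y (F \o p).

Definition diffeomorphism (X Y : dspace) (F : X -> Y) : Prop :=
  smooth F /\
  exists G : Y -> X, [/\ smooth G, cancel F G & cancel G F].

Definition subduction (X Y : dspace) (F : X -> Y) : Prop :=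
  [/\ smooth F,
      (forall y, exists x, F x = y) &
      forall n (U : set 'rV[R]_n) (p : U -> Y), plot Y p ->
        forall u : U, exists (V : set 'rV[R]_n) (VU : V `<=` U) (q : V -> X),
          [/\ open V, V (set_val u), plot X q &
              forall v : V, p (set_incl VU v) = F (q v)]].

Lemma plot_restr (X : dspace) n (U V : set 'rV[R]_n) (VU : V `<=` U)
    (p : U -> X) : open V -> plot X p -> plot X (p \o set_incl VU).
Proof.
move=> oV pp; exact: (plot_comp (F := id)
  (fun v : V => VU _ (set_valP v)) pp oV (smooth_on_id _)).
Qed.

Section Sub.
Variables (X : dspace) (P : X -> Prop).

Definition sub_plot n (U : set 'rV[R]_n) (p : U -> {x : X | P x}) : Prop :=
  plot X (fun u => sval (p u)).

Lemma sub_plot_open n (U : set 'rV[R]_n) (p : U -> {x : X | P x}) :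
  sub_plot p -> open U.
Proof. exact: plot_open. Qed.

Lemma sub_plot_cst n (U : set 'rV[R]_n) (x : {x : X | P x}) :
  open U -> sub_plot (fun _ : U => x).
Proof. exact: plot_cst. Qed.

Lemma sub_plot_local n (U : set 'rV[R]_n) (p : U -> {x : X | P x}) :
  open U ->
  (forall u : U, exists (V : set 'rV[R]_n) (VU : V `<=` U),
      [/\ open V, V (set_val u) & sub_plot (p \o set_incl VU)]) ->
  sub_plot p.
Proof. by move=> oU H; apply: plot_local. Qed.

Lemma sub_plot_comp n m (U : set 'rV[R]_n) (V : set 'rV[R]_m)
    (p : U -> {x : X | P x}) (F : 'rV[R]_m -> 'rV[R]_n)
    (FVU : forall v : V, U (F (set_val v))) :
  sub_plot p -> open V -> smooth_on V F ->
  sub_plot (fun v : V => p (set_mk (FVU v))).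
Proof.
by move=> pp oV sF; apply: (plot_comp (p := fun u => sval (p u)) FVU pp).
Qed.

Definition sub_dspace : dspace :=
  DSpace sub_plot_open sub_plot_cst sub_plot_local sub_plot_comp.

End Sub.

Section Prod.
Variables X Y : dspace.

Definition prod_plot n (U : set 'rV[R]_n) (p : U -> X * Y) : Prop :=
  plot X (fun u => (p u).1) /\ plot Y (fun u => (p u).2).

Lemma prod_plot_open n (U : set 'rV[R]_n) (p : U -> X * Y) :
  prod_plot p -> open U.
Proof. by case=> /plot_open. Qed.

Lemma prod_plot_cst n (U : set 'rV[R]_n) (x : X * Y) :
  open U -> prod_plot (fun _ : U => x).
Proof. by move=> oU; split; exact: plot_cst. Qed.

Lemma prod_plot_local n (U : set 'rV[R]_n) (p : U -> X * Y) :
  open U ->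
  (forall u : U, exists (V : set 'rV[R]_n) (VU : V `<=` U),
      [/\ open V, V (set_val u) & prod_plot (p \o set_incl VU)]) ->
  prod_plot p.
Proof.
by move=> oU H; split; apply: plot_local => // u;
  have [V [VU [oV Vu [p1 p2]]]] := H u; exists V, VU.
Qed.

Lemma prod_plot_comp n m (U : set 'rV[R]_n) (V : set 'rV[R]_m)
    (p : U -> X * Y) (F : 'rV[R]_m -> 'rV[R]_n)
    (FVU : forall v : V, U (F (set_val v))) :
  prod_plot p -> open V -> smooth_on V F ->
  prod_plot (fun v : V => p (set_mk (FVU v))).
Proof.
move=> [p1 p2] oV sF; split.
- exact: (plot_comp (p := fun u => (p u).1) FVU p1).
- exact: (plot_comp (p := fun u => (p u).2) FVU p2).
Qed.

Definition prod_dspace : dspace :=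
  DSpace prod_plot_open prod_plot_cst prod_plot_local prod_plot_comp.

End Prod.

Section FibreProduct.
Variables (X Y Z : dspace) (f : X -> Z) (g : Y -> Z).

Definition fprod : dspace :=
  @sub_dspace (prod_dspace X Y) (fun xy => f xy.1 = g xy.2).

Definition fpair (x : X) (y : Y) (e : f x = g y) : fprod := exist _ (x, y) e.
Definition fp1 (z : fprod) : X := (sval z).1.
Definition fp2 (z : fprod) : Y := (sval z).2.
Definition fpE (z : fprod) : f (fp1 z) = g (fp2 z) := svalP z.

End FibreProduct.

Lemma smooth_id (X : dspace) : smooth (@id X).
Proof. by []. Qed.

Lemma smooth_comp (X Y Z : dspace) (F : Y -> Z) (E : X -> Y) :
  smooth F -> smooth E -> smooth (F \o E).
Proof. by move=> sF sE n U p pp; apply: (sF _ _ (E \o p)); apply: sE. Qed.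

Lemma smooth_plot (X Y : dspace) (F : X -> Y) n (U : set 'rV[R]_n) (p : U -> X) :
  smooth F -> plot X p -> plot Y (fun u => F (p u)).
Proof. by move=> sF pp; exact: sF pp. Qed.

Lemma fprod_eq (X Y Z : dspace) (f : X -> Z) (g : Y -> Z) (z w : fprod f g) :
  fp1 z = fp1 w -> fp2 z = fp2 w -> z = w.
Proof.
case: z w => [[z1 z2] ez] [[w1 w2] ew]; rewrite /fp1 /fp2 /= => e1 e2.
by subst; congr exist; exact: Prop_irrelevance.
Qed.

Lemma fpair_irr (X Y Z : dspace) (f : X -> Z) (g : Y -> Z) x y
    (e e' : f x = g y) : fpair e = fpair e'.
Proof. by congr fpair; exact: Prop_irrelevance. Qed.

Lemma fpair_eta (X Y Z : dspace) (f : X -> Z) (g : Y -> Z) (z : fprod f g) :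
  z = fpair (fpE z).
Proof. exact: fprod_eq. Qed.

Lemma smooth_fp1 (X Y Z : dspace) (f : X -> Z) (g : Y -> Z) :
  smooth (@fp1 X Y Z f g).
Proof. by move=> n U p []. Qed.

Lemma smooth_fp2 (X Y Z : dspace) (f : X -> Z) (g : Y -> Z) :
  smooth (@fp2 X Y Z f g).
Proof. by move=> n U p []. Qed.

End Diffeology.

Arguments plot {R} _ {n U}.

Section Groupoids.
Variable R : realType.
Local Notation dspace := (dspace R).

(* [gmul g h] is the arrow "g after h" *)
Record dgroupoid := DGroupoid {
  gob : dspace;
  garr : dspace;
  gsrc : garr -> gob;
  gtgt : garr -> gob;
  gunit : gob -> garr;
  ginv : garr -> garr;
  gmul : forall g h : garr, gsrc g = gtgt h -> garr;
  smooth_gsrc : smooth gsrc;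
  smooth_gtgt : smooth gtgt;
  smooth_gunit : smooth gunit;
  smooth_ginv : smooth ginv;
  smooth_gmul : smooth (fun gh : fprod gsrc gtgt => gmul (fpE gh));
  gsrc_unit : forall x, gsrc (gunit x) = x;
  gtgt_unit : forall x, gtgt (gunit x) = x;
  gsrc_inv : forall g, gsrc (ginv g) = gtgt g;
  gtgt_inv : forall g, gtgt (ginv g) = gsrc g;
  gsrc_mul : forall g h (e : gsrc g = gtgt h), gsrc (gmul e) = gsrc h;
  gtgt_mul : forall g h (e : gsrc g = gtgt h), gtgt (gmul e) = gtgt g;
  gmulA : forall g h k (gh : gsrc g = gtgt h) (hk : gsrc h = gtgt k)
    (gh_k : gsrc (gmul gh) = gtgt k) (g_hk : gsrc g = gtgt (gmul hk)),
    gmul g_hk = gmul gh_k;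
  gmul1l : forall g (e : gsrc (gunit (gtgt g)) = gtgt g), gmul e = g;
  gmul1r : forall g (e : gsrc g = gtgt (gunit (gsrc g))), gmul e = g;
  gmulVl : forall g (e : gsrc (ginv g) = gtgt g), gmul e = gunit (gsrc g);
  gmulVr : forall g (e : gsrc g = gtgt (ginv g)), gmul e = gunit (gtgt g)
}.

(* The multiplication, extended by an irrelevant value to non-composable
   pairs, so that formulas need not carry proofs of composability. *)
Definition gcomp (G : dgroupoid) (g h : garr G) : garr G :=
  if pselect (gsrc g = gtgt h) is left e then gmul e else g.

Local Infix "**" := gcomp (at level 40, left associativity).

Section GroupoidTheory.
Variable G : dgroupoid.
Implicit Types g h k : garr G.

Lemma gcompE g h (e : gsrc g = gtgt h) : g ** h = gmul e.
Proof.
rewrite /gcomp; case: pselect => [e'|//].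
by rewrite (Prop_irrelevance e' e).
Qed.

Lemma gsrc_comp g h : gsrc g = gtgt h -> gsrc (g ** h) = gsrc h.
Proof. by move=> e; rewrite gcompE gsrc_mul. Qed.

Lemma gtgt_comp g h : gsrc g = gtgt h -> gtgt (g ** h) = gtgt g.
Proof. by move=> e; rewrite gcompE gtgt_mul. Qed.

Lemma gcompA g h k : gsrc g = gtgt h -> gsrc h = gtgt k ->
  g ** (h ** k) = g ** h ** k.
Proof.
move=> e1 e2; rewrite (gcompE e1) (gcompE e2).
have e3 : gsrc (gmul e1) = gtgt k by rewrite gsrc_mul.
have e4 : gsrc g = gtgt (gmul e2) by rewrite gtgt_mul.
by rewrite (gcompE e3) (gcompE e4); exact: gmulA.
Qed.

Lemma gcomp1l x g : gtgt g = x -> gunit x ** g = g.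
Proof.
move=> <-; have e : gsrc (gunit (gtgt g)) = gtgt g by rewrite gsrc_unit.
by rewrite (gcompE e) gmul1l.
Qed.

Lemma gcomp1r x g : gsrc g = x -> g ** gunit x = g.
Proof.
move=> <-; have e : gsrc g = gtgt (gunit (gsrc g)) by rewrite gtgt_unit.
by rewrite (gcompE e) gmul1r.
Qed.

Lemma gcompVl g : ginv g ** g = gunit (gsrc g).
Proof. by rewrite (gcompE (gsrc_inv g)) gmulVl. Qed.

Lemma gcompVr g : g ** ginv g = gunit (gtgt g).
Proof. by rewrite (gcompE (esym (gtgt_inv g))) gmulVr. Qed.

Lemma gcomp_idem g : gsrc g = gtgt g -> g ** g = g -> g = gunit (gsrc g).
Proof.
move=> e gg; have := gcompA (gsrc_inv g) e.
by rewrite gg gcompVl gcomp1l // => /esym.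
Qed.

Lemma plot_gcomp n (U : set 'rV[R]_n) (p q : U -> garr G) :
  (forall u, gsrc (p u) = gtgt (q u)) -> plot (garr G) p -> plot (garr G) q ->
  plot (garr G) (fun u => p u ** q u).
Proof.
move=> e pp pq.
have -> : (fun u => p u ** q u) =
   (fun gh : fprod (@gsrc G) (@gtgt G) => gmul (fpE gh)) \o
   (fun u => fpair (e u)).
  by apply/funext => u /=; rewrite (gcompE (e u)); congr gmul;
     exact: Prop_irrelevance.
by apply: smooth_gmul; split.
Qed.

End GroupoidTheory.

Record functor (G H : dgroupoid) := Functor {
  fob : gob G -> gob H;
  far : garr G -> garr H;
  smooth_far : smooth far;
  fsrc : forall g, gsrc (far g) = fob (gsrc g);
  ftgt : forall g, gtgt (far g) = fob (gtgt g);
  funit : forall x, far (gunit x) = gunit (fob x);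
  fcomp : forall g h, gsrc g = gtgt h -> far (g ** h) = far g ** far h
}.

Lemma smooth_fob (G H : dgroupoid) (F : functor G H) : smooth (fob F).
Proof.
move=> n U p pp.
have -> : fob F \o p = (@gsrc H) \o (far F \o (@gunit G \o p)).
  by apply/funext => u /=; rewrite funit gsrc_unit.
exact/smooth_gsrc/smooth_far/smooth_gunit.
Qed.

Lemma far_inv (A B : dgroupoid) (D : functor A B) g :
  far D (ginv g) = ginv (far D g).
Proof.
have e1 : gsrc (far D (ginv g)) = gtgt (far D g).
  by rewrite fsrc ftgt gsrc_inv.
have : (far D (ginv g) ** far D g) ** ginv (far D g) = ginv (far D g).
  rewrite -fcomp ?gsrc_inv // gcompVl funit gcomp1l //.
  by rewrite gtgt_inv fsrc.
rewrite -gcompA ?gtgt_inv // gcompVr gcomp1r // .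
Qed.

Section IdFunctor.
Variable G : dgroupoid.

Definition id_functor : functor G G :=
  @Functor G G id id (@smooth_id R _) (fun=> erefl) (fun=> erefl)
    (fun=> erefl) (fun _ _ _ => erefl).

End IdFunctor.

Section CompFunctor.
Variables (G H K : dgroupoid) (E : functor H K) (F : functor G H).

Lemma comp_functor_smooth : smooth (far E \o far F).
Proof. by move=> n U p pp; apply/(smooth_far E)/(smooth_far F). Qed.

Lemma comp_functor_src g : gsrc ((far E \o far F) g) = (fob E \o fob F) (gsrc g).
Proof. by rewrite /= !fsrc. Qed.

Lemma comp_functor_tgt g : gtgt ((far E \o far F) g) = (fob E \o fob F) (gtgt g).
Proof. by rewrite /= !ftgt. Qed.

Lemma comp_functor_unit x :
  (far E \o far F) (gunit x) = gunit ((fob E \o fob F) x).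
Proof. by rewrite /= !funit. Qed.

Lemma comp_functor_comp g h : gsrc g = gtgt h ->
  (far E \o far F) (g ** h) = (far E \o far F) g ** (far E \o far F) h.
Proof. by move=> e; rewrite /= fcomp // fcomp // fsrc ftgt e. Qed.

Definition comp_functor : functor G K :=
  Functor comp_functor_smooth comp_functor_src comp_functor_tgt
    comp_functor_unit comp_functor_comp.

End CompFunctor.

Section Pullback.
Variables (L M H : dgroupoid) (F : functor L H) (E : functor M H).

Definition pb_ob : dspace := fprod (fob F) (fob E).
Definition pb_arr : dspace := fprod (far F) (far E).

Lemma pb_srcP (g : pb_arr) : fob F (gsrc (fp1 g)) = fob E (gsrc (fp2 g)).
Proof. by rewrite -!fsrc fpE. Qed.
Lemma pb_tgtP (g : pb_arr) : fob F (gtgt (fp1 g)) = fob E (gtgt (fp2 g)).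
Proof. by rewrite -!ftgt fpE. Qed.
Lemma pb_unitP (x : pb_ob) : far F (gunit (fp1 x)) = far E (gunit (fp2 x)).
Proof. by rewrite !funit fpE. Qed.

Lemma pb_invP (g : pb_arr) : far F (ginv (fp1 g)) = far E (ginv (fp2 g)).
Proof. by rewrite !far_inv fpE. Qed.

Definition pb_src (g : pb_arr) : pb_ob := fpair (pb_srcP g).
Definition pb_tgt (g : pb_arr) : pb_ob := fpair (pb_tgtP g).
Definition pb_unit (x : pb_ob) : pb_arr := fpair (pb_unitP x).
Definition pb_inv (g : pb_arr) : pb_arr := fpair (pb_invP g).

Lemma pb_comp1 (g h : pb_arr) : pb_src g = pb_tgt h ->
  gsrc (fp1 g) = gtgt (fp1 h).
Proof. exact: (congr1 (@fp1 _ _ _ _ _ _)). Qed.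
Lemma pb_comp2 (g h : pb_arr) : pb_src g = pb_tgt h ->
  gsrc (fp2 g) = gtgt (fp2 h).
Proof. exact: (congr1 (@fp2 _ _ _ _ _ _)). Qed.

Lemma pb_mulP (g h : pb_arr) (e : pb_src g = pb_tgt h) :
  far F (gmul (pb_comp1 e)) = far E (gmul (pb_comp2 e)).
Proof.
rewrite -!gcompE (fcomp F (pb_comp1 e)) (fcomp E (pb_comp2 e)).
by rewrite (fpE g) (fpE h).
Qed.

Definition pb_mul (g h : pb_arr) (e : pb_src g = pb_tgt h) : pb_arr :=
  fpair (pb_mulP e).

Lemma pb_smooth_src : smooth pb_src.
Proof.
by move=> n U p [p1 p2]; split; [apply: (smooth_gsrc p1)|apply: (smooth_gsrc p2)].
Qed.
Lemma pb_smooth_tgt : smooth pb_tgt.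
Proof.
by move=> n U p [p1 p2]; split; [apply: (smooth_gtgt p1)|apply: (smooth_gtgt p2)].
Qed.
Lemma pb_smooth_unit : smooth pb_unit.
Proof.
by move=> n U p [p1 p2]; split; [apply: (smooth_gunit p1)|apply: (smooth_gunit p2)].
Qed.
Lemma pb_smooth_inv : smooth pb_inv.
Proof.
by move=> n U p [p1 p2]; split; [apply: (smooth_ginv p1)|apply: (smooth_ginv p2)].
Qed.
Lemma pb_smooth_mul : smooth (fun gh : fprod pb_src pb_tgt => pb_mul (fpE gh)).
Proof.
move=> n U p [[p11 p12] [p21 p22]]; split => /=.
- have -> : (fun u => (sval (pb_mul (fpE (p u)))).1) =
    (fun u => fp1 (fp1 (p u)) ** fp1 (fp2 (p u))).
    by apply/funext => u /=; rewrite (gcompE (pb_comp1 (fpE (p u)))).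
  by apply: plot_gcomp => // u; exact: pb_comp1 (fpE (p u)).
- have -> : (fun u => (sval (pb_mul (fpE (p u)))).2) =
    (fun u => fp2 (fp1 (p u)) ** fp2 (fp2 (p u))).
    by apply/funext => u /=; rewrite (gcompE (pb_comp2 (fpE (p u)))).
  by apply: plot_gcomp => // u; exact: pb_comp2 (fpE (p u)).
Qed.

Lemma pb_src_unit x : pb_src (pb_unit x) = x.
Proof. by apply: fprod_eq; exact: gsrc_unit. Qed.
Lemma pb_tgt_unit x : pb_tgt (pb_unit x) = x.
Proof. by apply: fprod_eq; exact: gtgt_unit. Qed.
Lemma pb_src_inv g : pb_src (pb_inv g) = pb_tgt g.
Proof. by apply: fprod_eq; exact: gsrc_inv. Qed.
Lemma pb_tgt_inv g : pb_tgt (pb_inv g) = pb_src g.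
Proof. by apply: fprod_eq; exact: gtgt_inv. Qed.
Lemma pb_src_mul g h (e : pb_src g = pb_tgt h) : pb_src (pb_mul e) = pb_src h.
Proof. by apply: fprod_eq; exact: gsrc_mul. Qed.
Lemma pb_tgt_mul g h (e : pb_src g = pb_tgt h) : pb_tgt (pb_mul e) = pb_tgt g.
Proof. by apply: fprod_eq; exact: gtgt_mul. Qed.
Lemma pb_mulA g h k (gh : pb_src g = pb_tgt h) (hk : pb_src h = pb_tgt k)
    (gh_k : pb_src (pb_mul gh) = pb_tgt k) (g_hk : pb_src g = pb_tgt (pb_mul hk)) :
  pb_mul g_hk = pb_mul gh_k.
Proof. by apply: fprod_eq; exact: gmulA. Qed.
Lemma pb_mul1l g (e : pb_src (pb_unit (pb_tgt g)) = pb_tgt g) : pb_mul e = g.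
Proof. by apply: fprod_eq; exact: gmul1l. Qed.
Lemma pb_mul1r g (e : pb_src g = pb_tgt (pb_unit (pb_src g))) : pb_mul e = g.
Proof. by apply: fprod_eq; exact: gmul1r. Qed.
Lemma pb_mulVl g (e : pb_src (pb_inv g) = pb_tgt g) :
  pb_mul e = pb_unit (pb_src g).
Proof. by apply: fprod_eq; exact: gmulVl. Qed.
Lemma pb_mulVr g (e : pb_src g = pb_tgt (pb_inv g)) :
  pb_mul e = pb_unit (pb_tgt g).
Proof. by apply: fprod_eq; exact: gmulVr. Qed.

Definition pullback : dgroupoid :=
  DGroupoid pb_smooth_src pb_smooth_tgt pb_smooth_unit pb_smooth_inv
    pb_smooth_mul pb_src_unit pb_tgt_unit pb_src_inv pb_tgt_inv pb_src_mul
    pb_tgt_mul pb_mulA pb_mul1l pb_mul1r pb_mulVl pb_mulVr.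

Lemma pb_gcomp (g h : garr pullback) : gsrc g = gtgt h ->
  fp1 (g ** h) = fp1 g ** fp1 h /\ fp2 (g ** h) = fp2 g ** fp2 h.
Proof.
by move=> e; rewrite (gcompE e) (gcompE (pb_comp1 e)) (gcompE (pb_comp2 e)).
Qed.

Definition pr1 : functor pullback L :=
  @Functor pullback L (@fp1 _ _ _ _ _ _) (@fp1 _ _ _ _ _ _)
    (@smooth_fp1 R _ _ _ _ _) (fun=> erefl) (fun=> erefl) (fun=> erefl)
    (fun g h e => proj1 (pb_gcomp e)).
Definition pr2 : functor pullback M :=
  @Functor pullback M (@fp2 _ _ _ _ _ _) (@fp2 _ _ _ _ _ _)
    (@smooth_fp2 R _ _ _ _ _) (fun=> erefl) (fun=> erefl) (fun=> erefl)
    (fun g h e => proj2 (pb_gcomp e)).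

End Pullback.

Record nat_trans (G H : dgroupoid) (F E : functor G H) := NatTrans {
  nt :> gob G -> garr H;
  smooth_nt : smooth nt;
  nt_src : forall x, gsrc (nt x) = fob F x;
  nt_tgt : forall x, gtgt (nt x) = fob E x;
  nt_natural : forall g,
    nt (gtgt g) ** far F g = far E g ** nt (gsrc g)
}.

Section WeakEquivalence.
Variables (G H : dgroupoid) (F : functor G H).

Definition Psi (z : fprod (fob F) (@gtgt H)) : gob H := gsrc (fp2 z).

Definition Phi_cod : dspace :=
  @sub_dspace R (prod_dspace (prod_dspace (gob G) (gob G)) (garr H))
    (fun w => gsrc w.2 = fob F w.1.1 /\ gtgt w.2 = fob F w.1.2).

Definition Phi (g : garr G) : Phi_cod :=
  exist _ (gsrc g, gtgt g, far F g) (conj (fsrc F g) (ftgt F g)).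

Definition weak_equivalence : Prop := subduction Psi /\ diffeomorphism Phi.

Definition subductive_weak_equivalence : Prop :=
  weak_equivalence /\ subduction (fob F).

End WeakEquivalence.

End Groupoids.

Section Anafunctors.
Variable R : realType.
Local Notation dspace := (dspace R).
Local Notation dgroupoid := (dgroupoid R).
Local Infix "**" := gcomp (at level 40, left associativity).

Section Subductions.

Lemma subduction_comp (X Y Z : dspace) (F : Y -> Z) (E : X -> Y) :
  subduction F -> subduction E -> subduction (F \o E).
Proof.
move=> [sF surjF liftF] [sE surjE liftE]; split; first exact: smooth_comp.
- move=> z; have [y <-] := surjF z; have [x <-] := surjE y.
  by exists x.
- move=> n U p pp u; have [V [VU [q [oV Vu pq qP]]]] := liftF _ _ _ pp u.
  have [W [WV [r [oW Wu pr rP]]]] := liftE _ _ _ pq (set_mk Vu).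
  exists W, (subset_trans WV VU), r; split=> // v.
  rewrite /= -rP -qP; congr (p _); exact: val_inj.
Qed.

Lemma subduction_id (X : dspace) : subduction (@id X).
Proof.
split=> // [x|n U p pp u]; first by exists x.
exists U, (@subset_refl _ U), p; split=> //; first exact: plot_open pp.
  exact: set_valP.
by move=> v; congr (p _); exact: val_inj.
Qed.

Lemma subduction_fp1 (X Y Z : dspace) (f : X -> Z) (g : Y -> Z) :
  smooth f -> subduction g -> subduction (@fp1 R X Y Z f g).
Proof.
move=> sf [sg surjg liftg]; split; first exact: smooth_fp1.
- by move=> x; have [y e] := surjg (f x); exists (fpair (esym e)).
- move=> n U p pp u.
  have [V [VU [q [oV Vu pq qP]]]] := liftg _ _ _ (sf _ _ _ pp) u.
  exists V, VU, (fun v : V => fpair (qP v : f (p (set_incl VU v)) = g (q v))).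
  by split=> //; split=> //=; exact: plot_restr.
Qed.

(* To check that a map is a plot, one may first lift a plot along a subduction. *)
Lemma plot_by_lift (X Y Z : dspace) (g : X -> Y) n (U : set 'rV[R]_n)
    (y : U -> Y) (p : U -> Z) :
  subduction g -> plot Y y ->
  (forall (V : set 'rV[R]_n) (VU : V `<=` U) (x : V -> X), open V -> plot X x ->
    (forall v : V, y (set_incl VU v) = g (x v)) ->
    plot Z (p \o set_incl VU)) ->
  plot Z p.
Proof.
move=> [_ _ liftg] py H; apply: plot_local; first exact: plot_open py.
move=> u; have [V [VU [q [oV Vu pq qP]]]] := liftg _ _ _ py u.
by exists V, VU; split=> //; exact: (H _ _ q).
Qed.

End Subductions.

Section Lift.
Variables (G H : dgroupoid) (F : functor G H) (w : weak_equivalence F).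

Definition Phi_inv : Phi_cod F -> garr G := sval (cid (proj2 (proj2 w))).

Lemma Phi_invP :
  [/\ smooth Phi_inv, cancel (Phi F) Phi_inv & cancel Phi_inv (Phi F)].
Proof. exact: svalP (cid (proj2 (proj2 w))). Qed.

Definition Phi_lift (x y : gob G) (h : garr H)
    (es : gsrc h = fob F x) (et : gtgt h = fob F y) : garr G :=
  Phi_inv (exist _ (x, y, h) (conj es et)).

Lemma lift_spec x y h (es : gsrc h = fob F x) (et : gtgt h = fob F y) :
  Phi F (Phi_lift es et) = exist _ (x, y, h) (conj es et).
Proof. by rewrite /Phi_lift; have [_ _ ->] := Phi_invP. Qed.

Lemma gsrc_lift x y h (es : gsrc h = fob F x) (et : gtgt h = fob F y) :
  gsrc (Phi_lift es et) = x.
Proof. by have := congr1 (fun z => (sval z).1.1) (lift_spec es et). Qed.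

Lemma gtgt_lift x y h (es : gsrc h = fob F x) (et : gtgt h = fob F y) :
  gtgt (Phi_lift es et) = y.
Proof. by have := congr1 (fun z => (sval z).1.2) (lift_spec es et). Qed.

Lemma far_lift x y h (es : gsrc h = fob F x) (et : gtgt h = fob F y) :
  far F (Phi_lift es et) = h.
Proof. by have := congr1 (fun z => (sval z).2) (lift_spec es et). Qed.

Lemma weq_inj (g g' : garr G) : gsrc g = gsrc g' -> gtgt g = gtgt g' ->
  far F g = far F g' -> g = g'.
Proof.
move=> e1 e2 e3; have [_ K _] := Phi_invP.
by apply: (can_inj K); apply: eq_exist; rewrite e1 e2 e3.
Qed.

Lemma lift_uniq g x y h (es : gsrc h = fob F x) (et : gtgt h = fob F y) :
  gsrc g = x -> gtgt g = y -> far F g = h -> Phi_lift es et = g.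
Proof.
by move=> e1 e2 e3; apply: weq_inj; rewrite ?gsrc_lift ?gtgt_lift ?far_lift.
Qed.

Lemma plot_lift n (U : set 'rV[R]_n) (x y : U -> gob G) (h : U -> garr H)
    (es : forall u, gsrc (h u) = fob F (x u))
    (et : forall u, gtgt (h u) = fob F (y u)) :
  plot (gob G) x -> plot (gob G) y -> plot (garr H) h ->
  plot (garr G) (fun u => Phi_lift (es u) (et u)).
Proof.
move=> px py ph; have [s _ _] := Phi_invP.
exact: (s _ _ (fun u => exist _ (x u, y u, h u) (conj (es u) (et u)))).
Qed.

End Lift.

Lemma swe_intro (G H : dgroupoid) (F : functor G H) :
  subduction (fob F) -> diffeomorphism (Phi F) -> subductive_weak_equivalence F.
Proof.
move=> subF dF; split=> //; split=> //; split.
- by move=> n U p [p1 p2]; exact: smooth_gsrc p2.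
- move=> y; have [_ surjF _] := subF; have [x e] := surjF y.
  have e' : fob F x = gtgt (gunit y) by rewrite gtgt_unit.
  by exists (fpair e'); rewrite /Psi /= gsrc_unit.
- move=> n U p pp u; have [_ _ liftF] := subF.
  have [V [VU [q [oV Vu pq qP]]]] := liftF _ _ _ pp u.
  have e (v : V) : fob F (q v) = gtgt (gunit (p (set_incl VU v))).
    by rewrite gtgt_unit qP.
  exists V, VU, (fun v => fpair (e v)); split=> //.
    by split=> //=; apply: (smooth_gunit (p := p \o set_incl VU)); apply: plot_restr.
  by move=> v; rewrite /Psi /= gsrc_unit.
Qed.

Lemma smooth_Phi (G H : dgroupoid) (F : functor G H) : smooth (Phi F).
Proof.
move=> n U p pp; split; last exact: smooth_far pp.
by split; [exact: smooth_gsrc pp|exact: smooth_gtgt pp].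
Qed.

Lemma swe_id (G : dgroupoid) : subductive_weak_equivalence (id_functor G).
Proof.
apply: swe_intro; first exact: subduction_id.
split; first exact: smooth_Phi.
exists (fun z : Phi_cod (id_functor G) => (sval z).2); split=> //.
- by move=> n U p [].
- by case=> [[[x y] h] [/= ex ey]]; apply: eq_exist; rewrite /= ex ey.
Qed.

Section SwePullback.
Variables (L M G H : dgroupoid) (F : functor L G) (P : functor L H)
  (E : functor M H).
Hypotheses (wF : subductive_weak_equivalence F)
  (wE : subductive_weak_equivalence E).
Local Notation FP := (comp_functor F (pr1 P E)).

Section Inv.
Variable z : Phi_cod FP.
Let x := (sval z).1.1.
Let y := (sval z).1.2.
Definition pbl1 : garr L :=
  @Phi_lift _ _ _ (proj1 wF) (fp1 x) (fp1 y) _ (proj1 (svalP z)) (proj2 (svalP z)).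

Lemma pbl_src : gsrc (far P pbl1) = fob E (fp2 x).
Proof. by rewrite fsrc gsrc_lift fpE. Qed.
Lemma pbl_tgt : gtgt (far P pbl1) = fob E (fp2 y).
Proof. by rewrite ftgt gtgt_lift fpE. Qed.

Definition pbl2 : garr M := Phi_lift (proj1 wE) pbl_src pbl_tgt.

Lemma pblP : far P pbl1 = far E pbl2.
Proof. by rewrite far_lift. Qed.

Definition pbl : garr (pullback P E) := fpair pblP.
End Inv.

Lemma swe_pullback : subductive_weak_equivalence FP.
Proof.
apply: swe_intro.
  apply: subduction_comp; first exact: (proj2 wF).
  apply: subduction_fp1; [exact: smooth_fob|exact: (proj2 wE)].
split; first exact: smooth_Phi.
exists pbl; split.
- move=> n U p [[[p11 p12] [p21 p22]] ph].
  have p1 : plot (garr L) (fun u => pbl1 (p u)) by exact: plot_lift.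
  split=> //=; apply: plot_lift => //.
  exact: (smooth_far P p1).
- move=> g; have e1 : pbl1 (Phi FP g) = fp1 g by exact: lift_uniq.
  apply: fprod_eq => //; apply: lift_uniq => //.
  by rewrite e1 fpE.
- case=> [[[x y] h] [ex ey]]; apply: eq_exist.
  congr (_, _, _).
  + by apply: fprod_eq; rewrite /= /fp1 /fp2 /= gsrc_lift.
  + by apply: fprod_eq; rewrite /= /fp1 /fp2 /= gtgt_lift.
  + by rewrite /= far_lift.
Qed.

End SwePullback.

Record fspan (G H : dgroupoid) := Span {
  mid : dgroupoid;
  lleg : functor mid G;
  rleg : functor mid H
}.

Definition is_anafunctor (G H : dgroupoid) (s : fspan G H) : Prop :=
  subductive_weak_equivalence (lleg s).

Record anafunctor (G H : dgroupoid) := Anafunctor {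
  ana_span :> fspan G H;
  anaP : is_anafunctor ana_span
}.

Definition ana_weq G H (a : anafunctor G H) : weak_equivalence (lleg a) :=
  proj1 (anaP a).

Definition id_ana (G : dgroupoid) : anafunctor G G :=
  @Anafunctor G G (Span (id_functor G) (id_functor G)) (swe_id G).

(* Compositions are written in diagrammatic order: first [a], then [b]. *)
Definition comp_ana (G H K : dgroupoid) (a : anafunctor G H)
    (b : anafunctor H K) : anafunctor G K :=
  @Anafunctor G K
    (Span (comp_functor (lleg a) (pr1 (rleg a) (lleg b)))
          (comp_functor (rleg b) (pr2 (rleg a) (lleg b))))
    (swe_pullback (rleg a) (anaP a) (anaP b)).

Definition transf (G H : dgroupoid) (a b : anafunctor G H) :=
  nat_trans (comp_functor (rleg a) (pr1 (lleg a) (lleg b)))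
            (comp_functor (rleg b) (pr2 (lleg a) (lleg b))).

Section TransfTheory.
Variables (G H : dgroupoid) (a b : anafunctor G H).
Implicit Types S T : transf a b.

Lemma transf_eq S T : (forall z, S z = T z) -> S = T.
Proof.
case: S T => [S s1 s2 s3 s4] [T t1 t2 t3 t4] /= /funext e; subst T.
by f_equal; exact: Prop_irrelevance.
Qed.

(* naturality of [S] along a pair of arrows with the same image in [G] *)
Lemma transf_natural S (g : garr (mid a)) (g' : garr (mid b))
    (x0 x1 : gob (mid a)) (y0 y1 : gob (mid b)) e0 e1 :
  far (lleg a) g = far (lleg b) g' ->
  gsrc g = x0 -> gtgt g = x1 -> gsrc g' = y0 -> gtgt g' = y1 ->
  S (@fpair _ _ _ _ _ _ x1 y1 e1) ** far (rleg a) g =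
  far (rleg b) g' ** S (@fpair _ _ _ _ _ _ x0 y0 e0).
Proof.
move=> e; have := nt_natural S (@fpair _ _ _ _ _ _ g g' e) => /= nat ex0 ex1 ey0 ey1.
have -> : fpair e1 = pb_tgt (fpair e) by apply: fprod_eq.
have -> : fpair e0 = pb_src (fpair e) by apply: fprod_eq.
exact: nat.
Qed.

Lemma transf_src S x y e : gsrc (S (@fpair _ _ _ _ _ _ x y e)) = fob (rleg a) x.
Proof. exact: nt_src. Qed.
Lemma transf_tgt S x y e : gtgt (S (@fpair _ _ _ _ _ _ x y e)) = fob (rleg b) y.
Proof. exact: nt_tgt. Qed.

End TransfTheory.

End Anafunctors.

Section TwoCells.
Variable R : realType.
Local Notation dspace := (dspace R).
Local Notation dgroupoid := (dgroupoid R).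
Local Infix "**" := gcomp (at level 40, left associativity).

Section ObPreimage.
Variables (G H : dgroupoid) (a : anafunctor G H) (x : gob G).

Lemma ob_preimage_ex : exists k, fob (lleg a) k = x.
Proof. by have [_ surj _] := proj2 (anaP a). Qed.

Definition ob_preimage : gob (mid a) := sval (cid ob_preimage_ex).

Lemma ob_preimageP : fob (lleg a) ob_preimage = x.
Proof. exact: svalP (cid ob_preimage_ex). Qed.

End ObPreimage.

(* smooth functors between the middle groupoids compatible with both legs *)
Record span_map (G H : dgroupoid) (a b : fspan G H) := SpanMap {
  smap :> functor (mid a) (mid b);
  smap_lob : forall k, fob (lleg b) (fob smap k) = fob (lleg a) k;
  smap_lar : forall g, far (lleg b) (far smap g) = far (lleg a) g;
  smap_rob : forall k, fob (rleg b) (fob smap k) = fob (rleg a) k;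
  smap_rar : forall g, far (rleg b) (far smap g) = far (rleg a) g
}.

Section Induced.
Variables (G H : dgroupoid) (a b : anafunctor G H) (m : span_map a b).

Section At.
Variable z : fprod (fob (lleg a)) (fob (lleg b)).

Lemma induced_src : gsrc (gunit (fob (lleg b) (fp2 z))) =
  fob (lleg b) (fob m (fp1 z)).
Proof. by rewrite gsrc_unit smap_lob fpE. Qed.

Lemma induced_tgt : gtgt (gunit (fob (lleg b) (fp2 z))) =
  fob (lleg b) (fp2 z).
Proof. by rewrite gtgt_unit. Qed.

Definition induced_fun : garr H :=
  far (rleg b) (Phi_lift (ana_weq b) induced_src induced_tgt).
End At.

Lemma induced_smooth :
  @smooth R (gob (pullback (lleg a) (lleg b))) (garr H) induced_fun.
Proof.
move=> n U p [p1 p2]; apply: (smooth_plot (smooth_far (rleg b))).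
apply: plot_lift => //; first exact: (smooth_plot (smooth_fob m) p1).
apply: (smooth_plot (@smooth_gunit R G)).
exact: (smooth_plot (smooth_fob (lleg b)) p2).
Qed.

Lemma induced_fun_src z : gsrc (induced_fun z) = fob (rleg a) (fp1 z).
Proof. by rewrite fsrc gsrc_lift smap_rob. Qed.

Lemma induced_fun_tgt z : gtgt (induced_fun z) = fob (rleg b) (fp2 z).
Proof. by rewrite ftgt gtgt_lift. Qed.

Lemma induced_natural (g : garr (pullback (lleg a) (lleg b))) :
  induced_fun (gtgt g) ** far (rleg a) (fp1 g) =
  far (rleg b) (fp2 g) ** induced_fun (gsrc g).
Proof.
rewrite -(smap_rar m) -!fcomp ?gsrc_lift ?gtgt_lift ?ftgt //; congr far.
have c1 : gsrc (Phi_lift (ana_weq b) (induced_src (gtgt g)) (induced_tgt (gtgt g)))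
  = gtgt (far m (fp1 g)) by rewrite gsrc_lift ftgt.
have c2 : gsrc (fp2 g) =
  gtgt (Phi_lift (ana_weq b) (induced_src (gsrc g)) (induced_tgt (gsrc g))).
  by rewrite gtgt_lift.
apply: (weq_inj (ana_weq b)).
- by rewrite !gsrc_comp // gsrc_lift fsrc.
- by rewrite !gtgt_comp // gtgt_lift.
- rewrite !fcomp // !far_lift smap_lar (fpE g) gcomp1l ?gcomp1r //.
  + by rewrite fsrc.
  + by rewrite ftgt.
Qed.

Definition induced : transf a b :=
  @NatTrans R _ _ (comp_functor (rleg a) (pr1 (lleg a) (lleg b)))
     (comp_functor (rleg b) (pr2 (lleg a) (lleg b)))
     induced_fun induced_smooth induced_fun_src induced_fun_tgt induced_natural.

End Induced.

Definition id_span_map (G H : dgroupoid) (a : fspan G H) : span_map a a :=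
  @SpanMap G H a a (id_functor (mid a)) (fun=> erefl) (fun=> erefl)
    (fun=> erefl) (fun=> erefl).

(* At [(y1, y2)] this is the image under [rleg a] of the lift of the unit at
   [lleg a y2], which is also the unit at [lleg a y1]. *)
Definition id_transf (G H : dgroupoid) (a : anafunctor G H) : transf a a :=
  induced (id_span_map a).

Section Vertical.
Variables (G H : dgroupoid) (a b c : anafunctor G H).
Variables (S : transf a b) (T : transf b c).

Lemma vcomp_midP (z : fprod (fob (lleg a)) (fob (lleg c))) (y : gob (mid b)) :
  fob (lleg a) (fp1 z) = fob (lleg b) y -> fob (lleg b) y = fob (lleg c) (fp2 z).
Proof. by move=> <-; exact: fpE. Qed.

(* The composite at [z = (k, k'')] through an object [y] of the middle
   groupoid of [b]. *)
Definition vcomp_at z y (e : fob (lleg a) (fp1 z) = fob (lleg b) y) : garr H :=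
  T (fpair (vcomp_midP e)) ** S (fpair e).

Definition vcomp_fun z : garr H :=
  vcomp_at (esym (ob_preimageP b (fob (lleg a) (fp1 z))) :
    fob (lleg a) (fp1 z) = _).

Lemma vcomp_at_indep z y y' (e : fob (lleg a) (fp1 z) = fob (lleg b) y)
    (e' : fob (lleg a) (fp1 z) = fob (lleg b) y') : vcomp_at e = vcomp_at e'.
Proof.
rewrite /vcomp_at.
have es : gsrc (gunit (fob (lleg a) (fp1 z))) = fob (lleg b) y.
  by rewrite gsrc_unit.
have et : gtgt (gunit (fob (lleg a) (fp1 z))) = fob (lleg b) y'.
  by rewrite gtgt_unit.
pose g := Phi_lift (ana_weq b) es et.
have gs : gsrc g = y by rewrite gsrc_lift.
have gt : gtgt g = y' by rewrite gtgt_lift.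
have Sg := transf_natural S (g := gunit (fp1 z)) (g' := g) e e'
  ltac:(by rewrite funit far_lift) (gsrc_unit _) (gtgt_unit _) gs gt.
have Tg := transf_natural T (g := g) (g' := gunit (fp2 z))
   (vcomp_midP e) (vcomp_midP e')
   ltac:(by rewrite funit far_lift fpE) gs gt (gsrc_unit _) (gtgt_unit _).
move: Sg Tg; rewrite !funit => Sg Tg.
have S1 : S (fpair e') = far (rleg b) g ** S (fpair e).
  by rewrite -Sg gcomp1r // transf_src.
have T1 : T (fpair (vcomp_midP e)) = T (fpair (vcomp_midP e')) ** far (rleg b) g.
  by rewrite Tg gcomp1l // transf_tgt.
rewrite S1 T1 gcompA //; first by rewrite transf_src ftgt gt.
by rewrite transf_tgt fsrc gs.
Qed.

Lemma vcomp_funE x y k (e : fob (lleg a) x = fob (lleg c) k)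
   (e1 : fob (lleg a) x = fob (lleg b) y) (e2 : fob (lleg b) y = fob (lleg c) k) :
  vcomp_fun (fpair e) = T (fpair e2) ** S (fpair e1).
Proof.
rewrite /vcomp_fun (vcomp_at_indep _ (e1 : fob (lleg a) (fp1 (fpair e)) = _)).
by rewrite /vcomp_at; congr (T _ ** _); exact: fpair_irr.
Qed.

Lemma vcomp_smooth :
  @smooth R (gob (pullback (lleg a) (lleg c))) (garr H) vcomp_fun.
Proof.
move=> n U p [p1 p2].
apply: (plot_by_lift (proj2 (anaP b)) (smooth_plot (smooth_fob (lleg a)) p1)).
move=> V VU q oV pq qP.
have -> : (vcomp_fun \o p) \o set_incl VU = (fun v => vcomp_at (qP v)).
  by apply/funext => v; exact: vcomp_at_indep.
apply: plot_gcomp.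
- by move=> v; rewrite transf_src transf_tgt.
- apply: (smooth_plot (smooth_nt T)); split=> //=; exact: plot_restr p2.
- apply: (smooth_plot (smooth_nt S)); split=> //=; exact: plot_restr p1.
Qed.

Lemma vcomp_src z : gsrc (vcomp_fun z) = fob (rleg a) (fp1 z).
Proof.
rewrite /vcomp_fun /vcomp_at gsrc_comp ?transf_src //.
by rewrite transf_tgt.
Qed.

Lemma vcomp_tgt z : gtgt (vcomp_fun z) = fob (rleg c) (fp2 z).
Proof.
rewrite /vcomp_fun /vcomp_at gtgt_comp ?transf_tgt //.
by rewrite transf_src.
Qed.

Lemma vcomp_natural (g : garr (pullback (lleg a) (lleg c))) :
  vcomp_fun (gtgt g) ** far (rleg a) (fp1 g) =
  far (rleg c) (fp2 g) ** vcomp_fun (gsrc g).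
Proof.
rewrite /vcomp_fun /vcomp_at.
set e1 := esym _; set e0 := esym _.
set y1 := ob_preimage b _ in e1 *; set y0 := ob_preimage b _ in e0 *.
have es : gsrc (far (lleg a) (fp1 g)) = fob (lleg b) y0.
  by rewrite fsrc ob_preimageP.
have et : gtgt (far (lleg a) (fp1 g)) = fob (lleg b) y1.
  by rewrite ftgt ob_preimageP.
pose h := Phi_lift (ana_weq b) es et.
have hs : gsrc h = y0 by rewrite gsrc_lift.
have ht : gtgt h = y1 by rewrite gtgt_lift.
have Sh := transf_natural S (g := fp1 g) (g' := h) e0 e1
  ltac:(by rewrite far_lift) erefl erefl hs ht.
have Th := transf_natural T (g := h) (g' := fp2 g)
   (vcomp_midP e0) (vcomp_midP e1)
   ltac:(by rewrite far_lift fpE) hs ht erefl erefl.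
rewrite -gcompA ?Sh; last 2 first.
- by rewrite transf_src transf_tgt.
- by rewrite transf_src ftgt.
rewrite gcompA ?Th; last 2 first.
- by rewrite transf_src ftgt ht.
- by rewrite transf_tgt fsrc hs.
rewrite gcompA //; first by rewrite transf_tgt fsrc.
by rewrite transf_src transf_tgt.
Qed.

Definition vcomp : transf a c :=
  @NatTrans R _ _ (comp_functor (rleg a) (pr1 (lleg a) (lleg c)))
     (comp_functor (rleg c) (pr2 (lleg a) (lleg c)))
     vcomp_fun vcomp_smooth vcomp_src vcomp_tgt vcomp_natural.

End Vertical.

Section Horizontal.
Variables (G H K : dgroupoid).
Variables (a a' : anafunctor G H) (b b' : anafunctor H K).
Variables (S : transf a a') (T : transf b b').

Section At.
Variable z : fprod (fob (lleg (comp_ana a b))) (fob (lleg (comp_ana a' b'))).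
(* [z = ((l, m), (l', m'))] *)
Let l : gob (mid a) := fp1 (fp1 z).
Let m : gob (mid b) := fp2 (fp1 z).
Let l' : gob (mid a') := fp1 (fp2 z).
Let m' : gob (mid b') := fp2 (fp2 z).
Let ll' : fob (lleg a) l = fob (lleg a') l' := fpE z.

Section Through.
Variables (m'' : gob (mid b')) (e : fob (lleg b) m = fob (lleg b') m'').

Lemma hcomp_lift_src : gsrc (S (fpair ll')) = fob (lleg b') m''.
Proof. by rewrite transf_src -e; exact: (fpE (fp1 z)). Qed.

Lemma hcomp_lift_tgt : gtgt (S (fpair ll')) = fob (lleg b') m'.
Proof. by rewrite transf_tgt; exact: (fpE (fp2 z)). Qed.

Definition hcomp_at : garr K :=
  far (rleg b') (Phi_lift (ana_weq b') hcomp_lift_src hcomp_lift_tgt) **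
  T (fpair e).
End Through.

Definition hcomp_fun : garr K :=
  hcomp_at (esym (ob_preimageP b' (fob (lleg b) m))).

Lemma hcomp_at_comp m'' (e : fob (lleg b) m = fob (lleg b') m'') :
  gsrc (far (rleg b') (Phi_lift (ana_weq b') (hcomp_lift_src e) hcomp_lift_tgt)) =
  gtgt (T (fpair e)).
Proof. by rewrite fsrc gsrc_lift transf_tgt. Qed.

Lemma hcomp_at_indep m1 m2 (e1 : fob (lleg b) m = fob (lleg b') m1)
    (e2 : fob (lleg b) m = fob (lleg b') m2) : hcomp_at e1 = hcomp_at e2.
Proof.
have es : gsrc (gunit (fob (lleg b) m)) = fob (lleg b') m1.
  by rewrite gsrc_unit.
have et : gtgt (gunit (fob (lleg b) m)) = fob (lleg b') m2.
  by rewrite gtgt_unit.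
pose g := Phi_lift (ana_weq b') es et.
have gs : gsrc g = m1 by rewrite gsrc_lift.
have gt : gtgt g = m2 by rewrite gtgt_lift.
have Tg := transf_natural T (g := gunit m) (g' := g) e1 e2
  ltac:(by rewrite funit far_lift) (gsrc_unit _) (gtgt_unit _) gs gt.
rewrite funit gcomp1r ?transf_src // in Tg.
rewrite /hcomp_at Tg gcompA; last 2 first.
- by rewrite fsrc gsrc_lift ftgt gt.
- by rewrite transf_tgt fsrc gs.
rewrite -fcomp ?gsrc_lift ?gt //; congr (far _ _ ** _).
have c : gsrc (Phi_lift (ana_weq b') (hcomp_lift_src e2) hcomp_lift_tgt) = gtgt g.
  by rewrite gsrc_lift.
apply: lift_uniq.
- by rewrite gsrc_comp.
- by rewrite gtgt_comp // gtgt_lift.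
- rewrite fcomp // !far_lift gcomp1r // transf_src; exact: (fpE (fp1 z)).
Qed.

End At.

Lemma hcomp_smooth :
  @smooth R (gob (pullback (lleg (comp_ana a b)) (lleg (comp_ana a' b'))))
    (garr K) hcomp_fun.
Proof.
move=> n U p [[p11 p12] [p21 p22]].
apply: (plot_by_lift (proj2 (anaP b')) (smooth_plot (smooth_fob (lleg b)) p12)).
move=> V VU q oV pq qP.
have -> : (hcomp_fun \o p) \o set_incl VU = (fun v => hcomp_at (qP v)).
  by apply/funext => v; exact: hcomp_at_indep.
apply: plot_gcomp.
- by move=> v; exact: hcomp_at_comp.
- apply: (smooth_plot (smooth_far (rleg b'))); apply: plot_lift => //.
  + exact: (plot_restr VU oV p22).
  + apply: (smooth_plot (smooth_nt S)); split=> //=.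
    * exact: (plot_restr VU oV p11).
    * exact: (plot_restr VU oV p21).
- apply: (smooth_plot (smooth_nt T)); split=> //=.
  exact: (plot_restr VU oV p12).
Qed.

Lemma hcomp_src z : gsrc (hcomp_fun z) = fob (rleg b) (fp2 (fp1 z)).
Proof. by rewrite /hcomp_fun /hcomp_at gsrc_comp ?hcomp_at_comp // transf_src. Qed.

Lemma hcomp_tgt z : gtgt (hcomp_fun z) = fob (rleg b') (fp2 (fp2 z)).
Proof.
by rewrite /hcomp_fun /hcomp_at gtgt_comp ?hcomp_at_comp // ftgt gtgt_lift.
Qed.

Lemma hcomp_natural
    (g : garr (pullback (lleg (comp_ana a b)) (lleg (comp_ana a' b')))) :
  hcomp_fun (gtgt g) ** far (rleg b) (fp2 (fp1 g)) =
  far (rleg b') (fp2 (fp2 g)) ** hcomp_fun (gsrc g).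
Proof.
rewrite /hcomp_fun.
set e1 := esym _; set e0 := esym _.
set y1 := ob_preimage b' _ in e1 *; set y0 := ob_preimage b' _ in e0 *.
have es : gsrc (far (lleg b) (fp2 (fp1 g))) = fob (lleg b') y0.
  by rewrite fsrc ob_preimageP.
have et : gtgt (far (lleg b) (fp2 (fp1 g))) = fob (lleg b') y1.
  by rewrite ftgt ob_preimageP.
pose h := Phi_lift (ana_weq b') es et.
have hs : gsrc h = y0 by rewrite gsrc_lift.
have ht : gtgt h = y1 by rewrite gtgt_lift.
have Th := transf_natural T (g := fp2 (fp1 g)) (g' := h) e0 e1
  ltac:(by rewrite far_lift) erefl erefl hs ht.
have Sg := transf_natural S (g := fp1 (fp1 g)) (g' := fp1 (fp2 g))
  (fpE (gsrc g)) (fpE (gtgt g)) (fpE g) erefl erefl erefl erefl.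
have c1 := hcomp_at_comp e1.
have c0 := hcomp_at_comp e0.
rewrite /hcomp_at -gcompA ?Th //; last by rewrite transf_src ftgt.
rewrite gcompA; last 2 first.
- by rewrite fsrc gsrc_lift ftgt ht.
- by rewrite transf_tgt fsrc hs.
rewrite gcompA //; last by rewrite ftgt gtgt_lift fsrc.
have d1 : gsrc (Phi_lift (ana_weq b') (hcomp_lift_src e1) (hcomp_lift_tgt (gtgt g)))
   = gtgt h by rewrite gsrc_lift ht.
have d0 : gsrc (fp2 (fp2 g)) =
   gtgt (Phi_lift (ana_weq b') (hcomp_lift_src e0) (hcomp_lift_tgt (gsrc g))).
  by rewrite gtgt_lift.
congr (_ ** _); rewrite -!fcomp //; congr far.
apply: (weq_inj (ana_weq b')).
- by rewrite !gsrc_comp // hs gsrc_lift.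
- by rewrite !gtgt_comp // gtgt_lift.
- rewrite !fcomp // !far_lift -(fpE (fp1 g)) -(fpE (fp2 g)); exact: Sg.
Qed.

Definition hcomp : transf (comp_ana a b) (comp_ana a' b') :=
  @NatTrans R _ _
     (comp_functor (rleg (comp_ana a b))
        (pr1 (lleg (comp_ana a b)) (lleg (comp_ana a' b'))))
     (comp_functor (rleg (comp_ana a' b'))
        (pr2 (lleg (comp_ana a b)) (lleg (comp_ana a' b'))))
     hcomp_fun hcomp_smooth hcomp_src hcomp_tgt hcomp_natural.

End Horizontal.

End TwoCells.

(* All compositions are in diagrammatic order. *)
Record bicat_data := BicatData {
  cell0 : Type;
  cell1 : cell0 -> cell0 -> Type;
  cell2 : forall A B : cell0, cell1 A B -> cell1 A B -> Type;
  bid1 : forall A, cell1 A A;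
  bcomp1 : forall A B C, cell1 A B -> cell1 B C -> cell1 A C;
  bid2 : forall A B (f : cell1 A B), cell2 f f;
  bvcomp : forall A B (f g h : cell1 A B), cell2 f g -> cell2 g h -> cell2 f h;
  bhcomp : forall A B C (f f' : cell1 A B) (g g' : cell1 B C),
    cell2 f f' -> cell2 g g' -> cell2 (bcomp1 f g) (bcomp1 f' g');
  bassoc : forall A B C D (f : cell1 A B) (g : cell1 B C) (h : cell1 C D),
    cell2 (bcomp1 (bcomp1 f g) h) (bcomp1 f (bcomp1 g h));
  blunit : forall A B (f : cell1 A B), cell2 (bcomp1 (bid1 A) f) f;
  brunit : forall A B (f : cell1 A B), cell2 (bcomp1 f (bid1 B)) f
}.

Definition inverse2 (B : bicat_data) (X Y : cell0 B) (f g : cell1 X Y)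
    (s : cell2 f g) (t : cell2 g f) : Prop :=
  bvcomp s t = bid2 f /\ bvcomp t s = bid2 g.

Definition invertible2 (B : bicat_data) (X Y : cell0 B) (f g : cell1 X Y)
    (s : cell2 f g) : Prop :=
  exists t, inverse2 s t.

Record is_bicategory (B : bicat_data) : Prop := IsBicategory {
  bvcompA : forall (X Y : cell0 B) (f g h k : cell1 X Y)
    (s : cell2 f g) (t : cell2 g h) (u : cell2 h k),
    bvcomp s (bvcomp t u) = bvcomp (bvcomp s t) u;
  bvcomp1l : forall (X Y : cell0 B) (f g : cell1 X Y) (s : cell2 f g),
    bvcomp (bid2 f) s = s;
  bvcomp1r : forall (X Y : cell0 B) (f g : cell1 X Y) (s : cell2 f g),
    bvcomp s (bid2 g) = s;
  bhcomp_id : forall (X Y Z : cell0 B) (f : cell1 X Y) (g : cell1 Y Z),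
    bhcomp (bid2 f) (bid2 g) = bid2 (bcomp1 f g);
  bhcomp_vcomp : forall (X Y Z : cell0 B) (f f' f'' : cell1 X Y)
    (g g' g'' : cell1 Y Z) (s : cell2 f f') (s' : cell2 f' f'')
    (t : cell2 g g') (t' : cell2 g' g''),
    bhcomp (bvcomp s s') (bvcomp t t') = bvcomp (bhcomp s t) (bhcomp s' t');
  bassoc_natural : forall (X Y Z W : cell0 B) (f f' : cell1 X Y)
    (g g' : cell1 Y Z) (h h' : cell1 Z W)
    (s : cell2 f f') (t : cell2 g g') (u : cell2 h h'),
    bvcomp (bhcomp (bhcomp s t) u) (bassoc f' g' h') =
    bvcomp (bassoc f g h) (bhcomp s (bhcomp t u));
  blunit_natural : forall (X Y : cell0 B) (f f' : cell1 X Y) (s : cell2 f f'),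
    bvcomp (bhcomp (bid2 (bid1 X)) s) (blunit f') = bvcomp (blunit f) s;
  brunit_natural : forall (X Y : cell0 B) (f f' : cell1 X Y) (s : cell2 f f'),
    bvcomp (bhcomp s (bid2 (bid1 Y))) (brunit f') = bvcomp (brunit f) s;
  bassoc_invertible : forall (X Y Z W : cell0 B) (f : cell1 X Y)
    (g : cell1 Y Z) (h : cell1 Z W), invertible2 (bassoc f g h);
  blunit_invertible : forall (X Y : cell0 B) (f : cell1 X Y),
    invertible2 (blunit f);
  brunit_invertible : forall (X Y : cell0 B) (f : cell1 X Y),
    invertible2 (brunit f);
  bpentagon : forall (X Y Z W V : cell0 B) (f : cell1 X Y) (g : cell1 Y Z)
    (h : cell1 Z W) (k : cell1 W V),
    bvcomp (bassoc (bcomp1 f g) h k) (bassoc f g (bcomp1 h k)) =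
    bvcomp (bvcomp (bhcomp (bassoc f g h) (bid2 k)) (bassoc f (bcomp1 g h) k))
           (bhcomp (bid2 f) (bassoc g h k));
  btriangle : forall (X Y Z : cell0 B) (f : cell1 X Y) (g : cell1 Y Z),
    bhcomp (brunit f) (bid2 g) =
    bvcomp (bassoc f (bid1 Y) g) (bhcomp (bid2 f) (blunit g))
}.

Record bicategory := Bicategory {
  bicat_of :> bicat_data;
  bicatP : is_bicategory bicat_of
}.

Section DGpoidAna.
Variable R : realType.
Local Notation dspace := (dspace R).
Local Notation dgroupoid := (dgroupoid R).
Local Infix "**" := gcomp (at level 40, left associativity).

Section CoherenceMaps.

Section Assoc.
Variables (A B C D : dgroupoid).
Variables (a : anafunctor A B) (b : anafunctor B C) (c : anafunctor C D).
Local Notation src := (comp_ana (comp_ana a b) c).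
Local Notation tgt := (comp_ana a (comp_ana b c)).

Definition assoc_ob (z : gob (mid src)) : gob (mid tgt) :=
  @fpair R _ _ _ (fob (rleg a)) (fob (lleg (comp_ana b c)))
    (fp1 (fp1 z)) (@fpair R _ _ _ (fob (rleg b)) (fob (lleg c))
                     (fp2 (fp1 z)) (fp2 z) (fpE z)) (fpE (fp1 z)).
Definition assoc_ar (z : garr (mid src)) : garr (mid tgt) :=
  @fpair R _ _ _ (far (rleg a)) (far (lleg (comp_ana b c)))
    (fp1 (fp1 z)) (@fpair R _ _ _ (far (rleg b)) (far (lleg c))
                     (fp2 (fp1 z)) (fp2 z) (fpE z)) (fpE (fp1 z)).
Definition assocV_ob (z : gob (mid tgt)) : gob (mid src) :=
  @fpair R _ _ _ (fob (rleg (comp_ana a b))) (fob (lleg c))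
    (@fpair R _ _ _ (fob (rleg a)) (fob (lleg b))
                     (fp1 z) (fp1 (fp2 z)) (fpE z))
    (fp2 (fp2 z)) (fpE (fp2 z)).
Definition assocV_ar (z : garr (mid tgt)) : garr (mid src) :=
  @fpair R _ _ _ (far (rleg (comp_ana a b))) (far (lleg c))
    (@fpair R _ _ _ (far (rleg a)) (far (lleg b))
                     (fp1 z) (fp1 (fp2 z)) (fpE z))
    (fp2 (fp2 z)) (fpE (fp2 z)).

Lemma assoc_smooth : smooth assoc_ar.
Proof. by move=> n U p [[p1 p2] p3]; split=> //; split. Qed.
Lemma assocV_smooth : smooth assocV_ar.
Proof. by move=> n U p [p1 [p2 p3]]; split=> //; split. Qed.
Lemma assoc_src g : gsrc (assoc_ar g) = assoc_ob (gsrc g).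
Proof. by apply: fprod_eq => //; apply: fprod_eq. Qed.
Lemma assoc_tgt g : gtgt (assoc_ar g) = assoc_ob (gtgt g).
Proof. by apply: fprod_eq => //; apply: fprod_eq. Qed.
Lemma assocV_src g : gsrc (assocV_ar g) = assocV_ob (gsrc g).
Proof. by apply: fprod_eq => //; apply: fprod_eq. Qed.
Lemma assocV_tgt g : gtgt (assocV_ar g) = assocV_ob (gtgt g).
Proof. by apply: fprod_eq => //; apply: fprod_eq. Qed.
Lemma assoc_unit x : assoc_ar (gunit x) = gunit (assoc_ob x).
Proof. by apply: fprod_eq => //; apply: fprod_eq. Qed.
Lemma assocV_unit x : assocV_ar (gunit x) = gunit (assocV_ob x).
Proof. by apply: fprod_eq => //; apply: fprod_eq. Qed.

Lemma assoc_comp g h : gsrc g = gtgt h ->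
  assoc_ar (g ** h) = assoc_ar g ** assoc_ar h.
Proof.
move=> e; have [e1 e2] := pb_gcomp e.
have [e3 e4] := pb_gcomp (pb_comp1 e).
have f : gsrc (assoc_ar g) = gtgt (assoc_ar h).
  by rewrite assoc_src assoc_tgt e.
have [f1 f2] := pb_gcomp f; have [f3 f4] := pb_gcomp (pb_comp2 f).
apply: fprod_eq; first by rewrite f1 -e3 -e1.
by rewrite f2; apply: fprod_eq; [rewrite f3 -e4 -e1|rewrite f4 -e2].
Qed.

Lemma assocV_comp g h : gsrc g = gtgt h ->
  assocV_ar (g ** h) = assocV_ar g ** assocV_ar h.
Proof.
move=> e; have [e1 e2] := pb_gcomp e.
have [e3 e4] := pb_gcomp (pb_comp2 e).
have f : gsrc (assocV_ar g) = gtgt (assocV_ar h).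
  by rewrite assocV_src assocV_tgt e.
have [f1 f2] := pb_gcomp f; have [f3 f4] := pb_gcomp (pb_comp1 f).
apply: fprod_eq; last by rewrite f2 -e4 -e2.
by rewrite f1; apply: fprod_eq; [rewrite f3 -e1|rewrite f4 -e3 -e2].
Qed.

Definition assoc_map : span_map src tgt :=
  @SpanMap R _ _ src tgt
    (Functor assoc_smooth assoc_src assoc_tgt assoc_unit assoc_comp)
    (fun=> erefl) (fun=> erefl) (fun=> erefl) (fun=> erefl).

Definition assocV_map : span_map tgt src :=
  @SpanMap R _ _ tgt src
    (Functor assocV_smooth assocV_src assocV_tgt assocV_unit assocV_comp)
    (fun=> erefl) (fun=> erefl) (fun=> erefl) (fun=> erefl).

Definition assoc_transf : transf src tgt := induced assoc_map.

End Assoc.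

Section Unitors.
Variables (A B : dgroupoid) (a : anafunctor A B).
Local Notation al := (comp_ana (id_ana A) a).
Local Notation ar := (comp_ana a (id_ana B)).

Lemma lunit_map_lob (k : gob (mid al)) :
  fob (lleg a) (fob (pr2 _ _) k) = fob (lleg al) k.
Proof. exact/esym/(fpE k). Qed.
Lemma lunit_map_lar (g : garr (mid al)) :
  far (lleg a) (far (pr2 _ _) g) = far (lleg al) g.
Proof. exact/esym/(fpE g). Qed.

Definition lunit_map : span_map al a :=
  @SpanMap R _ _ al a (pr2 _ _) lunit_map_lob lunit_map_lar
    (fun=> erefl) (fun=> erefl).

Lemma runit_map_rob (k : gob (mid ar)) :
  fob (rleg a) (fob (pr1 _ _) k) = fob (rleg ar) k.
Proof. exact: (fpE k). Qed.
Lemma runit_map_rar (g : garr (mid ar)) :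
  far (rleg a) (far (pr1 _ _) g) = far (rleg ar) g.
Proof. exact: (fpE g). Qed.

Definition runit_map : span_map ar a :=
  @SpanMap R _ _ ar a (pr1 _ _) (fun=> erefl) (fun=> erefl)
    runit_map_rob runit_map_rar.

Definition lunit_transf : transf al a := induced lunit_map.
Definition runit_transf : transf ar a := induced runit_map.

Definition lunitV_ob (k : gob (mid a)) : gob (mid al) :=
  @fpair R _ _ _ id (fob (lleg a)) (fob (lleg a) k) k erefl.
Definition lunitV_ar (k : garr (mid a)) : garr (mid al) :=
  @fpair R _ _ _ id (far (lleg a)) (far (lleg a) k) k erefl.
Lemma lunitV_smooth : smooth lunitV_ar.
Proof. by move=> n U p pp; split=> //; exact: (smooth_far (lleg a) pp). Qed.
Lemma lunitV_src g : gsrc (lunitV_ar g) = lunitV_ob (gsrc g).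
Proof. by apply: fprod_eq => //; exact: fsrc. Qed.
Lemma lunitV_tgt g : gtgt (lunitV_ar g) = lunitV_ob (gtgt g).
Proof. by apply: fprod_eq => //; exact: ftgt. Qed.
Lemma lunitV_unit x : lunitV_ar (gunit x) = gunit (lunitV_ob x).
Proof. by apply: fprod_eq => //; exact: funit. Qed.
Lemma lunitV_comp g h : gsrc g = gtgt h ->
  lunitV_ar (g ** h) = lunitV_ar g ** lunitV_ar h.
Proof.
move=> e; have f : gsrc (lunitV_ar g) = gtgt (lunitV_ar h).
  by rewrite lunitV_src lunitV_tgt e.
have [f1 f2] := pb_gcomp f.
by apply: fprod_eq; rewrite ?f1 ?f2 //; exact: fcomp.
Qed.

Definition lunitV_map : span_map a al :=
  @SpanMap R _ _ a al
    (Functor lunitV_smooth lunitV_src lunitV_tgt lunitV_unit lunitV_comp)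
    (fun=> erefl) (fun=> erefl) (fun=> erefl) (fun=> erefl).

Definition runitV_ob (k : gob (mid a)) : gob (mid ar) :=
  @fpair R _ _ _ (fob (rleg a)) id k (fob (rleg a) k) erefl.
Definition runitV_ar (k : garr (mid a)) : garr (mid ar) :=
  @fpair R _ _ _ (far (rleg a)) id k (far (rleg a) k) erefl.
Lemma runitV_smooth : smooth runitV_ar.
Proof. by move=> n U p pp; split=> //; exact: (smooth_far (rleg a) pp). Qed.
Lemma runitV_src g : gsrc (runitV_ar g) = runitV_ob (gsrc g).
Proof. by apply: fprod_eq => //; exact: fsrc. Qed.
Lemma runitV_tgt g : gtgt (runitV_ar g) = runitV_ob (gtgt g).
Proof. by apply: fprod_eq => //; exact: ftgt. Qed.
Lemma runitV_unit x : runitV_ar (gunit x) = gunit (runitV_ob x).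
Proof. by apply: fprod_eq => //; exact: funit. Qed.
Lemma runitV_comp g h : gsrc g = gtgt h ->
  runitV_ar (g ** h) = runitV_ar g ** runitV_ar h.
Proof.
move=> e; have f : gsrc (runitV_ar g) = gtgt (runitV_ar h).
  by rewrite runitV_src runitV_tgt e.
have [f1 f2] := pb_gcomp f.
by apply: fprod_eq; rewrite ?f1 ?f2 //; exact: fcomp.
Qed.

Definition runitV_map : span_map a ar :=
  @SpanMap R _ _ a ar
    (Functor runitV_smooth runitV_src runitV_tgt runitV_unit runitV_comp)
    (fun=> erefl) (fun=> erefl) (fun=> erefl) (fun=> erefl).

End Unitors.

Section CompMap.
Variables (G H : dgroupoid) (a b c : anafunctor G H)
  (m : span_map a b) (m' : span_map b c).

Definition comp_span_map : span_map a c.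
Proof.
apply: (@SpanMap R _ _ a c (comp_functor m' m)) => x /=.
- by rewrite !smap_lob.
- by rewrite !smap_lar.
- by rewrite !smap_rob.
- by rewrite !smap_rar.
Defined.

End CompMap.

Section ProdMap.
Variables (G H K : dgroupoid) (a a' : anafunctor G H) (b b' : anafunctor H K).
Variables (m : span_map a a') (m' : span_map b b').

Lemma prod_obP (z : gob (mid (comp_ana a b))) :
  fob (rleg a') (fob m (fp1 z)) = fob (lleg b') (fob m' (fp2 z)).
Proof. by rewrite smap_rob smap_lob fpE. Qed.
Lemma prod_arP (z : garr (mid (comp_ana a b))) :
  far (rleg a') (far m (fp1 z)) = far (lleg b') (far m' (fp2 z)).
Proof. by rewrite smap_rar smap_lar fpE. Qed.

Definition prod_ob z : gob (mid (comp_ana a' b')) := fpair (prod_obP z).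
Definition prod_ar z : garr (mid (comp_ana a' b')) := fpair (prod_arP z).

Lemma prod_map_smooth : smooth prod_ar.
Proof.
move=> n U p [p1 p2].
by split; [exact: (smooth_far m p1)|exact: (smooth_far m' p2)].
Qed.
Lemma prod_map_src g : gsrc (prod_ar g) = prod_ob (gsrc g).
Proof. by apply: fprod_eq; exact: fsrc. Qed.
Lemma prod_map_tgt g : gtgt (prod_ar g) = prod_ob (gtgt g).
Proof. by apply: fprod_eq; exact: ftgt. Qed.
Lemma prod_map_unit x : prod_ar (gunit x) = gunit (prod_ob x).
Proof. by apply: fprod_eq; exact: funit. Qed.
Lemma prod_map_comp g h : gsrc g = gtgt h ->
  prod_ar (g ** h) = prod_ar g ** prod_ar h.
Proof.
move=> e; have [e1 e2] := pb_gcomp e.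
have f : gsrc (prod_ar g) = gtgt (prod_ar h).
  by rewrite prod_map_src prod_map_tgt e.
have [f1 f2] := pb_gcomp f.
apply: fprod_eq; rewrite ?f1 ?f2.
- by rewrite [LHS](congr1 (far m) e1) fcomp //; exact: pb_comp1 e.
- by rewrite [LHS](congr1 (far m') e2) fcomp //; exact: pb_comp2 e.
Qed.

Definition prod_map : span_map (comp_ana a b) (comp_ana a' b').
Proof.
apply: (@SpanMap R _ _ (comp_ana a b) (comp_ana a' b')
  (Functor prod_map_smooth prod_map_src prod_map_tgt prod_map_unit
     prod_map_comp)) => x /=.
- exact: smap_lob.
- exact: smap_lar.
- exact: smap_rob.
- exact: smap_rar.
Defined.

End ProdMap.

End CoherenceMaps.

Definition DGpoid_ana_data : bicat_data :=
  @BicatData dgroupoid (@anafunctor R) (@transf R) (@id_ana R) (@comp_ana R)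
    (@id_transf R) (@vcomp R) (@hcomp R) assoc_transf lunit_transf runit_transf.

Section InducedTheory.
Variables (G H : dgroupoid).
Implicit Types a b c : anafunctor G H.

Lemma inducedE a b (m : span_map a b) z (g : garr (mid b)) :
  gsrc g = fob m (fp1 z) -> gtgt g = fp2 z ->
  far (lleg b) g = gunit (fob (lleg b) (fp2 z)) ->
  induced m z = far (rleg b) g.
Proof. by move=> e1 e2 e3; congr far; exact: lift_uniq. Qed.

Lemma induced_ext a b c (m : span_map a c) (m' : span_map b c) x y z e e' :
  fob m x = fob m' y ->
  induced m (@fpair _ _ _ _ _ _ x z e) = induced m' (@fpair _ _ _ _ _ _ y z e').
Proof. by move=> E; apply: inducedE; rewrite ?gsrc_lift ?gtgt_lift ?far_lift. Qed.

Lemma induced_unit a b (m : span_map a b) x e :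
  induced m (@fpair _ _ _ _ _ _ x (fob m x) e) = gunit (fob (rleg b) (fob m x)).
Proof.
by rewrite -funit; apply: inducedE; rewrite ?gsrc_unit ?gtgt_unit ?funit.
Qed.

Lemma vcomp_induced_l a b c (m : span_map a b) (T : transf b c) x z e e' :
  vcomp (induced m) T (@fpair _ _ _ _ _ _ x z e) =
  T (@fpair _ _ _ _ _ _ (fob m x) z e').
Proof.
rewrite [LHS](vcomp_funE _ _ _ (esym (smap_lob m x)) e').
by rewrite induced_unit gcomp1r // transf_src.
Qed.

Lemma vcomp_induced_r a b c (m : span_map b c) (S : transf a b) x y z e e' :
  fob m y = z ->
  vcomp S (induced m) (@fpair _ _ _ _ _ _ x z e) =
  S (@fpair _ _ _ _ _ _ x y e').
Proof.
move=> E; subst z.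
rewrite [LHS](vcomp_funE _ _ _ e' (esym (smap_lob m y))).
by rewrite induced_unit gcomp1l // transf_tgt smap_rob.
Qed.

Lemma vcomp_induced a b c (m : span_map a b) (m' : span_map b c) :
  vcomp (induced m) (induced m') = induced (comp_span_map m m').
Proof.
apply: transf_eq => z; rewrite (fpair_eta z).
have e : fob (lleg b) (fob m (fp1 z)) = fob (lleg c) (fp2 z).
  by rewrite smap_lob fpE.
by rewrite (vcomp_induced_l _ _ e); exact: induced_ext.
Qed.

Lemma induced_eq a b (m m' : span_map a b) : fob m =1 fob m' ->
  induced m = induced m'.
Proof.
move=> E; apply: transf_eq => z; rewrite (fpair_eta z); exact: induced_ext.
Qed.

Lemma induced_inverse a b (m : span_map a b) (m' : span_map b a) :
  cancel (fob m) (fob m') -> cancel (fob m') (fob m) ->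
  vcomp (induced m) (induced m') = id_transf a /\
  vcomp (induced m') (induced m) = id_transf b.
Proof. by move=> K K'; rewrite !vcomp_induced; split; exact: induced_eq. Qed.

End InducedTheory.

Lemma hcompE (G H K : dgroupoid) (a a' : anafunctor G H)
    (b b' : anafunctor H K) (S : transf a a') (T : transf b b') z m''
    (e : fob (lleg b) (fp2 (fp1 z)) = fob (lleg b') m'') :
  hcomp S T z = hcomp_at S T e.
Proof. exact: hcomp_at_indep. Qed.

Lemma hcomp_induced (G H K : dgroupoid) (a a' : anafunctor G H)
    (b b' : anafunctor H K) (m : span_map a a') (m' : span_map b b') :
  hcomp (induced m) (induced m') = induced (prod_map m m').
Proof.
apply: transf_eq => z.
rewrite (hcompE _ _ (esym (smap_lob m' (fp2 (fp1 z))))) /hcomp_at induced_unit.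
rewrite gcomp1r ?fsrc ?gsrc_lift //; apply/esym.
set l1 := Phi_lift _ _ _.
pose ez : fob (lleg a) (fp1 (fp1 z)) = fob (lleg a') (fp1 (fp2 z)) := fpE z.
pose l0 := Phi_lift (ana_weq a') (induced_src m (fpair ez))
  (induced_tgt (fpair ez)).
have E : far (rleg a') l0 = far (lleg b') l1 by rewrite far_lift.
have -> : far (rleg b') l1 = far (rleg (comp_ana a' b')) (fpair E) by [].
apply: inducedE.
- by apply: fprod_eq; exact: gsrc_lift.
- by apply: fprod_eq; exact: gtgt_lift.
- exact: far_lift.
Qed.

Lemma vcomp_assoc (G H : dgroupoid) (a b c d : anafunctor G H)
    (S : transf a b) (T : transf b c) (U : transf c d) :
  vcomp S (vcomp T U) = vcomp (vcomp S T) U.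
Proof.
apply: transf_eq => z.
have e1 := esym (ob_preimageP b (fob (lleg a) (fp1 z))).
have e2 := esym (ob_preimageP c (fob (lleg a) (fp1 z))).
set y1 := ob_preimage b _ in e1; set y2 := ob_preimage c _ in e2.
have e12 : fob (lleg b) y1 = fob (lleg c) y2 by rewrite -e1.
have e2z : fob (lleg c) y2 = fob (lleg d) (fp2 z) by rewrite -e2 fpE.
have e1z : fob (lleg b) y1 = fob (lleg d) (fp2 z) by rewrite -e1 fpE.
rewrite (fpair_eta z) [LHS](vcomp_funE _ _ _ e1 e1z).
rewrite [X in X ** _ = _](vcomp_funE _ _ _ e12 e2z).
rewrite [RHS](vcomp_funE _ _ _ e2 e2z).
rewrite [X in _ = _ ** X](vcomp_funE _ _ _ e1 e12).
by rewrite gcompA // transf_src transf_tgt.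
Qed.

Lemma lift_ex (G H : dgroupoid) (a : anafunctor G H) x y (h : garr G) :
  gsrc h = fob (lleg a) x -> gtgt h = fob (lleg a) y ->
  exists g, [/\ gsrc g = x, gtgt g = y & far (lleg a) g = h].
Proof.
by move=> es et; exists (Phi_lift (ana_weq a) es et);
  rewrite gsrc_lift gtgt_lift far_lift.
Qed.

Lemma hcompP (G H K : dgroupoid) (a a' : anafunctor G H)
    (b b' : anafunctor H K) (S : transf a a') (T : transf b b')
    l m l' m' elm elm' ez m'' e e' (g : garr (mid b')) :
  gsrc g = m'' -> gtgt g = m' ->
  far (lleg b') g = S (@fpair _ _ _ _ _ _ l l' e') ->
  hcomp S T (@fpair _ _ _ _ _ _ (@fpair _ _ _ _ _ _ l m elm)
               (@fpair _ _ _ _ _ _ l' m' elm') ez) =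
  far (rleg b') g ** T (@fpair _ _ _ _ _ _ m m'' e).
Proof.
move=> g1 g2 g3; rewrite (hcompE (z := fpair ez) _ _ e) /hcomp_at; congr (far _ _ ** _).
by apply: lift_uniq => //; rewrite g3; congr (S _); exact: fprod_eq.
Qed.

Lemma hcomp_vcomp (G H K : dgroupoid) (a a' a'' : anafunctor G H)
    (b b' b'' : anafunctor H K) (S : transf a a') (S' : transf a' a'')
    (T : transf b b') (T' : transf b' b'') :
  hcomp (vcomp S S') (vcomp T T') = vcomp (hcomp S T) (hcomp S' T').
Proof.
apply: transf_eq => -[[z1 z2] ez]; move: ez.
rewrite (fpair_eta z1) (fpair_eta z2) => ez.
move: (fp1 z1) (fp2 z1) (fpE z1) (fp1 z2) (fp2 z2) (fpE z2) ez => {z1 z2}.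
move=> l m elm l2 m2 elm2 ez; rewrite -/(fpair ez).
have e02 : fob (lleg a) l = fob (lleg a'') l2 := ez.
have el1 := esym (ob_preimageP a' (fob (lleg a) l)).
move: (ob_preimage a' _) el1 => l1 el1.
have el2 : fob (lleg a') l1 = fob (lleg a'') l2 by rewrite -el1.
have em1 := esym (ob_preimageP b' (fob (rleg a') l1)).
move: (ob_preimage b' _) em1 => m1 em1.
have f1 := esym (ob_preimageP b' (fob (lleg b) m)).
move: (ob_preimage b' _) f1 => n1 f1.
have f3 := esym (ob_preimageP b'' (fob (lleg b) m)).
move: (ob_preimage b'' _) f3 => n3 f3.
have f2 := esym (ob_preimageP b'' (fob (lleg b') m1)).
move: (ob_preimage b'' _) f2 => n2 f2.
have f13 : fob (lleg b') n1 = fob (lleg b'') n3 by rewrite -f1.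
have [g [g1 g2 g3]] : exists g : garr (mid b'), [/\ gsrc g = n1, gtgt g = m1 &
    far (lleg b') g = S (fpair el1)].
  by apply: lift_ex; rewrite ?transf_src ?transf_tgt -?f1 -?em1.
have [g' [g'1 g'2 g'3]] : exists g : garr (mid b''),
    [/\ gsrc g = n3, gtgt g = n2 & far (lleg b'') g = S (fpair el1)].
  by apply: lift_ex; rewrite ?transf_src ?transf_tgt -?f3 -?f2 -?em1.
have [h [h1 h2 h3]] : exists g : garr (mid b''),
    [/\ gsrc g = n2, gtgt g = m2 & far (lleg b'') g = S' (fpair el2)].
  by apply: lift_ex; rewrite ?transf_src ?transf_tgt -?elm2 -?f2 -?em1.
have hg' : gsrc h = gtgt g' by rewrite h1 g'2.
have el1' : fob (lleg (comp_ana a b)) (fpair elm) =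
  fob (lleg (comp_ana a' b')) (fpair em1) := el1.
have el2' : fob (lleg (comp_ana a' b')) (fpair em1) =
  fob (lleg (comp_ana a'' b'')) (fpair elm2) := el2.
rewrite [RHS](vcomp_funE _ _ ez el1' el2').
rewrite (hcompP T' el2' f2 h1 h2 h3).
rewrite (hcompP T el1' f1 g1 g2 g3).
rewrite (hcompP (S := vcomp S S') (vcomp T T') ez (g := h ** g')
  (m'' := n3) f3 (e' := e02)); first last.
- by rewrite fcomp // h3 g'3 [RHS](vcomp_funE _ _ e02 el1 el2).
- by rewrite gtgt_comp.
- by rewrite gsrc_comp.
have Tg := transf_natural T' f13 f2 (etrans g3 (esym g'3)) g1 g2 g'1 g'2.
rewrite [X in _ ** X](vcomp_funE _ _ f3 f1 f13) fcomp //.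
have c1 : gsrc (T' (fpair f2)) = gtgt (far (rleg b') g).
  by rewrite transf_src ftgt g2.
have c2 : gsrc (far (rleg b') g) = gtgt (T (fpair f1)).
  by rewrite transf_tgt fsrc g1.
have c3 : gsrc (far (rleg b'') h) = gtgt (T' (fpair f2)).
  by rewrite transf_tgt fsrc h1.
have c4 : gsrc (far (rleg b'') g') = gtgt (T' (fpair f13)).
  by rewrite transf_tgt fsrc g'1.
have c5 : gsrc (T' (fpair f13)) = gtgt (T (fpair f1)).
  by rewrite transf_src transf_tgt.
have c6 : gsrc (far (rleg b'') h) = gtgt (far (rleg b'') g').
  by rewrite fsrc ftgt hg'.
have c7 : gsrc (T' (fpair f2)) = gtgt (far (rleg b') g ** T (fpair f1)).
  by rewrite gtgt_comp.
have c8 : gsrc (far (rleg b'') g') = gtgt (T' (fpair f13) ** T (fpair f1)).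
  by rewrite gtgt_comp.
rewrite -(gcompA c3 c7) (gcompA c1 c2) Tg -(gcompA c4 c5).
by rewrite (gcompA c6 c8).
Qed.

Lemma assoc_naturalE (A B C D : dgroupoid) (a a' : anafunctor A B)
    (b b' : anafunctor B C) (c c' : anafunctor C D)
    (S : transf a a') (T : transf b b') (U : transf c c')
    l m n l' m' n' (elm : fob (rleg a) l = fob (lleg b) m)
    (en : fob (rleg (comp_ana a b)) (fpair elm) = fob (lleg c) n)
    (emn' : fob (rleg b') m' = fob (lleg c') n')
    (el' : fob (rleg a') l' = fob (lleg (comp_ana b' c')) (fpair emn'))
    (ez : fob (lleg (comp_ana (comp_ana a b) c)) (fpair en) =
          fob (lleg (comp_ana a' (comp_ana b' c'))) (fpair el')) :
  vcomp (hcomp (hcomp S T) U) (assoc_transf a' b' c') (fpair ez) =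
  vcomp (assoc_transf a b c) (hcomp S (hcomp T U)) (fpair ez).
Proof.
have elm' : fob (rleg a') l' = fob (lleg b') m' := el'.
have en' : fob (rleg (comp_ana a' b')) (fpair elm') = fob (lleg c') n' := emn'.
have ez1 : fob (lleg (comp_ana (comp_ana a b) c)) (fpair en) =
  fob (lleg (comp_ana (comp_ana a' b') c')) (fpair en') := ez.
have emn : fob (rleg b) m = fob (lleg c) n := en.
have el : fob (rleg a) l = fob (lleg (comp_ana b c)) (fpair emn) := elm.
have ez2 : fob (lleg (comp_ana a (comp_ana b c))) (fpair el) =
  fob (lleg (comp_ana a' (comp_ana b' c'))) (fpair el') := ez.
have -> : vcomp (hcomp (hcomp S T) U) (assoc_transf a' b' c') (fpair ez) =
    hcomp (hcomp S T) U (fpair ez1).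
  by apply: vcomp_induced_r; apply: fprod_eq => //; exact: fprod_eq.
have -> : vcomp (assoc_transf a b c) (hcomp S (hcomp T U)) (fpair ez) =
    hcomp S (hcomp T U) (fpair ez2).
  have ez2' : fob (lleg (comp_ana a (comp_ana b c)))
      (fob (assoc_map a b c) (fpair en)) =
    fob (lleg (comp_ana a' (comp_ana b' c'))) (fpair el') := ez.
  rewrite [LHS](vcomp_induced_l (m := assoc_map a b c) _ _ ez2').
  by congr (hcomp _ _ _); apply: fprod_eq => //; apply: fprod_eq => //;
     exact: fprod_eq.
have ell : fob (lleg a) l = fob (lleg a') l' := ez.
have f2 := esym (ob_preimageP b' (fob (lleg b) m)).
move: (ob_preimage b' _) f2 => m2 f2.
have h2 := esym (ob_preimageP c' (fob (lleg c) n)).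
move: (ob_preimage c' _) h2 => n2 h2.
have h3 := esym (ob_preimageP c' (fob (rleg b') m2)).
move: (ob_preimage c' _) h3 => n3 h3.
have [g [g1 g2 g3]] : exists g : garr (mid b'), [/\ gsrc g = m2, gtgt g = m' &
    far (lleg b') g = S (fpair ell)].
  by apply: lift_ex; rewrite ?transf_src ?transf_tgt -?f2.
have [k [k1 k2 k3]] : exists g : garr (mid c'), [/\ gsrc g = n2, gtgt g = n3 &
    far (lleg c') g = T (fpair f2)].
  by apply: lift_ex; rewrite ?transf_src ?transf_tgt -?h2 -?h3.
have [q [q1 q2 q3]] : exists q : garr (mid c'), [/\ gsrc q = n3, gtgt q = n' &
    far (lleg c') q = far (rleg b') g].
  by apply: lift_ex; rewrite ?fsrc ?ftgt ?g1 ?g2.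
have qk : gsrc q = gtgt k by rewrite q1 k2.
have e2 : fob (lleg (comp_ana a b)) (fpair elm) =
  fob (lleg (comp_ana a' b')) (fpair elm') := ell.
rewrite (hcompP (S := hcomp S T) U ez1 h2 (e' := e2) (g := q ** k)); first last.
- by rewrite fcomp // q3 k3 (hcompP T e2 f2 g1 g2 g3).
- by rewrite gtgt_comp.
- by rewrite gsrc_comp.
have f2' : fob (lleg (comp_ana b c)) (fpair emn) =
  fob (lleg (comp_ana b' c')) (fpair h3) := f2.
have gq : far (rleg b') g = far (lleg c') q by rewrite q3.
rewrite (hcompP (S := S) (hcomp T U) ez2 f2' (e' := ell)
  (g := fpair gq : garr (mid (comp_ana b' c')))) //; first last.
- by apply: fprod_eq; rewrite /fp1 /fp2 /=.
- by apply: fprod_eq; rewrite /fp1 /fp2 /=.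
have c1 : gsrc (far (rleg c') q) = gtgt (far (rleg c') k).
  by rewrite fsrc ftgt qk.
have c2 : gsrc (far (rleg c') k) = gtgt (U (fpair h2)).
  by rewrite fsrc k1 transf_tgt.
by rewrite (hcompP U f2' h2 k1 k2 k3) fcomp //; exact/esym/gcompA.
Qed.

Lemma lunit_naturalE (A B : dgroupoid) (a a' : anafunctor A B)
    (S : transf a a') x l l' (el : fob (id_functor A) x = fob (lleg a) l)
    (ez : fob (lleg (comp_ana (id_ana A) a)) (fpair el) = fob (lleg a') l') :
  vcomp (hcomp (id_transf (id_ana A)) S) (lunit_transf a') (fpair ez) =
  vcomp (lunit_transf a) S (fpair ez).
Proof.
have ell : fob (lleg a) l = fob (lleg a') l' by rewrite -el.
have el' : fob (id_functor A) x = fob (lleg a') l' := ez.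
have ez1 : fob (lleg (comp_ana (id_ana A) a)) (fpair el) =
  fob (lleg (comp_ana (id_ana A) a')) (fpair el') by [].
rewrite [LHS](vcomp_induced_r (m := lunit_map a') _ _ ez1) //.
rewrite [RHS](vcomp_induced_l (m := lunit_map a) _ _
  (ell : fob (lleg a) (fob (lunit_map a) (fpair el)) = _)).
have e0 : fob (lleg (id_ana A)) x = fob (lleg (id_ana A)) x by [].
rewrite (hcompP (S := id_transf (id_ana A)) S ez1 ell (g := gunit l')
  (e' := e0)) ?gsrc_unit ?gtgt_unit //.
- by rewrite funit gcomp1l // transf_tgt.
- rewrite funit -el'; apply/esym.
  exact: (inducedE (m := id_span_map (id_ana A)) (z := fpair e0)
    (g := gunit x) (gsrc_unit _) (gtgt_unit _) erefl).
Qed.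

Lemma runit_naturalE (A B : dgroupoid) (a a' : anafunctor A B)
    (S : transf a a') l x l' (el : fob (rleg a) l = fob (id_functor B) x)
    (ez : fob (lleg (comp_ana a (id_ana B))) (fpair el) = fob (lleg a') l') :
  vcomp (hcomp S (id_transf (id_ana B))) (runit_transf a') (fpair ez) =
  vcomp (runit_transf a) S (fpair ez).
Proof.
have ell : fob (lleg a) l = fob (lleg a') l' := ez.
have el' : fob (rleg a') l' = fob (id_functor B) (fob (rleg a') l') by [].
have ez1 : fob (lleg (comp_ana a (id_ana B))) (fpair el) =
  fob (lleg (comp_ana a' (id_ana B))) (fpair el') := ez.
rewrite [LHS](vcomp_induced_r (m := runit_map a') _ _ ez1) //.
rewrite [RHS](vcomp_induced_l (m := runit_map a) _ _
  (ell : fob (lleg a) (fob (runit_map a) (fpair el)) = _)).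
have e0 : fob (lleg (id_ana B)) x = fob (lleg (id_ana B)) x by [].
rewrite (hcompP (S := S) (id_transf (id_ana B)) ez1 e0
  (g := S (fpair ell)) (e' := ell)) ?transf_src ?transf_tgt //=.
rewrite [X in _ ** X](inducedE (m := id_span_map (id_ana B)) (z := fpair e0)
    (g := gunit x) (gsrc_unit _) (gtgt_unit _) erefl).
by rewrite gcomp1r // transf_src.
Qed.

Lemma assoc_invertible (A B C D : dgroupoid) (a : anafunctor A B)
    (b : anafunctor B C) (c : anafunctor C D) :
  @invertible2 DGpoid_ana_data A D _ _ (assoc_transf a b c).
Proof.
exists (induced (assocV_map a b c)); apply: induced_inverse => z.
- by apply: fprod_eq; [exact: fprod_eq|].
- by apply: fprod_eq; [|exact: fprod_eq].
Qed.

Lemma lunit_invertible (A B : dgroupoid) (a : anafunctor A B) :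
  @invertible2 DGpoid_ana_data A B _ _ (lunit_transf a).
Proof.
exists (induced (lunitV_map a)); apply: induced_inverse => z //.
by apply: fprod_eq => //; exact: esym (fpE z).
Qed.

Lemma runit_invertible (A B : dgroupoid) (a : anafunctor A B) :
  @invertible2 DGpoid_ana_data A B _ _ (runit_transf a).
Proof.
exists (induced (runitV_map a)); apply: induced_inverse => z //.
by apply: fprod_eq => //; exact: (fpE z).
Qed.

Lemma DGpoid_ana_is_bicategory : is_bicategory DGpoid_ana_data.
Proof.
split=> /=.
- exact: vcomp_assoc.
- move=> G H a b S; apply: transf_eq => z; rewrite (fpair_eta z).
  exact: vcomp_induced_l.
- move=> G H a b S; apply: transf_eq => z; rewrite (fpair_eta z).
  exact: vcomp_induced_r.
- move=> G H K a b; rewrite hcomp_induced; apply: induced_eq => z.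
  exact: fprod_eq.
- exact: hcomp_vcomp.
- move=> A B C D a a' b b' c c' S T U; apply: transf_eq.
  move=> -[[[[[[l m] elm] n] en] [[l' [[m' n'] emn']] el']] ez].
  exact: (@assoc_naturalE _ _ _ _ _ _ _ _ _ _ S T U l m n l' m' n').
- move=> A B a a' S; apply: transf_eq => -[[[[x l] el] l'] ez].
  exact: (@lunit_naturalE _ _ _ _ S x l l').
- move=> A B a a' S; apply: transf_eq => -[[[[l x] el] l'] ez].
  exact: (@runit_naturalE _ _ _ _ S l x l').
- exact: assoc_invertible.
- exact: lunit_invertible.
- exact: runit_invertible.
- move=> A B C D E a b c d; rewrite !hcomp_induced !vcomp_induced.
  apply: induced_eq => z.
  rewrite /= /assoc_ob /prod_ob /fpair /fp1 /fp2 /=.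
  apply: eq_exist; congr (_, _).
  apply: eq_exist; congr (_, _).
  exact: eq_exist.
- move=> A B C a b; rewrite !hcomp_induced !vcomp_induced.
  apply: induced_eq => z.
  rewrite /= /assoc_ob /prod_ob /fpair /fp1 /fp2 /=.
  exact: eq_exist.
Qed.

Definition DGpoid_ana : bicategory := Bicategory DGpoid_ana_is_bicategory.

End DGpoidAna.

Section SubBicategories.
Variable B : bicat_data.

(* [in1] is only relevant between objects in [in0], and [in2] only between
   1-cells in [in1]; see [mem1] and [mem2]. *)
Record subcells := SubCells {
  in0 : cell0 B -> Prop;
  in1 : forall X Y : cell0 B, cell1 X Y -> Prop;
  in2 : forall (X Y : cell0 B) (f g : cell1 X Y), cell2 f g -> Prop
}.

Definition mem1 (S : subcells) X Y (f : cell1 X Y) : Prop :=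
  [/\ in0 S X, in0 S Y & in1 S f].

Definition mem2 (S : subcells) X Y (f g : cell1 X Y) (s : cell2 f g) : Prop :=
  [/\ mem1 S f, mem1 S g & in2 S s].

Record is_sub_bicategory (S : subcells) : Prop := IsSubBicategory {
  sub_id1 : forall X, in0 S X -> mem1 S (bid1 X);
  sub_comp1 : forall X Y Z (f : cell1 X Y) (g : cell1 Y Z),
    mem1 S f -> mem1 S g -> mem1 S (bcomp1 f g);
  sub_id2 : forall X Y (f : cell1 X Y), mem1 S f -> mem2 S (bid2 f);
  sub_vcomp : forall X Y (f g h : cell1 X Y) (s : cell2 f g) (t : cell2 g h),
    mem2 S s -> mem2 S t -> mem2 S (bvcomp s t);
  sub_hcomp : forall X Y Z (f f' : cell1 X Y) (g g' : cell1 Y Z)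
    (s : cell2 f f') (t : cell2 g g'),
    mem2 S s -> mem2 S t -> mem2 S (bhcomp s t);
  sub_assoc : forall X Y Z W (f : cell1 X Y) (g : cell1 Y Z) (h : cell1 Z W),
    mem1 S f -> mem1 S g -> mem1 S h ->
    mem2 S (bassoc f g h) /\
    forall t, inverse2 (bassoc f g h) t -> mem2 S t;
  sub_lunit : forall X Y (f : cell1 X Y), mem1 S f ->
    mem2 S (blunit f) /\ forall t, inverse2 (blunit f) t -> mem2 S t;
  sub_runit : forall X Y (f : cell1 X Y), mem1 S f ->
    mem2 S (brunit f) /\ forall t, inverse2 (brunit f) t -> mem2 S t
}.

Definition all_cells : subcells :=
  SubCells (fun=> True) (fun _ _ _ => True) (fun _ _ _ _ _ => True).

Record essentially_full_sub_bicategory (S T : subcells) : Prop :=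
    EssentiallyFullSubBicategory {
  efs_sub : is_sub_bicategory S;
  efs_ambient : is_sub_bicategory T;
  efs_le0 : forall X, in0 S X -> in0 T X;
  efs_le1 : forall X Y (f : cell1 X Y), mem1 S f -> mem1 T f;
  efs_le2 : forall X Y (f g : cell1 X Y) (s : cell2 f g),
    mem2 S s -> mem2 T s;
  efs_ess : forall X Y (f : cell1 X Y), in0 S X -> in0 S Y -> mem1 T f ->
    exists (g : cell1 X Y) (s : cell2 f g) (t : cell2 g f),
      [/\ mem1 S g, mem2 T s, mem2 T t & inverse2 s t];
  efs_full : forall X Y (f g : cell1 X Y) (s : cell2 f g),
    mem1 S f -> mem1 S g -> mem2 T s -> mem2 S s
}.

End SubBicategories.

Section Manifolds.
Variable R : realType.
Local Notation dspace := (dspace R).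

(* Neither Hausdorff nor second-countable in general. *)
Record manifold := Manifold {
  mtop :> topologicalType;
  mdim : nat;
  midx : Type;
  mdom : midx -> set mtop;
  mchart : midx -> mtop -> 'rV[R]_mdim;
  mdom_cover : forall x, exists i, mdom i x;
  mdom_open : forall i, open (mdom i);
  mchart_inj : forall i x y, mdom i x -> mdom i y ->
    mchart i x = mchart i y -> x = y;
  (* [mchart i] is a homeomorphism from [mdom i] onto an open set *)
  mchart_homeo : forall i (V : set mtop), V `<=` mdom i ->
    open V <-> open (mchart i @` V);
  mchart_smooth : forall i j, exists F : 'rV[R]_mdim -> 'rV[R]_mdim,
    smooth_on (mchart i @` (mdom i `&` mdom j)) F /\
    forall x, mdom i x -> mdom j x -> F (mchart i x) = mchart j x
}.

Definition smooth_param (M : manifold) n (U : set 'rV[R]_n) (p : U -> M)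
    : Prop :=
  open U /\
  forall (i : midx M) (u : U), mdom i (p u) ->
    exists (V : set 'rV[R]_n) (VU : V `<=` U) (F : 'rV[R]_n -> 'rV[R]_(mdim M)),
      [/\ open V, V (set_val u), smooth_on V F &
          forall v : V, mdom i (p (set_incl VU v)) /\
                        mchart i (p (set_incl VU v)) = F (set_val v)].

Definition models (X : dspace) (M : manifold) (e : X -> M) : Prop :=
  bijective e /\
  forall n (U : set 'rV[R]_n) (p : U -> X), plot X p <-> smooth_param (e \o p).

Definition is_manifold (hausdorff sndcount : bool) (X : dspace) : Prop :=
  exists (M : manifold) (e : X -> M),
    [/\ models e, hausdorff -> hausdorff_space M &
        sndcount -> @second_countable M].

(* [F] below is the expression of [f] in the charts [i] and [j]; its values
   outside the image of the chart are irrelevant to its differential. *)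
Definition submersion (X Y : dspace) (f : X -> Y) : Prop :=
  smooth f /\
  exists (M : manifold) (e : X -> M) (N : manifold) (e' : Y -> N),
    [/\ models e, models e' &
      forall (x : X) (i : midx M) (j : midx N),
        mdom i (e x) -> mdom j (e' (f x)) ->
        exists F : 'rV[R]_(mdim M) -> 'rV[R]_(mdim N),
          [/\ forall y, mdom i (e y) -> mdom j (e' (f y)) ->
                F (mchart i (e y)) = mchart j (e' (f y)),
              differentiable F (mchart i (e x)) &
              forall w, exists v, 'd F (mchart i (e x)) v = w]].

End Manifolds.

Section LieGroupoids.
Variable R : realType.
Local Notation dgroupoid := (dgroupoid R).

Definition lie_groupoid (G : dgroupoid) : Prop :=
  [/\ is_manifold true true (gob G), is_manifold false false (garr G),
      submersion (@gsrc R G) & submersion (@gtgt R G)].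

Definition lie_weak_equivalence (G H : dgroupoid) (F : functor G H) : Prop :=
  [/\ weak_equivalence F,
      is_manifold false false (garr G) /\ is_manifold false false (Phi_cod F),
      is_manifold false false (fprod (fob F) (@gtgt R H)) /\
        is_manifold false false (gob H),
      smooth (Phi F) &
      submersion (Psi (F := F))].

Definition surjective_submersive (G H : dgroupoid) (F : functor G H) : Prop :=
  [/\ lie_weak_equivalence F, submersion (fob F) &
      forall y, exists x, fob F x = y].

Definition is_lie_anafunctor (G H : dgroupoid) (s : fspan G H) : Prop :=
  lie_groupoid (mid s) /\ surjective_submersive (lleg s).

Definition LieGpoid_ana : subcells (DGpoid_ana R) :=
  @SubCells (DGpoid_ana R) lie_groupoid
    (fun G H (a : anafunctor G H) => is_lie_anafunctor a)
    (fun _ _ _ _ _ => True).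

Definition LieGpoid_ana_restr (hausdorff sndcount : bool)
    : subcells (DGpoid_ana R) :=
  @SubCells (DGpoid_ana R)
    (fun G => lie_groupoid G /\ is_manifold hausdorff sndcount (garr G))
    (fun G H (a : anafunctor G H) => is_lie_anafunctor a /\
       is_manifold hausdorff sndcount (garr (mid a)))
    (fun _ _ _ _ _ => True).

End LieGroupoids.

(* Main.v *)
(** Being a manifold and being a submersion are diffeological properties: a manifold
is a space with D-open charts of one dimension (Hausdorff or second-countable for
its D-topology), and by the inverse function theorem a smooth map between manifolds
is a submersion iff plots of its target lift locally through any prescribed point
("local subduction").  Local subductions are stable under composition and base
change, and a fibre product along a submersion is a manifold whose topology is
generated by boxes; hence Lie anafunctors compose and are anafunctors.

All transformations are invertible, so for fullness it suffices to map a Lie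
anafunctor into a given one [G <- K -> H].  Since [K_0 -> G_0] is a subduction and
[G_0] is second-countable, [G_0] has a countable open cover [A_i] with smooth
sections into [K_0].  The disjoint union of the [A_i] is a manifold, etale over
[G_0]; the groupoid induced on it by [G] is Lie, has the separation and
countability properties of [G], and maps to [K] by full faithfulness of
[K -> G]. *)

Require Import Defs.
From HB Require Import structures.
From mathcomp Require Import all_boot all_order all_algebra.
From mathcomp Require Import all_classical all_reals.
From mathcomp Require Import topology interval_inference normedtype.
From mathcomp Require Import landau derive sequences ring lra.
(* [fprod] denotes the fibre product of Defs, not the product of finfun. *)
Import Defs.

Set Implicit Arguments.
Unset Strict Implicit.
Unset Printing Implicit Defensive.

Import Order.TTheory GRing.Theory Num.Theory.
Import numFieldNormedType.Exports.

Local Open Scope classical_set_scope.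
Local Open Scope ring_scope.

(** * Smooth maps between coordinate spaces *)

(** The definitions quantify over models: [is_manifold] and [submersion] each bring their own
    manifolds and bijections, and two hypotheses about one space may use different ones. Properties
    of plots alone remove this choice. A subduction lifts plots locally, but not through a
    prescribed point of the fibre; a submersion needs such a lift at every point, hence local
    subductions. The D-topology of a fibre product can in general be finer than the topology of
    boxes, so second countability does not pass to it formally. The charts provided by the normal
    form of a submersion are what makes the boxes visible. The middle groupoid of an arbitrary
    anafunctor may carry no manifold structure. What can be used is that plots of [G_0] lift
    locally; the inverse charts of [G_0] are such plots, and their lifts are the sections. Object
    spaces of Lie groupoids are always Hausdorff and second-countable, whereas arrow spaces have
    these properties only when a flag says so; this is why the family of sections must be countable
    in every case. *)

Section Germs.
Variable R : realType.

Lemma open_near (T : topologicalType) (V : set T) x :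
  open V -> V x -> \near x, V x.
Proof. by move=> oV Vx; exact: open_nbhs_nbhs. Qed.

(** The little-o of the differential is traded for an estimate with a factor [e]. Matrix products
    and inverse functions are then differentiated by naming the candidate [L], which [diff_unique]
    identifies with the differential. *)
Lemma is_diffP (X Y : normedModType R) (f : X -> Y) (L : {linear X -> Y}) x :
  continuous L ->
  (forall e, 0 < e -> \forall y \near x, `|f y - f x - L (y - x)| <= e * `|y - x|) ->
  differentiable f x /\ 'd f x = L :> (X -> Y).
Proof.
move=> cL H.
have E : f \o shift x = cst (f x) + L +o_ 0 id.
  apply/eqaddoP => e e0.
  move: (H _ e0); rewrite (near_shift 0) => H'.
  by apply: filterS H' => h; rewrite /= subr0 addrK !fctE opprD addrA.
have E' := diff_unique cL E.
by split=> //; apply/diff_locallyP; rewrite E'.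
Qed.

Lemma diff_bound (X Y : normedModType R) (f : X -> Y) x : differentiable f x ->
  forall e, 0 < e -> \forall y \near x, `|f y - f x - 'd f x (y - x)| <= e * `|y - x|.
Proof.
move=> df e e0.
have /eqaddoP/(_ _ e0) H := diff_locally df.
rewrite (near_shift 0); apply: filterS H => h.
by rewrite /= subr0 addrK !fctE opprD addrA.
Qed.

Lemma near_eq_diff (X Y : normedModType R) (f g : X -> Y) (x : X) :
  (\near x, f x = g x) -> differentiable f x ->
  differentiable g x /\ 'd g x = 'd f x :> (X -> Y).
Proof.
move=> fg df; apply: is_diffP; first exact: diff_continuous.
move=> e e0; have H := diff_bound df e0.
near=> y.
have <- : f y = g y by near: y.
have <- : f x = g x := nbhs_singleton fg.
by near: y.
Unshelve. all: by end_near. Qed.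

Lemma near_eq_continuous (X Y : topologicalType) (f g : X -> Y) (x : X) :
  (\near x, f x = g x) -> {for x, continuous f} -> {for x, continuous g}.
Proof.
move=> fg cf; rewrite /prop_for /continuous_at -(nbhs_singleton fg).
by apply: cvg_trans cf; apply: near_eq_cvg.
Qed.

End Germs.

(** * Calculus of scalar functions of class C^k *)

Section ScalarCk.
Variable R : realType.

(** [Ck_on] for a single component: products, reciprocals and determinants are formed of scalars,
    and [Ck_onP] translates back to rows. *)
Fixpoint ck (k m : nat) (V : set 'rV[R]_m) (f : 'rV[R]_m -> R) : Prop :=
  if k is k'.+1 then
    (forall x, V x -> differentiable f x) /\
    (forall i : 'I_m, ck k' V ('D_(delta_mx 0 i) f))
  else forall x, V x -> {for x, continuous f}.

Section Basics.
Variable m : nat.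
Implicit Types (V W : set 'rV[R]_m) (f g : 'rV[R]_m -> R).

(** The functions are total and their iterated derivatives do not refer to [V], so each clause of
    [ck] is a condition at single points. This makes smoothness local, in [smooth_on_local]. *)
Lemma ck_pointwise k V f : (forall x, V x -> ck k [set x] f) -> ck k V f.
Proof.
elim: k f => [|k IH] f /= H; first by move=> x Vx; apply: (H x Vx).
split=> [x Vx|i]; first by have [+ _] := H x Vx; exact.
by apply: IH => x Vx; have [_] := H x Vx.
Qed.

Lemma ck_sub k V W f : V `<=` W -> ck k W f -> ck k V f.
Proof.
move=> VW; elim: k f => [|k IH] f /=; first by move=> H x /VW; exact: H.
by case=> H1 H2; split=> [x /VW/H1//|i]; exact/IH/H2.
Qed.

Lemma ckS k V f : ck k.+1 V f -> ck k V f.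
Proof.
elim: k f => [|k IH] f [H1 H2].
  by move=> x /H1 /differentiable_continuous.
by split=> // i; exact/IH/H2.
Qed.

Lemma ck_ext k V f g : open V -> (forall x, V x -> f x = g x) ->
  ck k V f -> ck k V g.
Proof.
move=> oV; elim: k f g => [|k IH] f g fg /= H.
  move=> x Vx; apply: near_eq_continuous (H x Vx).
  by apply: filterS (open_near oV Vx).
have nfg x : V x -> \near x, f x = g x.
  by move=> Vx; apply: filterS (open_near oV Vx).
split=> [x Vx|i]; first by have [] := near_eq_diff (nfg x Vx) (H.1 x Vx).
apply: IH (H.2 i) => x Vx; exact/near_eq_derive/nfg.
Qed.

Lemma ck_cst k V (c : R) : ck k V (fun=> c).
Proof.
elim: k c => [|k IH] c /=; first by move=> x _; exact: cst_continuous.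
split=> [x _|i]; first exact: differentiable_cst.
have -> : 'D_(delta_mx 0 i) (fun=> c) = (fun=> 0) :> ('rV[R]_m -> R).
  by apply/funext => x; rewrite derive_cst.
exact: IH.
Qed.

Lemma ckD k V f g : open V -> ck k V f -> ck k V g -> ck k V (fun x => f x + g x).
Proof.
move=> oV; elim: k f g => [|k IH] f g /=.
  by move=> H1 H2 x Vx; exact: (cvgD (H1 x Vx : f @ x --> f x) (H2 x Vx : g @ x --> g x)).
move=> [H1 H2] [H3 H4]; split=> [x Vx|i].
  exact: (differentiableD (H1 x Vx) (H3 x Vx)).
apply: ck_ext (IH _ _ (H2 i) (H4 i)) => // x Vx; apply/esym.
by apply: (@deriveD _ _ _ f g); apply: diff_derivable; [exact: H1|exact: H3].
Qed.

Lemma ckM k V f g : open V -> ck k V f -> ck k V g -> ck k V (fun x => f x * g x).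
Proof.
move=> oV; elim: k f g => [|k IH] f g.
  by move=> H1 H2 x Vx; exact: (cvgM (H1 x Vx : f @ x --> f x) (H2 x Vx : g @ x --> g x)).
move=> ckf ckg; have [H1 H2] := ckf; have [H3 H4] := ckg; split=> [x Vx|i].
  exact: (differentiableM (H1 x Vx) (H3 x Vx)).
(* The Leibniz rule involves [f] and [g] themselves, of which only order [k] is used. *)
have := ckD oV (IH _ _ (ckS ckf) (H4 i)) (IH _ _ (ckS ckg) (H2 i)).
apply: ck_ext => // x Vx.
have /= := @deriveM _ _ f g x (delta_mx 0 i).
by move=> <- //; apply: diff_derivable; [exact: H1|exact: H3].
Qed.

Lemma ckV k V f : open V -> (forall x, V x -> f x != 0) -> ck k V f ->
  ck k V (fun x => (f x)^-1).
Proof.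
move=> oV f0; elim: k => [|k IH] ckf.
  by move=> x Vx; exact: (cvgV (f0 x Vx) (ckf x Vx : f @ x --> f x)).
have [H1 H2] := ckf; split=> [x Vx|i].
  exact: (differentiableV (H1 x Vx) (f0 x Vx)).
have C := IH (ckS ckf).
have := ckM oV (ck_cst k V (-1)) (ckM oV (ckM oV C C) (H2 i)).
apply: ck_ext => // x Vx.
rewrite deriveV ?f0 //; last by apply: diff_derivable; exact: H1.
by rewrite mulN1r expr2 invfM /GRing.scale /= mulNr.
Qed.

Lemma ck_sum k V (I : Type) (r : seq I) (P : pred I) (f : I -> 'rV[R]_m -> R) :
  open V -> (forall i, ck k V (f i)) -> ck k V (fun x => \sum_(i <- r | P i) f i x).
Proof.
move=> oV H; elim: r => [|i r IH].
  by apply: ck_ext (ck_cst k V 0) => // x _; rewrite big_nil.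
case: (boolP (P i)) => Pi.
  by apply: ck_ext (ckD oV (H i) IH) => // x _; rewrite big_cons Pi.
by apply: ck_ext IH => // x _; rewrite big_cons (negbTE Pi).
Qed.

Lemma ck_prod k V (I : Type) (r : seq I) (P : pred I) (f : I -> 'rV[R]_m -> R) :
  open V -> (forall i, ck k V (f i)) -> ck k V (fun x => \prod_(i <- r | P i) f i x).
Proof.
move=> oV H; elim: r => [|i r IH].
  by apply: ck_ext (ck_cst k V 1) => // x _; rewrite big_nil.
case: (boolP (P i)) => Pi.
  by apply: ck_ext (ckM oV (H i) IH) => // x _; rewrite big_cons Pi.
by apply: ck_ext IH => // x _; rewrite big_cons (negbTE Pi).
Qed.

End Basics.

Lemma differentiable_rowP (X : normedModType R) n (F : X -> 'rV[R]_n) x :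
  differentiable F x <-> forall j, differentiable (fun y => F y 0 j) x.
Proof.
split=> [dF j|H].
  exact: (differentiable_comp dF (differentiable_coord _ 0 j)).
have -> : F = \sum_(j < n) (fun y => F y 0 j *: delta_mx 0 j).
  by apply/funext => y; rewrite fct_sumE -row_sum_delta.
by apply: differentiable_sum => j; apply: differentiableZl.
Qed.

Lemma continuous_rowP (X : topologicalType) n (F : X -> 'rV[R]_n) x :
  {for x, continuous F} <-> forall j, {for x, continuous (fun y => F y 0 j)}.
Proof.
split=> [cF j|H].
  exact: (continuous_comp cF (@coord_continuous R 1 n 0 j (F x))).
apply/cvgrPdist_lt => e e0.
have Hj : \near x, forall j, `|F x 0 j - F x 0 j| < e.
  by near=> y => j; rewrite subrr normr0.
have Hf : \forall y \near x, forall j, `|F x 0 j - F y 0 j| < e.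
  apply: filter_forall => j.
  by have /cvgrPdist_lt/(_ _ e0) := H j.
near=> y; rewrite /Num.norm /= mx_normrE.
apply/bigmax_ltP; split=> // -[i j] _; rewrite (ord1 i) !mxE /=.
by move: j; near: y.
Unshelve. all: by end_near. Qed.

Lemma derive_coord (X : normedModType R) n (F : X -> 'rV[R]_n) x v j :
  differentiable F x -> 'D_v (fun y => F y 0 j) x = 'D_v F x 0 j.
Proof.
move=> dF; have dj := differentiable_coord (F x) 0 j.
have dFj : differentiable (fun y => F y 0 j) x by move/differentiable_rowP: dF.
rewrite !deriveE // [X in 'd X _](_ : _ = (fun N : 'rV[R]_n => N 0 j) \o F) //.
rewrite (diff_comp dF dj) /=.
(* The projection is bundled as a linear map, so that [diff_lin] gives its differential as the
   projection itself. *)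
have @f : {linear 'rV[R]_n -> R}.
  by exists (fun N : 'rV[R]_n => N 0 j); do 2![eexists]; do ?[constructor];
     rewrite ?mxE // => ? *; rewrite ?mxE//; move=> ?; rewrite !mxE.
by rewrite (@diff_lin _ _ _ f) //; exact: coord_continuous.
Qed.

Lemma Ck_onP k m n (V : set 'rV[R]_m) (F : 'rV[R]_m -> 'rV[R]_n) : open V ->
  Ck_on k V F <-> forall j, ck k V (fun x => F x 0 j).
Proof.
move=> oV; elim: k F => [|k IH] F /=.
  split=> [H j x Vx|H x Vx]; first by have /continuous_rowP := H x Vx; exact.
  by apply/continuous_rowP => j; exact: H.
split=> [[H1 H2] j|H].
  split=> [x Vx|i]; first by have /differentiable_rowP := H1 x Vx; exact.
  have /IH/(_ j) := H2 i; apply: ck_ext => // x Vx.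
  by rewrite derive_coord //; exact: H1.
have dF x : V x -> differentiable F x.
  by move=> Vx; apply/differentiable_rowP => j; have [H1 _] := H j; exact: H1.
split=> // i; apply/IH => j; have [_ /(_ i)] := H j.
by apply: ck_ext => // x Vx; rewrite derive_coord //; exact: dF.
Qed.

Lemma derive_partial m (f : 'rV[R]_m -> R) x v : differentiable f x ->
  'D_v f x = \sum_i v 0 i * 'D_(delta_mx 0 i) f x.
Proof.
move=> df; rewrite deriveE // {1}(row_sum_delta v) linear_sum /=.
by apply: eq_bigr => i _; rewrite linearZ /= deriveE.
Qed.

(** By the chain rule the partial derivatives of [f \o F] are sums of products of partial
    derivatives of components of [F] with composites of partial derivatives of [f] with [F]; the
    induction hypothesis applies to the latter. *)
Lemma ck_comp k m n (V : set 'rV[R]_m) (W : set 'rV[R]_n)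
    (F : 'rV[R]_m -> 'rV[R]_n) (f : 'rV[R]_n -> R) :
  open V -> open W -> (forall x, V x -> W (F x)) ->
  (forall j, ck k V (fun x => F x 0 j)) -> ck k W f -> ck k V (f \o F).
Proof.
move=> oV oW FVW; elim: k f => [|k IH] f.
  move=> cF cf x Vx; apply: continuous_comp; last by apply: cf; exact: FVW.
  by apply/continuous_rowP => j; exact: cF.
move=> cF cf; have [H1 H2] := cf.
have dF x : V x -> differentiable F x.
  by move=> Vx; apply/differentiable_rowP => j; have [H _] := cF j; exact: H.
split=> [x Vx|i].
  by apply: differentiable_comp; [exact: dF|exact/H1/FVW].
have IH' j := IH _ (fun j => ckS (cF j)) (H2 j).
have := @ck_sum _ k V _ (index_enum 'I_n) xpredT
  (fun j x => 'D_(delta_mx 0 i) (fun y => F y 0 j) x * ('D_(delta_mx 0 j) f \o F) x) oV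
  (fun j => ckM oV ((cF j).2 i) (IH' j)).
apply: ck_ext => // x Vx; have dx := dF x Vx; have dfx := H1 _ (FVW _ Vx).
have dc : differentiable (f \o F) x by exact: differentiable_comp.
rewrite [RHS]deriveE // (diff_comp dx dfx) /= -(deriveE _ dfx) derive_partial //.
by apply: eq_bigr => j _; rewrite derive_coord // deriveE.
Qed.

End ScalarCk.

(** * Smooth maps with values in rows *)

Section SmoothOn.
Variable R : realType.

Lemma smooth_onP m n (V : set 'rV[R]_m) (F : 'rV[R]_m -> 'rV[R]_n) : open V ->
  smooth_on V F <-> forall k j, ck k V (fun x => F x 0 j).
Proof.
move=> oV; split=> [H k|H k]; first by apply/(Ck_onP k F oV); exact: H.
by apply/(Ck_onP k F oV); exact: H.
Qed.

Lemma smooth_on_sub m n (V W : set 'rV[R]_m) (F : 'rV[R]_m -> 'rV[R]_n) :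
  open V -> open W -> V `<=` W -> smooth_on W F -> smooth_on V F.
Proof.
move=> oV oW VW /(smooth_onP _ oW) H; apply/(smooth_onP _ oV) => k j.
exact: ck_sub (H k j).
Qed.

Lemma smooth_on_local m n (V : set 'rV[R]_m) (F : 'rV[R]_m -> 'rV[R]_n) :
  open V ->
  (forall x, V x -> exists W G, [/\ open W, W x, smooth_on W G &
     forall y, W y -> V y -> G y = F y]) ->
  smooth_on V F.
Proof.
move=> oV H; apply/(smooth_onP _ oV) => k j; apply: ck_pointwise => x Vx.
have [W [G [oW Wx sG GF]]] := H x Vx.
have oWV : open (W `&` V) by exact: openI.
have /smooth_onP/(_ k j) ckG := smooth_on_sub oWV oW (@subIsetl _ W V) sG.
apply: (@ck_sub _ _ _ _ (W `&` V)); first by move=> _ ->.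
by apply: ck_ext (ckG oWV) => // y [Wy Vy]; rewrite GF.
Qed.

Lemma smooth_on_ext m n (V : set 'rV[R]_m) (F G : 'rV[R]_m -> 'rV[R]_n) :
  open V -> (forall x, V x -> F x = G x) -> smooth_on V F -> smooth_on V G.
Proof.
move=> oV FG sF; apply: smooth_on_local => // x Vx.
by exists V, F; split=> // y _; exact: FG.
Qed.

Lemma smooth_on_diff m n (V : set 'rV[R]_m) (F : 'rV[R]_m -> 'rV[R]_n) x :
  smooth_on V F -> V x -> differentiable F x.
Proof. by move=> /(_ 1) [H _]; exact: H. Qed.

Lemma smooth_on_continuous m n (V : set 'rV[R]_m) (F : 'rV[R]_m -> 'rV[R]_n) x :
  smooth_on V F -> V x -> {for x, continuous F}.
Proof. by move=> sF Vx; exact/differentiable_continuous/(smooth_on_diff sF). Qed.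

Lemma open_preim m n (V : set 'rV[R]_m) (W : set 'rV[R]_n)
    (F : 'rV[R]_m -> 'rV[R]_n) :
  open V -> open W -> smooth_on V F -> open (V `&` F @^-1` W).
Proof.
move=> oV oW sF; rewrite openE => x [Vx Wx]; apply: filterI.
  exact: (open_near oV Vx).
by apply: (smooth_on_continuous sF Vx); exact: (open_near oW Wx).
Qed.

Lemma smooth_on_comp m n p (V : set 'rV[R]_m) (W : set 'rV[R]_n)
    (F : 'rV[R]_m -> 'rV[R]_n) (G : 'rV[R]_n -> 'rV[R]_p) :
  open V -> open W -> (forall x, V x -> W (F x)) ->
  smooth_on V F -> smooth_on W G -> smooth_on V (G \o F).
Proof.
move=> oV oW FVW /(smooth_onP _ oV) sF /(smooth_onP _ oW) sG.
apply/(smooth_onP _ oV) => k j.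
exact: (ck_comp oV oW FVW (sF k) (sG k j)).
Qed.

Lemma smooth_on_lin m n (V : set 'rV[R]_m) (A : 'M[R]_(m, n)) :
  open V -> smooth_on V (fun x => x *m A).
Proof.
move=> oV; apply/(smooth_onP _ oV) => k j.
have /(smooth_onP _ oV) sid := smooth_on_id V.
have := ck_sum (index_enum 'I_m) xpredT oV
  (fun i => ckM oV (sid k i) (ck_cst k V (A i j))).
by apply: ck_ext => // x _; rewrite mxE.
Qed.

Lemma smooth_on_row_mx m n p (V : set 'rV[R]_m) (F : 'rV[R]_m -> 'rV[R]_n)
    (G : 'rV[R]_m -> 'rV[R]_p) : open V ->
  smooth_on V F -> smooth_on V G -> smooth_on V (fun x => row_mx (F x) (G x)).
Proof.
move=> oV /(smooth_onP _ oV) sF /(smooth_onP _ oV) sG.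
apply/(smooth_onP _ oV) => k j; case: (split_ordP j) => i ->.
- by apply: ck_ext (sF k i) => // x _; rewrite row_mxEl.
- by apply: ck_ext (sG k i) => // x _; rewrite row_mxEr.
Qed.

Lemma smooth_on_lsubmx m n (V : set 'rV[R]_(m + n)) :
  open V -> smooth_on V (lsubmx : 'rV[R]_(m + n) -> 'rV[R]_m).
Proof.
move=> oV; have /(smooth_onP _ oV) sid := smooth_on_id V.
apply/(smooth_onP _ oV) => k j.
by apply: ck_ext (sid k (lshift n j)) => // x _; rewrite mxE.
Qed.

Lemma smooth_on_rsubmx m n (V : set 'rV[R]_(m + n)) :
  open V -> smooth_on V (rsubmx : 'rV[R]_(m + n) -> 'rV[R]_n).
Proof.
move=> oV; have /(smooth_onP _ oV) sid := smooth_on_id V.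
apply/(smooth_onP _ oV) => k j.
by apply: ck_ext (sid k (rshift m j)) => // x _; rewrite mxE.
Qed.

End SmoothOn.

(** * The mean value inequality for the supremum norm *)

Section MeanValue.
Variable R : realType.

Lemma entry_le_norm n (v : 'rV[R]_n) i : `|v 0 i| <= `|v|.
Proof.
rewrite [leRHS]/Num.norm /= mx_normrE.
exact: (le_bigmax _ (fun ij : 'I_1 * 'I_n => `|v ij.1 ij.2|) (0, i)).
Qed.

Lemma norm_le_entries n (v : 'rV[R]_n) c : 0 <= c -> (forall i, `|v 0 i| <= c) ->
  `|v| <= c.
Proof.
move=> c0 H; rewrite [leLHS]/Num.norm /= mx_normrE.
by apply/bigmax_leP; split=> // -[i j] _ /=; rewrite (ord1 i).
Qed.

Lemma ball_segment n (x0 x y : 'rV[R]_n) r t : ball x0 r x -> ball x0 r y ->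
  0 <= t -> t <= 1 -> ball x0 r (x + t *: (y - x)).
Proof.
rewrite -ball_normE /ball_ /= => xr yr t0 t1.
have -> : x0 - (x + t *: (y - x)) = (1 - t) *: (x0 - x) + t *: (x0 - y).
  by apply/rowP => i; rewrite !mxE; ring.
apply: le_lt_trans (ler_normD _ _) _.
rewrite !normrZ !ger0_norm // ?subr_ge0 //.
(* Strictness comes from the end point [y], which has weight [t]; hence the separate case
   [t = 0]. *)
have [->|t0'] := eqVneq t 0; first by rewrite subr0 mul0r addr0 mul1r.
have tp : 0 < t by rewrite lt_neqAle eq_sym t0'.
apply: (@le_lt_trans _ _ ((1 - t) * r + t * `|x0 - y|)).
  by rewrite lerD2r ler_wpM2l ?subr_ge0 // ltW.
rewrite -[ltRHS](_ : (1 - t) * r + t * r = r); last by ring.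
by rewrite ltrD2l ltr_pM2l.
Qed.

(** The mean value theorem on the segment yields one directional derivative. Expanded in partial
    derivatives it has [n] terms, each at most [e] times the norm of [y - x]. *)
Lemma mean_value_bound n (h : 'rV[R]_n -> R) x0 r e :
  (forall x, ball x0 r x -> differentiable h x) ->
  (forall x i, ball x0 r x -> `|'D_(delta_mx 0 i) h x| <= e) ->
  forall x y, ball x0 r x -> ball x0 r y -> `|h y - h x| <= n%:R * e * `|y - x|.
Proof.
move=> dh bh x y xr yr.
pose l (t : R) := x + t *: (y - x).
have dl t : differentiable l t.
  apply: differentiableD => //; exact: differentiableZl.
(* With this identity the difference quotients of [h \o l] at [t] become literally those of [h] at
   [l t] along [y - x], so the derivative is read off without a chain rule. *)
have quot (s t : R) : l (s *: 1 + t) = s *: (y - x) + l t.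
  by rewrite /l /GRing.scale /= mulr1; apply/rowP => i; rewrite !mxE; ring.
have dhl (t : R) : 0 <= t -> t <= 1 -> differentiable (h \o l) t.
  move=> t0 t1; apply: differentiable_comp => //; apply: dh.
  exact: ball_segment.
have H (t : R) : t \in `]0, 1[%R -> is_derive t 1 (h \o l) ('D_(y - x) h (l t)).
  rewrite in_itv /= => /andP[/ltW t0 /ltW t1].
  have dlt : differentiable h (l t) by apply/dh/(ball_segment xr yr).
  apply: DeriveDef; last first.
    rewrite /derive; set g1 := fun s => s^-1 *: _; set g2 := fun s => s^-1 *: _.
    by suff -> : g1 = g2 by []; apply/funext => s; rewrite /g1 /= quot.
  have -> : derivable (h \o l) t 1 = derivable h (l t) (y - x).
    rewrite /derivable; set g1 := fun s => s^-1 *: _; set g2 := fun s => s^-1 *: _.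
    by suff -> : g1 = g2 by []; apply/funext => s; rewrite /g1 /= quot.
  exact: diff_derivable.
have C : {within `[0, 1], continuous (h \o l)}.
  apply: continuous_in_subspaceT => t; rewrite inE /= in_itv /= => /andP[t0 t1].
  exact/differentiable_continuous/dhl.
have [c] := MVT_segment ler01 H C.
have l0 : l 0 = x by rewrite /l scale0r addr0.
have l1 : l 1 = y by rewrite /l scale1r addrC subrK.
rewrite in_itv /= => /andP[c0 c1]; rewrite l0 l1 subr0 mulr1 => ->.
have cr : ball x0 r (l c) by exact: ball_segment.
rewrite derive_partial; last exact: dh.
apply: le_trans (ler_norm_sum _ _ _) _.
have -> : n%:R * e * `|y - x| = \sum_(i < n) (`|y - x| * e).
  by rewrite sumr_const card_ord -mulr_natl; ring.
apply: ler_sum => i _; rewrite normrM; apply: ler_pM => //.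
- exact: entry_le_norm.
- exact: bh.
Qed.

End MeanValue.

(** * The inverse function theorem *)

(** Completeness is what [banach_fixed_point] asks of the space of rows. *)
HB.instance Definition _ (R : realType) (m n : nat) := Complete.on 'M[R]_(m, n).

Section InverseFunction.
Variable R : realType.

Lemma nbhsS2 (T : topologicalType) (x : T) (A B C : set T) :
  nbhs x A -> nbhs x B -> (forall y, A y -> B y -> C y) -> nbhs x C.
Proof.
by move=> nA nB H; apply: filterS (filterI nA nB) => y [Ay By]; exact: H.
Qed.

Lemma continuous_distP (X : topologicalType) (Y : normedModType R) (f : X -> Y) x :
  (forall e, 0 < e -> \forall y \near x, `|f x - f y| < e) ->
  {for x, continuous f}.
Proof. by move=> H; apply/cvgrPdist_lt. Qed.

Lemma ck_det k m n (V : set 'rV[R]_m) (A : 'rV[R]_m -> 'M[R]_n) : open V ->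
  (forall i j, ck k V (fun x => A x i j)) -> ck k V (fun x => \det (A x)).
Proof.
move=> oV H; apply: ck_sum => // s; apply: ckM => //; first exact: ck_cst.
by apply: ck_prod => // i; exact: H.
Qed.

(** Cramer's rule: the entry [(i, j)] is the cofactor [(j, i)] divided by the determinant. *)
Lemma ck_invmx k m n (V : set 'rV[R]_m) (A : 'rV[R]_m -> 'M[R]_n) : open V ->
  (forall x, V x -> A x \in unitmx) ->
  (forall i j, ck k V (fun x => A x i j)) ->
  forall i j, ck k V (fun x => invmx (A x) i j).
Proof.
move=> oV uA H i j.
have C1 : ck k V (fun x => (\det (A x))^-1).
  by apply: ckV => // [x /uA|]; [rewrite unitmxE unitfE|exact: ck_det].
have C2 : ck k V (fun x => cofactor (A x) j i).
  apply: ckM => //; first exact: ck_cst.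
  apply: ck_det => // i' j'.
  by apply: ck_ext (H (lift j i') (lift i j')) => // x _; rewrite !mxE.
apply: ck_ext (ckM oV C1 C2) => // x Vx.
by rewrite /invmx uA // !mxE.
Qed.

(** The Jacobian acts by [v *m jacobian F x], so its rows belong to source coordinates. Surjectivity
    of the differential is therefore [row_full]. *)
Lemma jacobianE m n (F : 'rV[R]_m -> 'rV[R]_n) x i j : differentiable F x ->
  jacobian F x i j = 'D_(delta_mx 0 i) (fun y => F y 0 j) x.
Proof.
by move=> dF; rewrite derive_coord // deriveEjacobian // -rowE [RHS]mxE.
Qed.

Lemma ck_jacobian m n (V : set 'rV[R]_m) (F : 'rV[R]_m -> 'rV[R]_n) : open V ->
  smooth_on V F -> forall k i j, ck k V (fun x => jacobian F x i j).
Proof.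
move=> oV sF k i j; have /(smooth_onP _ oV)/(_ k.+1 j) [_ /(_ i)] := sF.
by apply: ck_ext => // x Vx; rewrite jacobianE //; exact: smooth_on_diff sF Vx.
Qed.

Lemma lipschitz_near m (V : set 'rV[R]_m) (F : 'rV[R]_m -> 'rV[R]_m) x0 :
  open V -> V x0 -> smooth_on V F -> jacobian F x0 = 1%:M ->
  exists r : R, [/\ 0 < r, ball x0 r `<=` V,
    forall x, ball x0 r x -> jacobian F x \in unitmx &
    forall x y, ball x0 r x -> ball x0 r y ->
      `|F y - F x - (y - x)| <= 2^-1 * `|y - x|].
Proof.
(* [mean_value_bound] multiplies the bound on partial derivatives by [m], and [m * e] is at most one
   half; the successor keeps [e] positive for [m = 0]. *)
move=> oV Vx0 sF J0; pose e : R := (2 * m.+1%:R)^-1.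
have e0 : 0 < e by rewrite invr_gt0 mulr_gt0.
have cJ := ck_jacobian oV sF 0.
have cdet := @ck_det 0 m m V (jacobian F) oV cJ.
have nJ : \forall x \near x0, forall i j : 'I_m,
    `|jacobian F x0 i j - jacobian F x i j| < e.
  have H i j : \forall x \near x0, `|jacobian F x0 i j - jacobian F x i j| < e.
    by have /cvgrPdist_lt/(_ _ e0) := cJ i j _ Vx0.
  exact: filter_forall _ (fun i => filter_forall _ (H i)).
(* The determinant is 1 at [x0], so it is nonzero wherever it differs from that value by less than
   1. *)
have ndet : \forall x \near x0, `|\det (jacobian F x0) - \det (jacobian F x)| < 1.
  by have /cvgrPdist_lt/(_ _ ltr01) := cdet _ Vx0.
have /nbhs_ballP [r /= r0 br] : nbhs x0 (V `&` [set x |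
    (forall i j : 'I_m, `|jacobian F x0 i j - jacobian F x i j| < e) /\
    `|\det (jacobian F x0) - \det (jacobian F x)| < 1]).
  exact: filterI (open_near oV Vx0) (filterI nJ ndet).
have bV x : ball x0 r x -> V x by move=> /br [].
exists r; split=> //.
- move=> x /br [_ [_]]; rewrite J0 det1 unitmxE unitfE => H.
  by apply/eqP => E; move: H; rewrite E subr0 normr1 ltxx.
- move=> x y xr yr; apply: norm_le_entries; first by rewrite mulr_ge0 // invr_ge0.
  move=> j; pose h z : R := F z 0 j - z 0 j.
  have -> : (F y - F x - (y - x)) 0 j = h y - h x.
    by rewrite /h !mxE; ring.
  have dFj z : ball x0 r z -> differentiable (fun y => F y 0 j) z.
    move=> /bV Vz; apply: (differentiable_rowP F z).1.
    exact: smooth_on_diff sF Vz.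
  have dc z : differentiable (fun y : 'rV[R]_m => y 0 j) z.
    exact: differentiable_coord.
  have := @mean_value_bound R m h x0 r e _ _ x y xr yr.
  have dh z : ball x0 r z -> differentiable h z.
    by move=> zr; exact: (differentiableB (dFj z zr) (dc z)).
  have bh z i : ball x0 r z -> `|'D_(delta_mx 0 i) h z| <= e.
    move=> zr; have Vz := bV z zr.
    have -> : 'D_(delta_mx 0 i) h z =
        'D_(delta_mx 0 i) (fun y => F y 0 j) z -
        'D_(delta_mx 0 i) (fun y : 'rV[R]_m => y 0 j) z.
      by apply: (@deriveB _ _ _ (fun y => F y 0 j)); apply: diff_derivable;
        [exact: dFj|exact: dc].
    rewrite -jacobianE; last exact: smooth_on_diff sF Vz.
    rewrite (derive_coord (F := id)) // derive_id.
    have [_ [/(_ i j) + _]] := br z zr.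
    by rewrite J0 distrC !mxE eqxx /= eq_sym => /ltW.
  move=> /(_ dh (fun z i => @bh z i)) /le_trans; apply.
  rewrite ler_wpM2r // /e invfM mulrCA ger_pMr ?invr_gt0 //.
  by rewrite ler_pdivrMr // mul1r ler_nat.
Qed.

Lemma solve_near m (F : 'rV[R]_m -> 'rV[R]_m) x1 y r : 0 < r ->
  (forall x x', closed_ball x1 r x -> closed_ball x1 r x' ->
      `|F x' - F x - (x' - x)| <= 2^-1 * `|x' - x|) ->
  `|y - F x1| <= r / 2 -> exists2 x, closed_ball x1 r x & F x = y.
Proof.
move=> r0 H yF.
have cb x : closed_ball x1 r x = (`|x1 - x| <= r) :> Prop.
  by rewrite closed_ballE.
have b1 : closed_ball x1 r x1 by rewrite cb subrr normr0 ltW.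
(* the fixed points of [T] are the solutions of [F x = y] *)
pose T x := x - F x + y.
(* The contraction estimate uses one half of the radius, and [y - F x1] the other half. *)
have TT : set_fun (closed_ball x1 r) (closed_ball x1 r) T.
  move=> x xr; rewrite cb.
  have -> : x1 - T x = (F x - F x1 - (x - x1)) - (y - F x1).
    by rewrite /T; apply/rowP => i; rewrite !mxE; ring.
  apply: le_trans (ler_normB _ _) _.
  have h1 := H _ _ b1 xr.
  have h2 : `|x - x1| <= r by rewrite distrC -cb.
  lra.
pose Tf : {fun (closed_ball x1 r) >-> (closed_ball x1 r)} := mkfun_fun TT.
have ctr : is_contraction Tf.
  have h : 0 <= (2^-1 : R) by rewrite invr_ge0.
  exists (NngNum h); split; first by rewrite /= invf_lt1 // ltr1n.
  move=> [u v] /= [ur vr].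
  have -> : T u - T v = - (F u - F v - (u - v)).
    by rewrite /T; apply/rowP => i; rewrite !mxE; ring.
  by rewrite normrN; exact: H.
have [x xr xT] := banach_fixed_point ctr (@closed_ball_closed _ _ _ _)
  (ex_intro _ _ b1).
exists x => //; have : x = x - F x + y := xT.
by move=> E; apply/eqP; rewrite -subr_eq0; apply/eqP/rowP => i;
  move/rowP: E => /(_ i); rewrite !mxE; lra.
Qed.

Lemma norm_mulmx_bound m (A : 'M[R]_m) :
  exists2 c, 0 < c & forall x : 'rV[R]_m, `|x *m A| <= c * `|x|.
Proof.
exists (1 + \sum_i \sum_j `|A i j|).
  by apply: ltr_pwDl => //; do 2! (apply: sumr_ge0 => ? _).
move=> x; apply: norm_le_entries.
  by rewrite mulr_ge0 // addr_ge0 //; do 2! (apply: sumr_ge0 => ? _).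
move=> j; rewrite mxE mulrDl mul1r; apply: ler_wpDl => //.
apply: le_trans (ler_norm_sum _ _ _) _; rewrite mulr_suml.
apply: ler_sum => i _; rewrite normrM mulrC; apply: ler_pM => //.
  by rewrite (bigD1 j) //= lerDl; apply: sumr_ge0.
exact: entry_le_norm.
Qed.

Lemma diff_mulmx m n (A : 'M[R]_(m, n)) (x v : 'rV[R]_m) :
  'd (fun y : 'rV[R]_m => y *m A) x v = v *m A.
Proof.
have cA : continuous (mulmxr A : 'rV[R]_m -> 'rV[R]_n).
  move=> y; apply: differentiable_continuous.
  by apply: (smooth_on_diff (smooth_on_lin A openT)).
have [//|_ ->//] := is_diffP (f := fun y : 'rV[R]_m => y *m A) (x := x) cA.
move=> e e0; apply: (nbhsS2 (@filterT _ (nbhs x) _) filterT) => y _ _ /=.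
by rewrite -mulmxBl subrr normr0 mulr_ge0 // ltW.
Qed.

Lemma inverse_function_id m (V : set 'rV[R]_m) (F : 'rV[R]_m -> 'rV[R]_m) x0 :
  open V -> V x0 -> smooth_on V F -> jacobian F x0 = 1%:M ->
  exists U W (G : 'rV[R]_m -> 'rV[R]_m),
  [/\ open U /\ U `<=` V, U x0, open W /\ smooth_on W G,
    forall x, U x -> W (F x) /\ G (F x) = x &
    forall y, W y -> U (G y) /\ F (G y) = y].
Proof.
move=> oV Vx0 sF J0; have [r [r0 rV uJ lip]] := lipschitz_near oV Vx0 sF J0.
pose U := ball x0 r; pose W := F @` U.
have oU : open U by exact: ball_open.
(* [F] differs from the identity by a map of Lipschitz constant one half, so it shrinks distances by
   a factor of at most two. This gives both the injectivity of [F] and the Lipschitz bound on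
   [G]. *)
have expand x y : U x -> U y -> `|y - x| <= 2 * `|F y - F x|.
  move=> Ux Uy; have := lip x y Ux Uy.
  have : `|y - x| <= `|F y - F x| + `|F y - F x - (y - x)|.
    apply: le_trans (ler_normB _ _); rewrite le_eqVlt; apply/orP; left.
    by apply/eqP; congr `|_|; apply/rowP => i; rewrite !mxE; ring.
  lra.
have inj x y : U x -> U y -> F x = F y -> x = y.
  move=> Ux Uy E; have := expand x y Ux Uy; rewrite E subrr normr0 mulr0.
  by rewrite normr_le0 subr_eq0 => /eqP ->.
have oW : open W.
  rewrite openE => _ [x1 Ux1 <-].
  have /nbhs_closedballP [/= rho' br] : nbhs x1 U := open_near oU Ux1.
  have rho0 : 0 < rho'%:num by []. move: (rho'%:num) rho0 br => rho rho0 br.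
  apply/nbhs_ballP; exists (rho / 2) => /=; first by rewrite divr_gt0.
  move=> y; rewrite -ball_normE /ball_ /= distrC => yF.
  have [x xr <-] := solve_near rho0 (fun x x' h h' => lip x x' (br x h) (br x' h')) (ltW yF).
  by exists x => //; exact: br.
pose G y := xget x0 [set x | U x /\ F x = y].
have GP y : W y -> U (G y) /\ F (G y) = y.
  move=> [x Ux Fx]; rewrite /G; case: xgetP => [z -> //|/(_ x) []].
  by split.
have GF x : U x -> G (F x) = x.
  move=> Ux; have [UG FG] : U (G (F x)) /\ F (G (F x)) = F x.
    by apply: GP; exists x.
  exact: inj.
have dF x : U x -> differentiable F x.
  by move=> /rV Vx; exact: smooth_on_diff sF Vx.
have lipG (y y1 : 'rV[R]_m) : W y -> W y1 -> `|G y - G y1| <= 2 * `|y - y1|.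
  move=> Wy Wy1; have [U1 E1] := GP _ Wy; have [U2 E2] := GP _ Wy1.
  by have := expand _ _ U2 U1; rewrite E1 E2.
have dG (y1 : 'rV[R]_m) : W y1 -> differentiable G y1 /\
    forall v, 'd G y1 v = v *m invmx (jacobian F (G y1)).
  move=> Wy1; have [U1 F1] := GP _ Wy1.
  set A := invmx _.
  have JA : jacobian F (G y1) *m A = 1%:M by rewrite mulmxV //; exact: uJ.
  have cA : continuous (mulmxr A : 'rV[R]_m -> 'rV[R]_m).
    move=> x; apply: differentiable_continuous.
    by apply: (smooth_on_diff (smooth_on_lin A openT)).
  have [c c0 bA] := norm_mulmx_bound A.
  suff [d1 d2] : differentiable G y1 /\ 'd G y1 = mulmxr A :> ('rV[R]_m -> 'rV[R]_m).
    by split=> // v; rewrite d2.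
  apply: is_diffP => // e e0.
  (* The error of [F] is transported to [G] by the matrix [A], which costs a factor [c], and is
     compared with [y - y1] through the Lipschitz bound on [G], which costs a factor 2. *)
  have e'0 : 0 < e / (2 * c) by rewrite divr_gt0 // mulr_gt0.
  have nF := diff_bound (dF _ U1) e'0.
  have nG : {for y1, continuous G}.
    apply: continuous_distP => d d0.
    have n1 : \forall y \near y1, ball y1 (d / 2) y.
      by apply: nbhsx_ballx; rewrite divr_gt0.
    apply: (nbhsS2 (open_near oW Wy1) n1) => y Wy.
    rewrite -ball_normE /ball_ /= => yd; have := lipG _ _ Wy1 Wy.
    lra.
  have nFG := nG _ nF.
  apply: (nbhsS2 (open_near oW Wy1) nFG) => y Wy /=.
  have [Uy Fy] := GP _ Wy; rewrite Fy F1.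
  set t := y - y1 - _ => bt.
  have -> : G y - G y1 - (y - y1) *m A = - (t *m A).
    have dFy := dF _ U1.
    have -> : t = y - y1 - (G y - G y1) *m jacobian F (G y1).
      by rewrite -deriveEjacobian // deriveE.
    by rewrite [in RHS]mulmxBl opprB -mulmxA JA mulmx1.
  rewrite normrN; apply: le_trans (bA _) _.
  rewrite -ler_pdivlMl //; apply: le_trans bt _.
  have := lipG _ _ Wy Wy1.
  have -> : e / (2 * c) * `|G y - G y1| = c^-1 * (e * (`|G y - G y1| / 2)).
    by field; rewrite gt_eqF.
  move=> h; rewrite ler_pM2l ?invr_gt0 // ler_pM2l //; lra.
exists U, W, G; split.
- by split.
- exact: ballxx.
(* The partial derivatives of [G] are entries of the inverse Jacobian of [F] evaluated at [G y], so
   order [k] for [G] gives order [k.+1]. *)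
- split=> //; apply/(smooth_onP _ oW); elim=> [|k IH] j.
    move=> y Wy; have [d _] := dG y Wy.
    by apply: (continuous_rowP G y).1; exact: differentiable_continuous.
  split=> [y Wy|i]; first by have [d _] := dG y Wy; exact: (differentiable_rowP G y).1.
  have sFU := smooth_on_sub oU oV rV sF.
  have := ck_comp oW oU (fun y Wy => (GP y Wy).1) IH
    (ck_invmx oU uJ (ck_jacobian oU sFU k) i j).
  apply: ck_ext => // y Wy; have [d E] := dG y Wy.
  by rewrite derive_coord // deriveE // E -rowE mxE.
- by move=> x Ux; split; [exists x|exact: GF].
- exact: GP.
Qed.

(** Multiplying the values of [F] by the inverse of its Jacobian at [x0] reduces to the case of the
    identity Jacobian; the same multiplication is then put in front of the inverse map. *)
Lemma inverse_function m (V : set 'rV[R]_m) (F : 'rV[R]_m -> 'rV[R]_m) x0 :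
  open V -> V x0 -> smooth_on V F -> jacobian F x0 \in unitmx ->
  exists U W (G : 'rV[R]_m -> 'rV[R]_m),
  [/\ open U /\ U `<=` V, U x0, open W /\ smooth_on W G,
    forall x, U x -> W (F x) /\ G (F x) = x &
    forall y, W y -> U (G y) /\ F (G y) = y].
Proof.
move=> oV Vx0 sF uJ; pose A := invmx (jacobian F x0); pose F1 x := F x *m A.
have sF1 : smooth_on V F1.
  exact: (smooth_on_comp oV openT (fun _ _ => I) sF (smooth_on_lin A openT)).
have dF := smooth_on_diff sF Vx0.
have J1 : jacobian F1 x0 = 1%:M.
  apply/row_matrixP => i; rewrite rowE -deriveEjacobian; last first.
    exact: smooth_on_diff sF1 Vx0.
  have dA x : differentiable (fun y : 'rV[R]_m => y *m A) x.
    exact: (smooth_on_diff (smooth_on_lin A openT)).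
  rewrite deriveE; last exact: smooth_on_diff sF1 Vx0.
  rewrite (diff_comp dF (dA _)) /=.
  rewrite diff_mulmx.
  by rewrite -deriveE // deriveEjacobian // -mulmxA mulmxV // rowE.
have [U [W [G [[oU UV] Ux0 [oW sG] FG GF]]]] := inverse_function_id oV Vx0 sF1 J1.
have oW' : open [set y | W (y *m A)].
  by have := open_preim openT oW (smooth_on_lin A openT); rewrite setTI.
exists U, [set y | W (y *m A)], (fun y => G (y *m A)); split=> //.
- split=> //; apply: (smooth_on_comp oW' oW _ (smooth_on_lin A oW') sG) => //.
- by move=> y /GF [Uy]; split=> //; apply: (can_inj (mulmxKV uJ)).
Qed.

End InverseFunction.

(** * Manifolds as diffeological spaces *)

Section TotalPlots.
Variable R : realType.
Local Notation dspace := (dspace R).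

(* A plot on [U] presented as a total map, whose values outside [U] are junk. *)
Definition pl (X : dspace) n (U : set 'rV[R]_n) (p : 'rV[R]_n -> X) : Prop :=
  plot X (fun u : U => p (set_val u)).

Section OneSpace.
Variable X : dspace.

Lemma pl_open n (U : set 'rV[R]_n) (p : 'rV[R]_n -> X) : pl U p -> open U.
Proof. exact: plot_open. Qed.

Lemma pl_ext n (U : set 'rV[R]_n) (p q : 'rV[R]_n -> X) :
  (forall u, U u -> p u = q u) -> pl U p -> pl U q.
Proof.
move=> pq; rewrite /pl; congr (plot X _); apply/funext => u.
exact/pq/set_valP.
Qed.

Lemma pl_comp n m (U : set 'rV[R]_n) (V : set 'rV[R]_m) (p : 'rV[R]_n -> X) F :
  pl U p -> open V -> smooth_on V F -> (forall v, V v -> U (F v)) ->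
  pl V (p \o F).
Proof.
move=> pp oV sF FVU.
have FVU' (v : V) : U (F (set_val v)) by exact/FVU/set_valP.
exact: (plot_comp FVU' pp oV sF).
Qed.

Lemma pl_sub n (U V : set 'rV[R]_n) (p : 'rV[R]_n -> X) :
  open V -> V `<=` U -> pl U p -> pl V p.
Proof. by move=> oV VU pp; apply: (pl_comp pp oV (smooth_on_id V)). Qed.

Lemma pl_local n (U : set 'rV[R]_n) (p : 'rV[R]_n -> X) : open U ->
  (forall u, U u -> exists V, [/\ open V, V u & pl V p]) -> pl U p.
Proof.
move=> oU H; apply: plot_local => // u.
have [V [oV Vu pp]] := H _ (set_valP u).
exists (V `&` U), (@subIsetr _ V U); split.
- exact: openI.
- by split=> //; exact: set_valP.
- exact: (pl_sub (openI oV oU) (@subIsetl _ V U) pp).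
Qed.

Lemma pl_cst n (U : set 'rV[R]_n) (x : X) : open U -> pl U (fun=> x).
Proof. exact: plot_cst. Qed.

Lemma pl_extend n (U : set 'rV[R]_n) (x0 : X) (p : U -> X) : plot X p ->
  exists2 q, pl U q & forall u : U, q (set_val u) = p u.
Proof.
move=> pp.
pose q v := if pselect (U v) is left Uv then p (set_mk Uv) else x0.
have qE (u : U) : q (set_val u) = p u.
  rewrite /q; case: pselect => [Uu|/(_ (set_valP u))//].
  by congr p; exact: val_inj.
by exists q => //; rewrite /pl (_ : (fun _ => _) = p) //; exact/funext.
Qed.

(** The open sets of the D-topology, the finest topology for which all plots are continuous. *)
Definition dopen (A : set X) : Prop :=
  forall n (U : set 'rV[R]_n) p, pl U p -> open (U `&` p @^-1` A).

Lemma dopenT : dopen setT.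
Proof. by move=> n U p pp; rewrite preimage_setT setIT; exact: pl_open pp. Qed.

Lemma dopen0 : dopen set0.
Proof. by move=> n U p pp; rewrite preimage_set0 setI0; exact: open0. Qed.

Lemma dopenI A B : dopen A -> dopen B -> dopen (A `&` B).
Proof.
move=> oA oB n U p pp; rewrite preimage_setI setIIr.
by apply: openI; [exact: oA|exact: oB].
Qed.

Lemma dopen_bigcup (I : Type) (D : set I) (f : I -> set X) :
  (forall i, D i -> dopen (f i)) -> dopen (\bigcup_(i in D) f i).
Proof.
move=> H n U p pp; rewrite preimage_bigcup setI_bigcupr.
by apply: bigcup_open => i Di; exact: H.
Qed.

Definition dhausdorff : Prop := forall x y : X, x <> y ->
  exists A B, [/\ dopen A, dopen B, A x, B y & forall z, A z -> B z -> False].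

Definition dbasis (I : Type) (B : I -> set X) : Prop :=
  (forall i, dopen (B i)) /\
  forall A x, dopen A -> A x -> exists i, B i x /\ B i `<=` A.

Definition dsecond_countable : Prop := exists B : nat -> set X, dbasis B.

Lemma dbasis_countable (I : countType) (B : I -> set X) :
  dbasis B -> dsecond_countable.
Proof.
(* Numbers that encode no index get the empty set, which is D-open and does not disturb a basis. *)
move=> [oB bB]; exists (fun n => if unpickle n is Some i then B i else set0).
split=> [n|A x oA Ax]; first by case: unpickle => // ; exact: dopen0.
by have [i Bi] := bB A x oA Ax; exists (pickle i); rewrite pickleK.
Qed.

End OneSpace.

Section Maps.
Variables (X Y : dspace) (f : X -> Y).

Lemma pl_smooth n (U : set 'rV[R]_n) p : smooth f -> pl U p -> pl U (f \o p).
Proof. by move=> sf pp; exact: sf pp. Qed.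

(** When [X] is empty a plot has no total extension, but its domain is then empty too and the
    locality axiom settles the case. *)
Lemma smooth_pl : (forall n (U : set 'rV[R]_n) p, pl U p -> pl U (f \o p)) ->
  smooth f.
Proof.
move=> H n U p pp; have [[x _]|nX] := pselect (exists x : X, True).
  have [q pq qE] := pl_extend x pp.
  have -> : f \o p = (fun u => (f \o q) (set_val u)).
    by apply/funext => u /=; rewrite qE.
  exact: (H _ _ q pq).
by apply: plot_local => [|u]; [exact: plot_open pp|case: nX; exists (p u)].
Qed.

Lemma dopen_preimage A : smooth f -> dopen A -> dopen (f @^-1` A).
Proof. by move=> sf oA n U p pp; exact: (oA _ _ _ (pl_smooth sf pp)). Qed.

Lemma dhausdorff_inj : smooth f -> injective f -> dhausdorff Y -> dhausdorff X.
Proof.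
move=> sf fI hY x y xy; have [|A [B [oA oB Ax By AB]]] := hY (f x) (f y).
  by move/fI.
exists (f @^-1` A), (f @^-1` B).
by split=> //; [exact: dopen_preimage|exact: dopen_preimage|move=> z; exact: AB].
Qed.

End Maps.

Lemma dhausdorff_prod X Y : dhausdorff X -> dhausdorff Y ->
  dhausdorff (prod_dspace X Y).
Proof.
move=> hX hY [x y] [x' y'] ne.
have s1 : @smooth R (prod_dspace X Y) X fst by move=> n U p [].
have s2 : @smooth R (prod_dspace X Y) Y snd by move=> n U p [].
have [E|nx] := pselect (x = x').
  have ny : y <> y' by move=> E'; apply: ne; rewrite E E'.
  have [A [B [oA oB Ax By AB]]] := hY _ _ ny.
  exists (snd @^-1` A), (snd @^-1` B).
  by split=> //; [exact: (dopen_preimage s2)|exact: (dopen_preimage s2)|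
    move=> z; exact: AB].
have [A [B [oA oB Ax By AB]]] := hX _ _ nx.
exists (fst @^-1` A), (fst @^-1` B).
by split=> //; [exact: (dopen_preimage s1)|exact: (dopen_preimage s1)|
  move=> z; exact: AB].
Qed.

(* [lpar] and [lcrd] are inverse to each other between [lU] and [lD], and are junk
   elsewhere. *)
Record lchart (X : dspace) n := LChart {
  lU : set 'rV[R]_n;
  lD : set X;
  lpar : 'rV[R]_n -> X;
  lcrd : X -> 'rV[R]_n;
  lD_open : dopen lD;
  lpar_pl : pl lU lpar;
  lparD : forall u, lU u -> lD (lpar u);
  lparK : forall u, lU u -> lcrd (lpar u) = u;
  lcrdU : forall x, lD x -> lU (lcrd x);
  lcrdK : forall x, lD x -> lpar (lcrd x) = x;
  lcrd_smooth : forall m (W : set 'rV[R]_m) q, pl W q ->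
    (forall w, W w -> lD (q w)) -> smooth_on W (lcrd \o q)
}.

Arguments lD_open {X n} l.
Arguments lpar_pl {X n} l.

Definition loc_eucl n (X : dspace) : Prop :=
  forall x, exists c : lchart X n, lD c x.

Section LChart.
Variables (X : dspace) (n : nat) (c : lchart X n).

Lemma lU_open : open (lU c).
Proof. exact: pl_open (lpar_pl c). Qed.

Lemma lcrd_inj x y : lD c x -> lD c y -> lcrd c x = lcrd c y -> x = y.
Proof. by move=> Dx Dy E; rewrite -(lcrdK Dx) E lcrdK. Qed.

Lemma lchart_pl m (W : set 'rV[R]_m) q : open W -> (forall w, W w -> lD c (q w)) ->
  smooth_on W (lcrd c \o q) -> pl W q.
Proof.
move=> oW qD sq.
have := pl_comp (lpar_pl c) oW sq (fun w Ww => lcrdU (qD w Ww)).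
by apply: pl_ext => w Ww /=; rewrite lcrdK //; exact: qD.
Qed.

Lemma lcrd_smooth_restr m (W : set 'rV[R]_m) q : pl W q ->
  smooth_on (W `&` q @^-1` lD c) (lcrd c \o q).
Proof.
move=> pq; apply: lcrd_smooth; last by move=> w [].
by apply: (@pl_sub _ _ W) => //; exact: (lD_open c _ _ _ pq).
Qed.

(** This is the homeomorphism axiom of [manifold] for the D-topology. For the converse direction,
    the part of a plot that lies in the chart domain is recovered from its smooth coordinates, and
    openness is pulled back along these. *)
Lemma lchart_dopen A : A `<=` lD c -> dopen A <-> open (lcrd c @` A).
Proof.
move=> AD; have -> : lcrd c @` A = lU c `&` lpar c @^-1` A.
  apply/seteqP; split=> [_ [x Ax <-]|u [Uu Au]].
    have Dx := AD x Ax.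
    by split; [exact: lcrdU|rewrite /= lcrdK].
  by exists (lpar c u) => //; rewrite lparK.
split=> [oA|oA m W q pq]; first exact: (oA _ _ _ (lpar_pl c)).
have -> : W `&` q @^-1` A = (W `&` q @^-1` lD c) `&`
    (lcrd c \o q) @^-1` (lU c `&` lpar c @^-1` A).
  apply/seteqP; split=> [w [Ww Aw]|w [[Ww Dw] [_]]] /=.
    have Dw := AD _ Aw; have Uw := lcrdU Dw.
    by do !split=> //; rewrite /= lcrdK.
  by rewrite /= lcrdK.
apply: open_preim => //; last exact: lcrd_smooth_restr.
exact: (lD_open c _ _ _ pq).
Qed.

Section Restrict.
Variables (A : set X) (oA : dopen A).

Let U := lU c `&` lpar c @^-1` A.
Let D := lD c `&` A.

Lemma restr_open : dopen D. Proof. by apply: dopenI => //; exact: lD_open. Qed.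
Lemma restr_pl : pl U (lpar c).
Proof.
by apply: (pl_sub _ _ (lpar_pl c)); [exact: (@oA _ _ _ (lpar_pl c))|move=> u []].
Qed.
Lemma restr_parD u : U u -> D (lpar c u).
Proof. by case=> Uu Au; split=> //; exact: lparD. Qed.
Lemma restr_parK u : U u -> lcrd c (lpar c u) = u.
Proof. by case=> Uu _; exact: lparK. Qed.
Lemma restr_crdU x : D x -> U (lcrd c x).
Proof. by case=> Dx Ax; split; [exact: lcrdU|rewrite /= lcrdK]. Qed.
Lemma restr_crdK x : D x -> lpar c (lcrd c x) = x.
Proof. by case=> Dx _; exact: lcrdK. Qed.
Lemma restr_smooth m (W : set 'rV[R]_m) q : pl W q ->
  (forall w, W w -> D (q w)) -> smooth_on W (lcrd c \o q).
Proof. by move=> pq H; apply: lcrd_smooth => // w /H []. Qed.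

Definition lrestr : lchart X n := LChart restr_open restr_pl restr_parD
  restr_parK restr_crdU restr_crdK restr_smooth.

End Restrict.

End LChart.

End TotalPlots.

Arguments lU_open {R X n} c.
Arguments lpar_pl {R X n} l.

(** * From a model to charts and the D-topology *)

Section FromModels.
Variable R : realType.
Local Notation dspace := (dspace R).

Lemma smooth_paramP (M : manifold R) n (U : set 'rV[R]_n) (p : 'rV[R]_n -> M) :
  smooth_param (fun u : U => p (set_val u)) <->
  open U /\ forall i u, U u -> mdom i (p u) ->
    exists V (F : 'rV[R]_n -> 'rV[R]_(mdim M)),
      [/\ open V, V u, V `<=` U, smooth_on V F &
        forall v, V v -> mdom i (p v) /\ mchart i (p v) = F v].
Proof.
split=> [[oU H]|[oU H]]; split=> // i u.
- move=> Uu iu; have [V [VU [F [oV Vu sF FP]]]] := H i (set_mk Uu) iu.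
  exists V, F; split=> // v Vv; exact: (FP (set_mk Vv)).
- move=> iu; have [V [F [oV Vu VU sF FP]]] := H i _ (set_valP u) iu.
  exists V, VU, F; split=> // v; exact: (FP _ (set_valP v)).
Qed.

Section Model.
Variables (X : dspace) (M : manifold R) (e : X -> M).
Hypothesis me : models e.

Lemma pl_modelP n (U : set 'rV[R]_n) p : pl (X := X) U p <->
  open U /\ forall i u, U u -> mdom i (e (p u)) ->
    exists V (F : 'rV[R]_n -> 'rV[R]_(mdim M)),
      [/\ open V, V u, V `<=` U, smooth_on V F &
        forall v, V v -> mdom i (e (p v)) /\ mchart i (e (p v)) = F v].
Proof.
have [_ H] := me; apply: iff_trans (H _ _ _) _.
exact: (smooth_paramP U (e \o p)).
Qed.

Lemma model_inv : exists g : M -> X, cancel e g /\ cancel g e.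
Proof. by have [[g K1 K2] _] := me; exists g. Qed.

Lemma mchart_open (i j : midx M) :
  open (mchart i @` (mdom i `&` mdom j)).
Proof.
apply/(mchart_homeo (@subIsetl _ _ _)).
by apply: openI; exact: mdom_open.
Qed.

Lemma model_dopen (A : set M) : open A -> dopen (e @^-1` A).
Proof.
move=> oA n U p pp; have /pl_modelP [oU H] := pp.
rewrite openE => u [Uu Au]; have [i iu] := mdom_cover (e (p u)).
have [V [F [oV Vu VU sF FP]]] := H i u Uu iu.
have oAi : open (mchart i @` (mdom i `&` A)).
  by apply/(mchart_homeo (@subIsetl _ _ _)); apply: openI => //; exact: mdom_open.
have FAi : (mchart i @` (mdom i `&` A)) (F u).
  by have [_ <-] := FP u Vu; exists (e (p u)).
have W := open_near (open_preim oV oAi sF) (conj Vu FAi).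
rewrite /interior; apply: filterS W => v [Vv [y [iy Ay] yF]].
split; first exact: VU.
have [iv Fv] := FP v Vv; rewrite -Fv in yF.
by rewrite /= -(mchart_inj iy iv yF).
Qed.

Section Chart.
Variables (g : M -> X) (eg : cancel e g) (ge : cancel g e) (x0 : X) (i : midx M).

Let U := mchart i @` mdom i.
Let inv (u : 'rV[R]_(mdim M)) : M :=
  xget (e x0) [set y | mdom i y /\ mchart i y = u].

Lemma model_invP u : U u -> mdom i (inv u) /\ mchart i (inv u) = u.
Proof.
move=> [y iy yu]; rewrite /inv; case: xgetP => [z -> //|/(_ y) []].
by split.
Qed.

Lemma model_invK y : mdom i y -> inv (mchart i y) = y.
Proof.
move=> iy; have [|i1 i2] := @model_invP (mchart i y); first by exists y.
exact: (mchart_inj i1 iy i2).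
Qed.

Lemma model_U_open : open U.
Proof. by apply/mchart_homeo => //; exact: mdom_open. Qed.

Lemma model_pl : pl U (g \o inv).
Proof.
apply/pl_modelP; split; first exact: model_U_open.
move=> j u Uu; rewrite /= ge => ju; have [iu Eu] := model_invP Uu.
have [F [sF FP]] := mchart_smooth i j.
exists (mchart i @` (mdom i `&` mdom j)), F; split=> //.
- exact: mchart_open.
- by exists (inv u).
- by move=> _ [y [iy _] <-]; exists y.
- move=> _ [y [iy jy] <-]; rewrite /= ge model_invK //; split=> //.
  by rewrite FP.
Qed.

Lemma model_parD u : U u -> mdom i (e ((g \o inv) u)).
Proof. by move=> Uu; rewrite /= ge; have [] := model_invP Uu. Qed.
Lemma model_parK u : U u -> mchart i (e ((g \o inv) u)) = u.
Proof. by move=> Uu; rewrite /= ge; have [] := model_invP Uu. Qed.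
Lemma model_crdU x : mdom i (e x) -> U (mchart i (e x)).
Proof. by move=> ix; exists (e x). Qed.
Lemma model_crdK x : mdom i (e x) -> (g \o inv) (mchart i (e x)) = x.
Proof. by move=> ix; rewrite /= model_invK // eg. Qed.
Lemma model_crd_smooth m (W : set 'rV[R]_m) q : pl W q ->
  (forall w, W w -> mdom i (e (q w))) -> smooth_on W ((mchart i \o e) \o q).
Proof.
move=> /pl_modelP [oW H] qD; apply: smooth_on_local => // w Ww.
have [V [F [oV Vw VW sF FP]]] := H i w Ww (qD w Ww).
by exists V, F; split=> // v Vv _; have [_ <-] := FP v Vv.
Qed.

Definition model_chart : lchart X (mdim M) :=
  @LChart R X _ U (e @^-1` mdom i) (g \o inv) (mchart i \o e)
    (model_dopen (mdom_open i)) model_pl model_parD model_parK model_crdU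
    model_crdK model_crd_smooth.

End Chart.

Lemma model_lchart i x : mdom i (e x) -> exists c : lchart X (mdim M),
  lD c = e @^-1` mdom i /\ lcrd c = mchart i \o e.
Proof.
move=> ix; have [g [eg ge]] := model_inv.
by exists (model_chart eg ge x i).
Qed.

Lemma model_loc_eucl : loc_eucl (mdim M) X.
Proof.
move=> x; have [i ix] := mdom_cover (e x); have [c [D _]] := model_lchart ix.
by exists c; rewrite D.
Qed.

(** The topology of a model is forced: it is the D-topology, as one checks inside each chart domain.
    Being Hausdorff or second-countable is thus independent of the model. *)
Lemma model_openE (A : set M) : open A <-> dopen (e @^-1` A).
Proof.
split=> [|oA]; first exact: model_dopen.
have [g [eg ge]] := model_inv.
have -> : A = \bigcup_i (A `&` mdom i).
  apply/seteqP; split=> [y Ay|y [i _ []//]].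
  by have [i iy] := mdom_cover y; exists i.
apply: bigcup_open => i _; rewrite openE => y [Ay iy].
have ix : mdom i (e (g y)) by rewrite ge.
have [c [cD cC]] := model_lchart ix.
have oAi : open (A `&` mdom i).
  apply/(mchart_homeo (@subIsetr _ _ _)).
  have -> : mchart i @` (A `&` mdom i) = lcrd c @` (e @^-1` (A `&` mdom i)).
    rewrite cC; apply/seteqP; split=> [_ [z Az <-]|_ [x Ax <-]].
      by exists (g z); rewrite /= ?ge.
    by exists (e x).
  apply/lchart_dopen; first by rewrite cD => x [].
  by rewrite preimage_setI -cD; apply: dopenI => //; exact: lD_open.
by rewrite /interior; exact: (open_near oAi).
Qed.

Lemma model_hausdorff : hausdorff_space M -> dhausdorff X.
Proof.
rewrite open_hausdorff => H x y xy; have [g [eg ge]] := model_inv.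
have nxy : e x != e y by apply/eqP => /(can_inj eg).
have [[A B] /= [/set_mem Ax /set_mem By] [oA oB /eqP AB]] := H _ _ nxy.
exists (e @^-1` A), (e @^-1` B).
split=> //; [exact/model_dopen|exact/model_dopen|move=> z Az Bz].
by have : (A `&` B) (e z) by []; rewrite AB.
Qed.

Lemma model_second_countable : @second_countable M -> dsecond_countable X.
Proof.
move=> [B cB [oB bB]]; have /countable_injP [f fI] := cB.
exists (fun n => e @^-1` [set y | exists2 A, B A /\ f A = n & A y]).
split=> [n|A x oA Ax].
  apply: model_dopen.
  have -> : [set y | exists2 A, B A /\ f A = n & A y] =
      \bigcup_(A in [set A | B A /\ f A = n]) A.
    by apply/seteqP; split=> y [A ? ?]; exists A.
  by apply: bigcup_open => A [BA _]; exact: oB.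
have [g [eg ge]] := model_inv.
have oA' : open (g @^-1` A).
  apply/model_openE; rewrite -comp_preimage (_ : g \o e = id) //.
  exact/funext.
have nA' : nbhs (e x) (g @^-1` A) by apply: open_near => //; rewrite /= eg.
have [C [BC Cx] CA] := bB (e x) _ nA'.
exists (f C); split; first by exists C.
move=> y [C' [BC' fC'] C'y]; have : C' = C by apply: fI; rewrite ?inE.
by move=> E; rewrite E in C'y; have := CA _ C'y; rewrite /= eg.
Qed.

End Model.

End FromModels.

(** * From charts to a model whose topology is the D-topology *)

Definition dtop (R : realType) (X : dspace R) : Type := dcar X.

Section DTopology.
Variables (R : realType) (X : dspace R).

HB.instance Definition _ := gen_eqMixin (dtop X).
HB.instance Definition _ := gen_choiceMixin (dtop X).

Lemma dopen_bigcupT (I : Type) (f : I -> set (dtop X)) :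
  (forall i, dopen (X := X) (f i)) -> dopen (X := X) (\bigcup_i f i).
Proof. by move=> H; exact: dopen_bigcup. Qed.

HB.instance Definition _ := isOpenTopological.Build (dtop X)
  (@dopenT R X) (@dopenI R X) dopen_bigcupT.

End DTopology.

Section ToManifold.
Variables (R : realType) (X : dspace R) (n : nat).
Hypothesis lX : loc_eucl n X.

Lemma dtop_homeo (c : lchart X n) (V : set (dtop X)) : V `<=` lD c ->
  open V <-> open (lcrd c @` V).
Proof. exact: lchart_dopen. Qed.

Lemma dtop_transition (c d : lchart X n) : exists F : 'rV[R]_n -> 'rV[R]_n,
  smooth_on (lcrd c @` (lD c `&` lD d)) F /\
  forall x, lD c x -> lD d x -> F (lcrd c x) = lcrd d x.
Proof.
exists (lcrd d \o lpar c); split=> [|x Dx _]; last by rewrite /= lcrdK.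
have -> : lcrd c @` (lD c `&` lD d) = lU c `&` lpar c @^-1` lD d.
  apply/seteqP; split=> [_ [x [Dx D'x] <-]|u [Uu D'u]].
    by split; [exact: lcrdU|rewrite /= lcrdK].
  by exists (lpar c u); [split=> //; exact: lparD|exact: lparK].
exact: lcrd_smooth_restr (lpar_pl c).
Qed.

(** All charts of the given dimension serve as the atlas, so nothing has to be chosen and [models]
    holds for the identity. *)
Definition dmanifold : manifold R :=
  @Manifold R (dtop X) n (lchart X n) (@lD R X n) (@lcrd R X n) lX
    (@lD_open R X n) (@lcrd_inj R X n) dtop_homeo dtop_transition.

Lemma pl_smooth_param m (U : set 'rV[R]_m) (q : 'rV[R]_m -> X) :
  pl U q <-> smooth_param (fun u : U => q (set_val u) : dmanifold).
Proof.
split=> [pq|/(smooth_paramP (M := dmanifold) U q) [oU H]].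
  apply/(smooth_paramP (M := dmanifold) U q).
  split=> [|c u Uu Du]; first exact: pl_open pq.
  exists (U `&` q @^-1` lD c), (lcrd c \o q).
  split; [exact: (lD_open pq)|by []|exact: subIsetl|
    exact: lcrd_smooth_restr|by move=> v []].
apply: pl_local => // u Uu; have [c Du] := lX (q u).
have [V [F [oV Vu VU sF FP]]] := H c u Uu Du.
exists V; split=> //; apply: (lchart_pl (c := c)) => //.
- by move=> v /FP [].
- by apply: smooth_on_ext sF => // v /FP [].
Qed.

Lemma models_id : models (M := dmanifold) (@id X).
Proof.
split=> [|m U p]; first by exists id.
have [[x _]|nX] := pselect (exists x : X, True).
  split=> pp.
    have [q pq qE] := pl_extend x pp.
    have -> : id \o p = (fun u => q (set_val u)) by apply/funext => u; rewrite qE.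
    exact/pl_smooth_param.
  pose q v := if pselect (U v) is left Uv then p (set_mk Uv) else x.
  have qE : p = (fun u => q (set_val u)).
    apply/funext => u; rewrite /q; case: pselect => [Uu|/(_ (set_valP u))//].
    by congr p; exact: val_inj.
  rewrite qE in pp *; exact/pl_smooth_param.
split=> [pp|[oU _]].
  by split=> [|c u]; [exact: plot_open pp|case: nX; exists (p u)].
by apply: plot_local => // u; case: nX; exists (p u).
Qed.

Lemma dmanifold_hausdorff : dhausdorff X -> hausdorff_space dmanifold.
Proof.
move=> hX; rewrite open_hausdorff => x y /eqP /hX [A [B [oA oB Ax By AB]]].
exists (A, B) => /=; first by rewrite !inE.
split=> //; apply/eqP/seteqP; split=> // z [Az Bz]; exact: AB Bz.
Qed.

Lemma dmanifold_second_countable :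
  dsecond_countable X -> @second_countable dmanifold.
Proof.
move=> [B [oB bB]]; exists (range B).
  exact: (card_le_trans (card_image_le _ _) (countableP _)).
split=> [_ [k _ <-]|x A]; first exact: oB.
rewrite nbhsE => -[C [oC Cx] CA]; have [k [Bx BC]] := bB C x oC Cx.
by exists (B k); [split=> //; exists k|exact: subset_trans BC CA].
Qed.

End ToManifold.

(** * Manifolds characterised by their diffeology *)

Section Characterization.
Variable R : realType.
Local Notation dspace := (dspace R).

(** Removes the existential over models: the right-hand side speaks of [X] alone, so facts obtained
    from different models of one space can be combined. *)
Lemma is_manifoldP h s (X : dspace) : is_manifold h s X <->
  [/\ exists n, loc_eucl n X, h -> dhausdorff X & s -> dsecond_countable X].
Proof.
split=> [[M [e [me hM sM]]]|[[n lX] hX sX]].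
  split=> [|hh|ss]; first by exists (mdim M); exact: (model_loc_eucl me).
  - exact: (model_hausdorff me (hM hh)).
  - exact: (model_second_countable me (sM ss)).
exists (dmanifold lX), id; split; first exact: models_id.
- by move=> /hX; exact: dmanifold_hausdorff.
- by move=> /sX; exact: dmanifold_second_countable.
Qed.

Lemma is_manifold_weaken (h s h' s' : bool) (X : dspace) :
  (h' -> h) -> (s' -> s) -> is_manifold h s X -> is_manifold h' s' X.
Proof.
move=> hh ss /is_manifoldP [lX hX sX]; apply/is_manifoldP.
by split=> // [/hh|/ss].
Qed.

Section Diffeo.
Variables (X Y : dspace) (f : X -> Y) (g : Y -> X).
Hypotheses (sf : smooth f) (sg : smooth g) (fg : cancel f g) (gf : cancel g f).

Lemma lchart_diffeo n (c : lchart X n) : exists d : lchart Y n, lD d = g @^-1` lD c.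
Proof.
have sD : dopen (g @^-1` lD c) by apply: dopen_preimage => //; exact: lD_open.
have dpl : pl (lU c) (f \o lpar c) by exact: pl_smooth (lpar_pl c).
have parD u : lU c u -> lD c (g ((f \o lpar c) u)).
  by move=> Uu; rewrite /= fg; exact: lparD.
have parK u : lU c u -> lcrd c (g ((f \o lpar c) u)) = u.
  by move=> Uu; rewrite /= fg; exact: lparK.
have crdK y : lD c (g y) -> (f \o lpar c) (lcrd c (g y)) = y.
  by move=> Dy; rewrite /= lcrdK // gf.
have crdS m (W : set 'rV[R]_m) q : pl W q -> (forall w, W w -> lD c (g (q w))) ->
  smooth_on W ((lcrd c \o g) \o q).
  by move=> pq H; apply: (lcrd_smooth (q := g \o q)) => //; exact: pl_smooth.
by exists (@LChart R Y n (lU c) (g @^-1` lD c) (f \o lpar c) (lcrd c \o g)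
  sD dpl parD parK (fun y => @lcrdU R X n c (g y)) crdK crdS).
Qed.

End Diffeo.

Lemma is_manifold_diffeo h s (X Y : dspace) (f : X -> Y) :
  diffeomorphism f -> is_manifold h s X -> is_manifold h s Y.
Proof.
move=> [sf [g [sg fg gf]]] /is_manifoldP [[n lX] hX sX].
apply/is_manifoldP; split.
- exists n => y; have [c Dx] := lX (g y).
  by have [d dD] := lchart_diffeo sf sg fg gf c; exists d; rewrite dD.
- by move=> /hX; apply: dhausdorff_inj sg _; exact: can_inj gf.
- move=> /sX [B [oB bB]]; exists (fun k => g @^-1` B k); split=> [k|A y oA Ay].
    exact: dopen_preimage.
  have [|k [By BA]] := bB (f @^-1` A) (g y) (dopen_preimage sf oA).
    by rewrite /= gf.
  by exists k; split=> // z /BA; rewrite /= gf.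
Qed.

End Characterization.

(** * Submersions *)

Section LinearAlgebra.
Variable F : fieldType.

Lemma row_free_complete n k (A : 'M[F]_(n, n + k)) : row_free A ->
  exists C : 'M[F]_(k, n + k), col_mx A C \in unitmx.
Proof.
move=> /eqP rA; have rC : \rank (A^C)%MS = k by rewrite mxrank_compl rA addKn.
exists (castmx (rC, erefl) (row_base A^C)%MS).
rewrite -row_full_unit -sub1mx -addsmxE.
apply: submx_trans (submx_full _ (addsmx_compl_full A)) _.
by rewrite addsmxS // eqmx_cast eq_row_base.
Qed.

Lemma row_full_complete n k (J : 'M[F]_(n + k, n)) : row_full J ->
  exists K : 'M[F]_(n + k, k), row_mx J K \in unitmx.
Proof.
move=> fJ; have [|C uC] := @row_free_complete n k J^T.
  by rewrite /row_free mxrank_tr; exact: fJ.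
by exists C^T; rewrite -unitmx_tr tr_row_mx trmxK.
Qed.

End LinearAlgebra.

Section Submersions.
Variable R : realType.
Local Notation dspace := (dspace R).

Lemma jacobian_row_mx m n k (f : 'rV[R]_m -> 'rV[R]_n) (K : 'M[R]_(m, k)) x :
  differentiable f x ->
  jacobian (fun y => row_mx (f y) (y *m K)) x = row_mx (jacobian f x) K.
Proof.
move=> df; have dK : differentiable (fun y : 'rV[R]_m => y *m K) x.
  exact: (smooth_on_diff (smooth_on_lin K openT)).
have dfK : differentiable (fun y => row_mx (f y) (y *m K)) x.
  apply/differentiable_rowP => j; case: (split_ordP j) => i ->.
  - have -> : (fun y => row_mx (f y) (y *m K) 0 (lshift k i)) = (fun y => f y 0 i).
      by apply/funext => y; rewrite row_mxEl.
    by have /differentiable_rowP := df; exact.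
  - have -> : (fun y => row_mx (f y) (y *m K) 0 (rshift n i)) = (fun y => (y *m K) 0 i).
      by apply/funext => y; rewrite row_mxEr.
    by have /differentiable_rowP := dK; exact.
apply/matrixP => i j; rewrite jacobianE //; case: (split_ordP j) => l ->.
- have -> : (fun y => row_mx (f y) (y *m K) 0 (lshift k l)) = (fun y => f y 0 l).
    by apply/funext => y; rewrite row_mxEl.
  by rewrite row_mxEl jacobianE.
- have -> : (fun y => row_mx (f y) (y *m K) 0 (rshift n l)) = (fun y => (y *m K) 0 l).
    by apply/funext => y; rewrite row_mxEr.
  rewrite row_mxEr (derive_coord (F := fun y => y *m K)) // deriveE //.
  by rewrite diff_mulmx -rowE mxE.
Qed.

Section Recoordinate.
Variables (X : dspace) (n : nat) (c : lchart X n) (U W : set 'rV[R]_n).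
Variables (H G : 'rV[R]_n -> 'rV[R]_n).
Hypotheses (oU : open U) (oW : open W) (UU : U `<=` lU c).
Hypotheses (sH : smooth_on U H) (sG : smooth_on W G).
Hypotheses (HU : forall u, U u -> W (H u)) (GW : forall w, W w -> U (G w)).
Hypotheses (HK : forall u, U u -> G (H u) = u) (GK : forall w, W w -> H (G w) = w).

Let D := lD c `&` lcrd c @^-1` U.

Lemma recoord_open : dopen D.
Proof.
apply/(lchart_dopen (c := c)); first exact: subIsetl.
have -> : lcrd c @` D = U; last exact: oU.
apply/seteqP; split=> [_ [x [_ Ux] <-]//|u Uu].
have Du := lparD (UU Uu).
by exists (lpar c u); rewrite ?lparK ?/D //=; do ?split=> //=; rewrite ?lparK //; exact: UU.
Qed.
Lemma recoord_pl : pl W (lpar c \o G).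
Proof. by apply: (pl_comp (lpar_pl c) oW sG) => w /GW/UU. Qed.
Lemma recoord_parD w : W w -> D ((lpar c \o G) w).
Proof.
by move=> /GW Uw; have Uw' := UU Uw; split; [exact: lparD|rewrite /= lparK].
Qed.
Lemma recoord_parK w : W w -> (H \o lcrd c) ((lpar c \o G) w) = w.
Proof. by move=> Ww; rewrite /= lparK ?GK //; exact/UU/GW. Qed.
Lemma recoord_crdU x : D x -> W ((H \o lcrd c) x).
Proof. by case=> _; exact: HU. Qed.
Lemma recoord_crdK x : D x -> (lpar c \o G) ((H \o lcrd c) x) = x.
Proof. by case=> Dx Ux; rewrite /= HK // lcrdK. Qed.
Lemma recoord_smooth m (V : set 'rV[R]_m) q : pl V q ->
  (forall v, V v -> D (q v)) -> smooth_on V ((H \o lcrd c) \o q).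
Proof.
move=> pq qD; apply: (smooth_on_comp (F := lcrd c \o q) (W := U)) => //.
- exact: pl_open pq.
- by move=> v /qD [].
- by apply: lcrd_smooth => // v /qD [].
Qed.

Definition recoord : lchart X n := LChart recoord_open recoord_pl recoord_parD
  recoord_parK recoord_crdU recoord_crdK recoord_smooth.

End Recoordinate.

Section OneMap.
Variables (X Y : dspace) (f : X -> Y).

Lemma submersion_charts : submersion f -> smooth f /\ exists m n, forall x,
  exists (a : lchart X m) (b : lchart Y n),
    [/\ lD a x, forall x', lD a x' -> lD b (f x') &
      row_full (jacobian (lcrd b \o f \o lpar a) (lcrd a x))].
Proof.
move=> [sf [M [e [N [e' [me me' H]]]]]]; split=> //.
exists (mdim M), (mdim N) => x.
have [i ix] := mdom_cover (e x); have [j jx] := mdom_cover (e' (f x)).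
have [F [FE dF surjF]] := H x i j ix jx.
have [a [aD aC]] := model_lchart me ix; have [b [bD bC]] := model_lchart me' jx.
have oA : dopen (f @^-1` lD b) by apply: dopen_preimage => //; exact: lD_open.
exists (lrestr a oA), b => /=; split.
- by split; rewrite ?aD ?bD.
- by move=> x' [].
have Dx : lD a x by rewrite aD.
(* The [F] supplied by [submersion] is prescribed only on the images of charts. It agrees near the
   point with the coordinate expression of [f], and so has the same differential there. *)
have E : \forall u \near lcrd a x, F u = (lcrd b \o f \o lpar a) u.
  have oU : open (lU (lrestr a oA))  by exact: lU_open.
  have Ux : lU (lrestr a oA) (lcrd a x).
    by split; [exact: lcrdU|rewrite /= lcrdK // bD].
  apply: filterS (open_near oU Ux) => u [Uu fu] /=.
  have iu : mdom i (e (lpar a u)) by have := lparD Uu; rewrite aD.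
  have ju : mdom j (e' (f (lpar a u))) by move: fu; rewrite /= bD.
  rewrite bC /= -(FE _ iu ju); congr F.
  by rewrite -[LHS](lparK Uu) aC.
have Ea : lcrd a x = mchart i (e x) by rewrite aC.
rewrite -Ea in dF surjF.
have [dG dE] := near_eq_diff E dF.
have sJ (w : 'rV[R]_(mdim N)) : exists v, v *m jacobian (lcrd b \o f \o lpar a) (lcrd a x) = w.
  have [v vw] := surjF w; exists v.
  rewrite -(deriveEjacobian v dG) (deriveE v dG) dE; exact: vw.
(* Preimages of the basis vectors are the rows of a left inverse of the Jacobian. *)
apply/row_fullP; have [B BP] := choice sJ.
exists (\matrix_l B (delta_mx 0 l)); apply/row_matrixP => l.
by rewrite row_mul rowK BP row1.
Qed.

(** The local normal form of a submersion as a coordinate projection, with dimensions common to all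
    points. *)
Definition normal_form n k : Prop := forall x,
  exists (a : lchart X (n + k)) (b : lchart Y n),
    [/\ lD a x, forall x', lD a x' -> lD b (f x') &
      forall x', lD a x' -> lcrd b (f x') = lsubmx (lcrd a x')].

(** The coordinate expression [F] is completed by [k] linear functions, the columns of [K], to a map
    [H] with invertible Jacobian. By the inverse function theorem [H] is a change of coordinates,
    and [f] reads off its first [n] entries. *)
Lemma straighten n k x (a : lchart X (n + k)) (b : lchart Y n) : smooth f ->
  lD a x -> (forall x', lD a x' -> lD b (f x')) ->
  row_full (jacobian (lcrd b \o f \o lpar a) (lcrd a x)) ->
  exists a' : lchart X (n + k), [/\ lD a' x, lD a' `<=` lD a &
    forall x', lD a' x' -> lcrd b (f x') = lsubmx (lcrd a' x')].
Proof.
move=> sf Dx aD fJ; set F := lcrd b \o f \o lpar a.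
have sF : smooth_on (lU a) F.
  apply: (lcrd_smooth (q := f \o lpar a)); first exact: pl_smooth (lpar_pl a).
  by move=> u Uu; exact/aD/lparD.
have [K uK] := row_full_complete fJ.
pose H u := row_mx (F u) (u *m K).
have sH : smooth_on (lU a) H.
  apply: smooth_on_row_mx => //; first exact: lU_open.
  exact: smooth_on_lin (lU_open a).
have [|U [W [G [[oU UU] Ux [oW sG] FG GF]]]] :=
    inverse_function (lU_open a) (lcrdU Dx) sH.
  by rewrite jacobian_row_mx //; exact: smooth_on_diff sF (lcrdU Dx).
have sHU := smooth_on_sub oU (lU_open a) UU sH.
exists (recoord oU oW UU sHU sG (fun u h => (FG u h).1) (fun w h => (GF w h).1)
  (fun u h => (FG u h).2) (fun w h => (GF w h).2)) => /=; split.
- by split.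
- by move=> x' [].
- by move=> x' [Dx' _]; rewrite /H row_mxKl /F /= lcrdK.
Qed.

Lemma submersion_normal_form : submersion f -> exists n k, normal_form n k.
Proof.
move=> /submersion_charts [sf [m [n H]]].
have [[x0 _]|nX] := pselect (exists x : X, True); last first.
  by exists n, 0%N => x; case: nX; exists x.
(* The inequality is the rank bound for the Jacobian at a point, so [X] has to be inhabited here. *)
have nm : (n <= m)%N.
  have [a [b [_ _ /eqP <-]]] := H x0; exact: rank_leq_row.
have [k mk] : exists k, m = (n + k)%N by exists (m - n)%N; rewrite subnKC.
subst m; exists n, k => x; have [a [b [Dx aD fJ]]] := H x.
have [a' [Dx' aa' E]] := straighten sf Dx aD fJ.
by exists a', b; split=> // x' /aa'; exact: aD.
Qed.

(* The local subductions of Souriau. *)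
Definition local_subduction : Prop := smooth f /\
  forall x n (U : set 'rV[R]_n) p u, pl U p -> U u -> p u = f x ->
    exists (V : set 'rV[R]_n) q, [/\ V u, V `<=` U, pl V q, q u = x &
      forall v, V v -> f (q v) = p v].

(** In normal form a plot is lifted by using its own coordinates as the first ones and freezing the
    remaining [k] at their values at [x]. *)
Lemma normal_form_lsub n k : smooth f -> normal_form n k -> local_subduction.
Proof.
move=> sf nf; split=> // x m U p u pp Uu pu; have [a [b [Dx aD aE]]] := nf x.
pose V0 := U `&` p @^-1` lD b.
have oV0 : open V0 by exact: (lD_open pp).
pose F v := row_mx (lcrd b (p v)) (rsubmx (lcrd a x)).
have sF : smooth_on V0 F.
  apply: smooth_on_row_mx => //; last exact: smooth_on_cst.
  exact: lcrd_smooth_restr.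
pose V := V0 `&` F @^-1` lU a.
have oV : open V by apply: open_preim => //; exact: lU_open.
have Db : lD b (p u) by rewrite pu; exact: aD.
have Fu : F u = lcrd a x.
  by rewrite /F pu aE // hsubmxK.
exists V, (lpar a \o F); split.
- by do !split=> //; rewrite /= Fu; exact: lcrdU.
- by move=> v [[]].
- apply: (pl_comp (lpar_pl a) oV) => [|v []//].
  exact: (smooth_on_sub oV oV0 (@subIsetl _ _ _) sF).
- by rewrite /= Fu lcrdK.
- move=> v [[Uv Dv] Fv] /=; have Da := lparD Fv.
  apply: (lcrd_inj (aD _ Da) Dv); rewrite aE // lparK //.
  by rewrite row_mxKl.
Qed.

(** Lifting an inverse chart of [Y] through [x] gives a local section of [f]; by the chain rule the
    differential of its coordinate expression is a right inverse of that of [f]. *)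
Lemma lsub_submersion m n : loc_eucl m X -> loc_eucl n Y -> local_subduction ->
  submersion f.
Proof.
move=> lX lY [sf lf]; split=> //.
exists (dmanifold lX), id, (dmanifold lY), id; split; try exact: models_id.
move=> x a b /= Dx Dfx; exists (lcrd b \o f \o lpar a).
have dF : differentiable (lcrd b \o f \o lpar a) (lcrd a x).
  have oA : dopen (f @^-1` lD b) by apply: dopen_preimage => //; exact: lD_open.
  have sF : smooth_on (lU (lrestr a oA)) (lcrd b \o f \o lpar a).
    apply: (lcrd_smooth (q := f \o lpar a)); last by move=> u [].
    exact: (pl_smooth sf (lpar_pl (lrestr a oA))).
  by apply: (smooth_on_diff sF); split; [exact: lcrdU|rewrite /= lcrdK].
split=> //; first by move=> y Dy _; rewrite /= lcrdK.
move=> w; set F := _ \o _ \o _.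
  have Ufx := lcrdU Dfx.
  have [V [q [Vx VU pq qx qE]]] := lf x _ _ _ _ (lpar_pl b) Ufx (lcrdK Dfx).
  set v0 := lcrd b (f x) in Vx qx.
  pose S := lcrd a \o q; pose V1 := V `&` q @^-1` lD a.
  have sS : smooth_on V1 S  by exact: lcrd_smooth_restr pq.
  have oV1 : open V1 by exact: (lD_open pq).
  have V1v0 : V1 v0 by split=> //; rewrite /= qx.
  have Sv0 : S v0 = lcrd a x by rewrite /S /= qx.
  have dS : differentiable S v0 by exact: smooth_on_diff sS V1v0.
  have dF' : differentiable F (S v0) by rewrite Sv0.
  have FS : \forall v \near v0, F (S v) = v.
    apply: filterS (open_near oV1 V1v0) => v [Vv Dv].
    by rewrite /F /S /= lcrdK // qE // lparK //; exact: VU.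
  have dFS : differentiable (F \o S) v0 by exact: differentiable_comp.
  have [did E] := near_eq_diff FS dFS.
  exists ('d S v0 w); rewrite -Sv0.
  have -> : 'd F (S v0) ('d S v0 w) = 'd (F \o S) v0 w by rewrite (diff_comp dS dF').
  have Ew : 'd (fun v => v) v0 w = 'd (F \o S) v0 w := congr1 (@^~ w) E.
  rewrite -Ew -(deriveE w did); exact: derive_id.
Qed.

End OneMap.

End Submersions.

(** * Fibre products along submersions *)

Section FibreProducts.
Variable R : realType.
Local Notation dspace := (dspace R).

Lemma pl_fprod (X Y Z : dspace) (g : X -> Z) (f : Y -> Z) n (U : set 'rV[R]_n)
    (p : 'rV[R]_n -> fprod g f) :
  pl U (@fp1 _ _ _ _ _ _ \o p) -> pl U (@fp2 _ _ _ _ _ _ \o p) -> pl U p.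
Proof. by []. Qed.

Lemma dopen_crd (X : dspace) n m (c : lchart X n) (F : 'rV[R]_n -> 'rV[R]_m) B :
  smooth_on setT F -> open B -> dopen (lD c `&` (F \o lcrd c) @^-1` B).
Proof.
move=> sF oB k W q pq; rewrite preimage_setI setIA.
apply: (open_preim (F := F \o (lcrd c \o q))) => //; first exact: (lD_open pq).
apply: (smooth_on_comp (W := setT)) sF => //; [exact: (lD_open pq)|exact: openT|].
exact: lcrd_smooth_restr.
Qed.

Lemma open_row_mx_box a k (B : set 'rV[R]_(a + k)) (u : 'rV[R]_a) (v : 'rV[R]_k) :
  open B -> B (row_mx u v) -> exists r : R, 0 < r /\
    forall u' v', ball u r u' -> ball v r v' -> B (row_mx u' v').
Proof.
move=> oB Buv; have /nbhs_ballP [r /= r0 rB] : nbhs (row_mx u v) B.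
  exact: (open_near oB Buv).
(* [norm_le_entries] only yields a weak inequality; halving the radius makes it strict. *)
exists (r / 2); split=> [|u' v' uu vv]; first by rewrite divr_gt0.
apply: rB; move: uu vv; rewrite -!ball_normE /ball_ /= => uu vv.
apply: (@le_lt_trans _ _ (r / 2)); last by rewrite ltr_pdivrMr // ltr_pMr // ltr1n.
apply: norm_le_entries; first by rewrite divr_ge0 // ltW.
move=> j; rewrite opp_row_mx add_row_mx; case: (split_ordP j) => i ->.
- by rewrite row_mxEl; apply: le_trans (entry_le_norm _ _) (ltW uu).
- by rewrite row_mxEr; apply: le_trans (entry_le_norm _ _) (ltW vv).
Qed.

Section Chart.
Variables (X Y Z : dspace) (g : X -> Z) (f : Y -> Z) (a c k : nat).
Hypotheses (sg : smooth g).
Variables (ax : lchart X a) (ay : lchart Y (c + k)) (bz : lchart Z c).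
Hypotheses (axD : forall x, lD ax x -> lD bz (g x))
  (ayD : forall y, lD ay y -> lD bz (f y))
  (ayE : forall y, lD ay y -> lcrd bz (f y) = lsubmx (lcrd ay y)).
Variable z0 : fprod g f.

(* A point [(x, y)] is determined by the coordinates of [x] and the last [k]
   coordinates of [y], since the first [c] ones are those of [f y = g x]. *)
Let D : set (fprod g f) := [set z | lD ax (fp1 z) /\ lD ay (fp2 z)].
Let crd (z : fprod g f) : 'rV[R]_(a + k) :=
  row_mx (lcrd ax (fp1 z)) (rsubmx (lcrd ay (fp2 z))).
Let xpar (u : 'rV[R]_(a + k)) : X := lpar ax (lsubmx u).
Let ycrd (u : 'rV[R]_(a + k)) : 'rV[R]_(c + k) :=
  row_mx (lcrd bz (g (xpar u))) (rsubmx u).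
Let U : set 'rV[R]_(a + k) := [set u | lU ax (lsubmx u) /\ lU ay (ycrd u)].
Let par (u : 'rV[R]_(a + k)) : fprod g f :=
  if pselect (g (xpar u) = f (lpar ay (ycrd u))) is left e then fpair e else z0.

Let U1 : set 'rV[R]_(a + k) := lsubmx @^-1` lU ax.

Lemma fprod_U1_open : open U1.
Proof.
have := open_preim openT (lU_open ax) (@smooth_on_lsubmx R a k _ openT).
by rewrite setTI.
Qed.

Lemma fprod_xpar_pl : pl U1 xpar.
Proof.
apply: (pl_comp (lpar_pl ax) fprod_U1_open) => //.
exact/smooth_on_lsubmx/fprod_U1_open.
Qed.

Lemma fprod_ycrd_smooth : smooth_on U1 ycrd.
Proof.
have oU1 := fprod_U1_open.
apply: smooth_on_row_mx => //; last exact: smooth_on_rsubmx.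
apply: (lcrd_smooth (q := g \o xpar)); first exact: pl_smooth sg fprod_xpar_pl.
by move=> u U1u; exact/axD/lparD.
Qed.

Lemma fprod_U_open : open U.
Proof. exact: (open_preim fprod_U1_open (lU_open ay) fprod_ycrd_smooth). Qed.

(** The default value [z0] does not occur on [U]: the two points of [Z] to be compared lie in the
    domain of [bz] and have the same coordinates. *)
Lemma fprod_parP u : U u ->
  fp1 (par u) = xpar u /\ fp2 (par u) = lpar ay (ycrd u).
Proof.
move=> [Ux Uy]; rewrite /par; case: pselect => [//|[]].
have Dx := lparD Ux; have Dy := lparD Uy.
apply: (lcrd_inj (axD Dx) (ayD Dy)).
by rewrite (ayE Dy) lparK // row_mxKl.
Qed.

Lemma fprod_D_open : dopen D.
Proof.
apply: dopenI.
- exact: (dopen_preimage (@smooth_fp1 R _ _ _ g f) (@lD_open R _ _ ax)).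
- exact: (dopen_preimage (@smooth_fp2 R _ _ _ g f) (@lD_open R _ _ ay)).
Qed.

Lemma fprod_par_pl : pl U par.
Proof.
have UU1 : U `<=` U1 by move=> u [].
apply: pl_fprod.
- apply: (@pl_ext _ _ _ _ xpar); first by move=> u /fprod_parP [].
  exact: (pl_sub fprod_U_open UU1 fprod_xpar_pl).
- apply: (@pl_ext _ _ _ _ (lpar ay \o ycrd)); first by move=> u /fprod_parP [].
  apply: (pl_comp (lpar_pl ay) fprod_U_open); last by move=> u [].
  exact: (smooth_on_sub fprod_U_open fprod_U1_open UU1 fprod_ycrd_smooth).
Qed.

Lemma fprod_parD u : U u -> D (par u).
Proof.
move=> Uu; have [E1 E2] := fprod_parP Uu; have [Ux Uy] := Uu.
by split; rewrite ?E1 ?E2; exact: lparD.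
Qed.

Lemma fprod_parK u : U u -> crd (par u) = u.
Proof.
move=> Uu; have [E1 E2] := fprod_parP Uu; have [Ux Uy] := Uu.
by rewrite /crd E1 E2 !lparK // row_mxKr hsubmxK.
Qed.

Lemma fprod_ycrdK z : D z -> ycrd (crd z) = lcrd ay (fp2 z).
Proof.
move=> [Dx Dy]; rewrite /ycrd /xpar /crd row_mxKl row_mxKr lcrdK //.
by rewrite (fpE z) ayE // hsubmxK.
Qed.

Lemma fprod_crdU z : D z -> U (crd z).
Proof.
move=> Dz; have [Dx Dy] := Dz; split; last by rewrite fprod_ycrdK //; exact: lcrdU.
by rewrite /crd row_mxKl; exact: lcrdU.
Qed.

Lemma fprod_crdK z : D z -> par (crd z) = z.
Proof.
move=> Dz; have [E1 E2] := fprod_parP (fprod_crdU Dz); have [Dx Dy] := Dz.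
apply: fprod_eq; first by rewrite E1 /xpar /crd row_mxKl lcrdK.
by rewrite E2 fprod_ycrdK // lcrdK.
Qed.

Lemma fprod_crd_smooth m (W : set 'rV[R]_m) q : pl W q ->
  (forall w, W w -> D (q w)) -> smooth_on W (crd \o q).
Proof.
move=> pq qD; have oW := pl_open pq.
have p1 : pl W (@fp1 _ _ _ _ g f \o q) := pl_smooth (@smooth_fp1 R _ _ _ g f) pq.
have p2 : pl W (@fp2 _ _ _ _ g f \o q) := pl_smooth (@smooth_fp2 R _ _ _ g f) pq.
apply: (smooth_on_row_mx oW).
  by apply: (lcrd_smooth p1) => w /qD [].
apply: (smooth_on_comp (W := setT) (F := lcrd ay \o (@fp2 _ _ _ _ g f \o q))
  (G := rsubmx)) => //; first exact: openT.
  by apply: (lcrd_smooth p2) => w /qD [].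
exact/smooth_on_rsubmx/openT.
Qed.

Definition fprod_chart : lchart (fprod g f) (a + k) :=
  LChart fprod_D_open fprod_par_pl fprod_parD fprod_parK fprod_crdU fprod_crdK
    fprod_crd_smooth.

(** The coordinates of a point of the fibre product split into a part read off its first component
    and a part read off its second, so a D-open set contains a box around each of its points in
    [D]. *)
Lemma fprod_chart_box A z : dopen A -> A z -> D z ->
  exists P Q, [/\ dopen P, dopen Q, P (fp1 z), Q (fp2 z) &
    forall w : fprod g f, P (fp1 w) -> Q (fp2 w) -> A w].
Proof.
move=> oA Az Dz; have [Dx Dy] := Dz.
have oU := lU_open (lrestr fprod_chart oA).
have Uz : lU (lrestr fprod_chart oA) (crd z) by apply: lcrdU; split.
have [r [r0 rU]] := open_row_mx_box oU Uz.
have oB1 := ball_open (lcrd ax (fp1 z)) r.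
have oB2 := ball_open (rsubmx (lcrd ay (fp2 z))) r.
exists (lD ax `&` (id \o lcrd ax) @^-1` ball (lcrd ax (fp1 z)) r),
  (lD ay `&` (rsubmx \o lcrd ay) @^-1` ball (rsubmx (lcrd ay (fp2 z))) r).
split.
- exact/dopen_crd/oB1/smooth_on_id.
- by apply: dopen_crd oB2; exact/smooth_on_rsubmx/openT.
- by split=> //; exact: ballxx.
- by split=> //; exact: ballxx.
- move=> w [Dx' b1] [Dy' b2]; have Dw : D w by [].
  have [_] : lU (lrestr fprod_chart oA) (crd w) by exact: rU.
  by rewrite /= fprod_crdK.
Qed.

End Chart.

Section OfSubmersion.
Variables (X Y Z : dspace) (g : X -> Z) (f : Y -> Z).
Hypotheses (sg : smooth g) (sf : submersion f).

Lemma fprod_charts n : loc_eucl n X -> exists m, loc_eucl m (fprod g f) /\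
  forall A (z : fprod g f), dopen A -> A z ->
  exists P Q, [/\ dopen P, dopen Q, P (fp1 z), Q (fp2 z) &
    forall w : fprod g f, P (fp1 w) -> Q (fp2 w) -> A w].
Proof.
move=> lX; have [c [k nf]] := submersion_normal_form sf.
have ch z : exists (ax : lchart X n) (ay : lchart Y (c + k)) (bz : lchart Z c),
   [/\ forall x, lD ax x -> lD bz (g x), forall y, lD ay y -> lD bz (f y),
    forall y, lD ay y -> lcrd bz (f y) = lsubmx (lcrd ay y),
    lD ax (@fp1 _ _ _ _ g f z) & lD ay (fp2 z)].
  have [ay [bz [Dy ayD ayE]]] := nf (fp2 z); have [ax Dx] := lX (fp1 z).
  have oA : dopen (g @^-1` lD bz) := dopen_preimage sg (@lD_open R _ _ bz).
  exists (lrestr ax oA), ay, bz; split=> // [x []//|].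
  by split=> //; rewrite /= fpE; exact: ayD.
exists (n + k)%N; split=> [z|A z oA Az].
- have [ax [ay [bz [axD ayD ayE Dx Dy]]]] := ch z.
  by exists (fprod_chart sg axD ayD ayE z).
- have [ax [ay [bz [axD ayD ayE Dx Dy]]]] := ch z.
  exact: (fprod_chart_box sg axD ayD ayE z oA Az).
Qed.

(** Separation is inherited through the injection into the product. Countability holds because boxes
    of basic sets form a basis, by the second half of [fprod_charts]. *)
Lemma fprod_manifold h s : is_manifold h s X -> is_manifold h s Y ->
  is_manifold h s (fprod g f).
Proof.
move=> /is_manifoldP [[n lX] hX sX] /is_manifoldP [_ hY sY].
have [m [lP box]] := fprod_charts lX; apply/is_manifoldP; split.
- by exists m.
- move=> hh; apply: (@dhausdorff_inj R (fprod g f) (prod_dspace X Y) sval).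
  + by move=> n' U p.
  + by move=> z w E; apply: fprod_eq; rewrite /fp1 /fp2 E.
  + by apply: dhausdorff_prod; [exact: hX|exact: hY].
- move=> ss; have [B1 [oB1 bB1]] := sX ss; have [B2 [oB2 bB2]] := sY ss.
  apply: (@dbasis_countable _ _ (nat * nat)%type
    (fun ij => (@fp1 _ _ _ _ g f) @^-1` B1 ij.1 `&` (@fp2 _ _ _ _ g f) @^-1` B2 ij.2)).
  split=> [[i j]|A z oA Az] /=.
    apply: dopenI.
      exact: (dopen_preimage (@smooth_fp1 R _ _ _ g f) (oB1 i)).
    exact: (dopen_preimage (@smooth_fp2 R _ _ _ g f) (oB2 j)).
  have [P [Q [oP oQ Pz Qz PQ]]] := box A z oA Az.
  have [i [iz iP]] := bB1 P _ oP Pz; have [j [jz jQ]] := bB2 Q _ oQ Qz.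
  by exists (i, j); split=> // w [/iP Pw /jQ Qw]; exact: PQ.
Qed.

End OfSubmersion.

End FibreProducts.

Local Infix "**" := gcomp (at level 40, left associativity).

(** * Lie anafunctors through local subductions *)

Section LocalSubductions.
Variable R : realType.
Local Notation dspace := (dspace R).

Lemma pl_pair (X Y Z : dspace) (g : X -> Z) (f : Y -> Z) (z0 : fprod g f) n
    (U : set 'rV[R]_n) p q : pl U p -> pl U q ->
  (forall u, U u -> g (p u) = f (q u)) ->
  exists r : 'rV[R]_n -> fprod g f,
    pl U r /\ forall u, U u -> fp1 (r u) = p u /\ fp2 (r u) = q u.
Proof.
move=> pp pq e.
pose r u : fprod g f := if pselect (g (p u) = f (q u)) is left e then fpair e else z0.
have rE u : U u -> fp1 (r u) = p u /\ fp2 (r u) = q u.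
  by move=> Uu; rewrite /r; case: pselect => [//|/(_ (e u Uu))].
exists r; split=> //; apply: pl_fprod.
- by apply: (pl_ext _ pp) => u /rE [].
- by apply: (pl_ext _ pq) => u /rE [].
Qed.

Lemma submersion_lsub (X Y : dspace) (f : X -> Y) :
  submersion f -> local_subduction f.
Proof.
move=> sf; have [n [k nf]] := submersion_normal_form sf.
by apply: normal_form_lsub nf; have [] := sf.
Qed.

Lemma lsub_submersionP (h s h' s' : bool) (X Y : dspace) (f : X -> Y) :
  is_manifold h s X -> is_manifold h' s' Y ->
  local_subduction f -> submersion f.
Proof.
move=> /is_manifoldP [[m lX] _ _] /is_manifoldP [[n lY] _ _].
exact: lsub_submersion lX lY.
Qed.

Lemma lsub_id (X : dspace) : local_subduction (@id X).
Proof.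
by split=> // x n U p u pp Uu pu; exists U, p; split.
Qed.

Lemma lsub_comp (X Y Z : dspace) (f : Y -> Z) (g : X -> Y) :
  local_subduction f -> local_subduction g -> local_subduction (f \o g).
Proof.
move=> [sf lf] [sg lg]; split; first exact: smooth_comp.
move=> x n U p u pp Uu pu.
have [V [q [Vu VU pq qu qE]]] := lf (g x) n U p u pp Uu pu.
have [W [r [Wu WV pr ru rE]]] := lg x n V q u pq Vu qu.
exists W, r; split=> // [w /WV/VU//|w Ww] /=.
by rewrite rE // qE //; exact: WV.
Qed.

Lemma lsub_fp1 (X Y Z : dspace) (g : X -> Z) (f : Y -> Z) :
  smooth g -> local_subduction f -> local_subduction (@fp1 R X Y Z g f).
Proof.
move=> sg [sf lf]; split; first exact: smooth_fp1.
move=> z n U p u pp Uu pu.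
have gu : (g \o p) u = f (fp2 z) by rewrite /= pu fpE.
have [V [q [Vu VU pq qu qE]]] := lf _ _ _ _ _ (pl_smooth sg pp) Uu gu.
have pV : pl V p := pl_sub (pl_open pq) VU pp.
have [r [pr rE]] := pl_pair z pV pq (fun v Vv => esym (qE v Vv)).
exists V, r; split=> // [|v /rE []//].
by have [r1 r2] := rE u Vu; apply: fprod_eq; rewrite ?r1 ?r2.
Qed.

Lemma lsub_subduction (X Y : dspace) (f : X -> Y) :
  local_subduction f -> (forall y, exists x, f x = y) -> subduction f.
Proof.
move=> [sf lf] surjf; split=> // n U p pp u.
have [p' pp' p'E] := pl_extend (p u) pp; have [x fx] := surjf (p u).
have [|V [q [Vu VU pq qu qE]]] := lf x _ _ _ _ pp' (set_valP u).
  by rewrite p'E.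
exists V, VU, (fun v => q (set_val v)); split=> //; first exact: pl_open pq.
move=> v; rewrite qE; last exact: set_valP.
exact: (esym (p'E (set_incl VU v))).
Qed.

End LocalSubductions.

(** * Local subductions in groupoids and weak equivalences *)

Section GroupoidLemmas.
Variable R : realType.
Local Notation dgroupoid := (dgroupoid R).

Lemma ginvK (G : dgroupoid) : involutive (@ginv R G).
Proof.
move=> g.
have e : gsrc (ginv (ginv g)) = gtgt (ginv g) by rewrite gsrc_inv.
rewrite -[LHS](gcomp1r (x := gsrc g)); last by rewrite gsrc_inv gtgt_inv.
rewrite -gcompVl gcompA ?gsrc_inv // gcompVl gcomp1l //.
by rewrite gsrc_inv.
Qed.

(** Inverts two opposite sides of a commuting square; this is the naturality of a pointwise
    inverse. *)
Lemma gcomp_swap (G : dgroupoid) (s1 s0 p q : garr G) :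
  gsrc s1 = gtgt p -> gsrc p = gsrc s0 -> gtgt q = gtgt s1 -> gsrc q = gtgt s0 ->
  s1 ** p = q ** s0 -> ginv s1 ** q = p ** ginv s0.
Proof.
move=> e1 e2 e3 e4 E.
have -> : p = ginv s1 ** (q ** s0).
  by rewrite -E gcompA ?gsrc_inv // gcompVl gcomp1l.
rewrite -!gcompA ?gsrc_inv ?gtgt_inv ?gtgt_comp //.
  by rewrite gcompVr gcomp1r.
by rewrite gsrc_comp ?gtgt_inv.
Qed.

(** The target is the source after inversion, an involution. For each groupoid constructed below
    only the source then needs a lifting argument. *)
Lemma lsub_gtgt (G : dgroupoid) :
  local_subduction (@gsrc R G) -> local_subduction (@gtgt R G).
Proof.
move=> ls; have -> : @gtgt R G = @gsrc R G \o @ginv R G.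
  by apply/funext => g; rewrite /= gsrc_inv.
apply: lsub_comp => //; split; first exact: smooth_ginv.
move=> g n U p u pp Uu pu; exists U, (@ginv R G \o p); split=> //.
- exact: pl_smooth (@smooth_ginv R G) pp.
- by rewrite /= pu ginvK.
- by move=> v _; rewrite /= ginvK.
Qed.

Lemma pl_lift (G H : dgroupoid) (F : functor G H) (w : weak_equivalence F)
    (g0 : garr G) n (U : set 'rV[R]_n) x y h :
  pl (X := gob G) U x -> pl (X := gob G) U y -> pl (X := garr H) U h ->
  (forall u, U u -> gsrc (h u) = fob F (x u)) ->
  (forall u, U u -> gtgt (h u) = fob F (y u)) ->
  exists2 g, pl (X := garr G) U g & forall u, U u ->
    [/\ gsrc (g u) = x u, gtgt (g u) = y u & far F (g u) = h u].
Proof.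
move=> px py ph es et.
have es' (u : U) : gsrc (h (set_val u)) = fob F (x (set_val u)).
  exact/es/set_valP.
have et' (u : U) : gtgt (h (set_val u)) = fob F (y (set_val u)).
  exact/et/set_valP.
have [g pg gE] := pl_extend g0 (plot_lift w es' et' px py ph).
exists g => // u Uu; have := gE (set_mk Uu); rewrite /= => ->.
by rewrite gsrc_lift gtgt_lift far_lift.
Qed.

Section WeakEquivalences.
Variables (G H : dgroupoid) (F : functor G H).
Hypotheses (w : weak_equivalence F) (lF : local_subduction (fob F)).

(** An arrow of [G] amounts to its end points and its image in [H]. The end points of the arrows in
    the plot are lifted along [fob F], full faithfulness then supplies the arrows, and [weq_inj]
    shows that the lift passes through [g]. *)
Lemma lsub_far : local_subduction (far F).
Proof.
split; first exact: smooth_far.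
move=> g n U h u ph Uu hu; have [_ lift] := lF.
have [V1 [x [V1u V1U px xu xE]]] := lift (gsrc g) _ _ (@gsrc R H \o h) u
  (pl_smooth (@smooth_gsrc R H) ph) Uu (etrans (congr1 (@gsrc R H) hu) (fsrc F g)).
have [V2 [y [V2u V2U py yu yE]]] := lift (gtgt g) _ _ (@gtgt R H \o h) u
  (pl_smooth (@smooth_gtgt R H) ph) Uu (etrans (congr1 (@gtgt R H) hu) (ftgt F g)).
pose V := V1 `&` V2.
have oV : open V by apply: openI; [exact: pl_open px|exact: pl_open py].
have [] := @pl_lift _ _ _ w g _ V x y h.
- exact: pl_sub oV (@subIsetl _ _ _) px.
- exact: pl_sub oV (@subIsetr _ _ _) py.
- by apply: pl_sub oV _ ph => v [/V1U].
- by move=> v [V1v _]; rewrite xE.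
- by move=> v [_ V2v]; rewrite yE.
move=> g' pg' gE; exists V, g'; split=> //.
- by move=> v [/V1U].
- have [|e1 e2 e3] := gE u; first by split.
  by apply: (weq_inj w); rewrite ?e1 ?e2 ?e3.
- by move=> v /gE [].
Qed.

(** [Psi] is the source after [fp2], and [fp2] is the base change of [fob F] along the target. *)
Lemma lsub_Psi : local_subduction (@gsrc R H) -> local_subduction (Psi (F := F)).
Proof.
move=> ls; have -> : Psi (F := F) = @gsrc R H \o @fp2 _ _ _ _ _ _ by [].
apply: lsub_comp => //; have [sF lift] := lF; split; first exact: smooth_fp2.
move=> z n U h u ph Uu hu.
have tu : (@gtgt R H \o h) u = fob F (fp1 z) by rewrite /= hu fpE.
have [V [x [Vu VU px xu xE]]] :=
  lift _ _ _ _ _ (pl_smooth (@smooth_gtgt R H) ph) Uu tu.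
have hV : pl V h := pl_sub (pl_open px) VU ph.
have [r [pr rE]] := pl_pair z px hV xE.
exists V, r; split=> // [|v /rE []//].
by have [r1 r2] := rE u Vu; apply: fprod_eq; rewrite ?r1 ?r2.
Qed.

End WeakEquivalences.

End GroupoidLemmas.

(** * Lie anafunctors and their composition *)

Section LieAnafunctors.
Variable R : realType.
Local Notation dgroupoid := (dgroupoid R).

(** From right to left, the domain of [Psi] is a manifold as a fibre product along the submersion
    [gtgt], [Phi] carries the manifold structure of the arrows to its codomain, and [lsub_Psi] makes
    [Psi] a submersion. *)
Lemma lie_anafunctorP (G H : dgroupoid) (s : fspan G H) : lie_groupoid G ->
  is_lie_anafunctor s <->
  [/\ lie_groupoid (mid s), weak_equivalence (lleg s),
      local_subduction (fob (lleg s)) & forall y, exists x, fob (lleg s) x = y].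
Proof.
move=> [mG0 mG1 sG tG]; split.
  by move=> [lK [[w _ _ _ _] sub surj]]; split=> //; exact: submersion_lsub.
move=> [lK w lsub surj]; have [mK0 mK1 sK tK] := lK; split=> //.
have mG0' : is_manifold false false (gob G) by exact: is_manifold_weaken mG0.
have mK0' : is_manifold false false (gob (mid s)) by exact: is_manifold_weaken mK0.
have mP : is_manifold false false (fprod (fob (lleg s)) (@gtgt R G)).
  by apply: fprod_manifold => //; exact: smooth_fob.
split=> //; last exact: (lsub_submersionP mK0' mG0').
split=> //.
- by split=> //; exact: is_manifold_diffeo (proj2 w) mK1.
- exact: smooth_Phi.
- apply: (lsub_submersionP mP mG0'); apply: lsub_Psi => //.
  exact: submersion_lsub.
Qed.

Lemma lie_anafunctor_is_anafunctor (G H : dgroupoid) (s : fspan G H) :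
  is_lie_anafunctor s -> is_anafunctor s.
Proof.
move=> [_ [[w _ _ _ _] sub surj]]; split=> //.
by apply: lsub_subduction => //; exact: submersion_lsub.
Qed.

Section PullbackLie.
Variables (L M H : dgroupoid) (P : functor L H) (E : functor M H).
Hypotheses (lL : lie_groupoid L) (lM : lie_groupoid M) (lH : lie_groupoid H).
Hypotheses (w : weak_equivalence E) (lE : local_subduction (fob E)).

Lemma pullback_arr_manifold h s :
  is_manifold h s (garr L) -> is_manifold h s (garr M) ->
  is_manifold h s (garr (pullback P E)).
Proof.
move=> mL mM; apply: fprod_manifold => //; first exact: smooth_far.
have [_ mH _ _] := lH; apply: (lsub_submersionP mM mH); exact: lsub_far.
Qed.

(** The first component of the source is lifted to arrows of [L]. Their images in [H], the given
    sources in [M] and targets lifted along [fob E] determine arrows of [M] by full faithfulness of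
    [E]. *)
Lemma lsub_pullback_src : local_subduction (@gsrc R (pullback P E)).
Proof.
split; first exact: smooth_gsrc.
have [_ _ /submersion_lsub [_ lift1] _] := lL; have [_ lift2] := lE.
move=> g n U p u pp Uu pu.
have p1 : pl U (fob (pr1 P E) \o p) := pl_smooth (smooth_fob (pr1 P E)) pp.
have p2 : pl U (fob (pr2 P E) \o p) := pl_smooth (smooth_fob (pr2 P E)) pp.
have p1u : (fob (pr1 P E) \o p) u = gsrc (fp1 g) by rewrite /= pu.
have p2u : (fob (pr2 P E) \o p) u = gsrc (fp2 g) by rewrite /= pu.
have [V [q1 [Vu VU pq1 q1u q1E]]] := lift1 _ _ _ _ _ p1 Uu p1u.
have ph : pl V (far P \o q1) := pl_smooth (smooth_far P) pq1.
have tu : (@gtgt R H \o (far P \o q1)) u = fob E (gtgt (fp2 g)).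
  by rewrite /= q1u (fpE g) ftgt.
have [W [y [Wu WV py yu yE]]] :=
  lift2 _ _ _ _ _ (pl_smooth (@smooth_gtgt R H) ph) Vu tu.
have oW := pl_open py.
have [] := @pl_lift R _ _ _ w (fp2 g) _ W (fob (pr2 P E) \o p) y (far P \o q1).
- by apply: pl_sub p2 => // v /WV/VU.
- by [].
- exact: pl_sub ph.
- move=> v Wv /=; rewrite fsrc q1E; last exact: WV.
  exact: (fpE (p v)).
- by move=> v Wv /=; rewrite yE.
move=> q2 pq2 q2E.
have pq1W : pl W q1 by exact: pl_sub pq1.
have e v : W v -> far P (q1 v) = far E (q2 v) by move=> /q2E [].
have [r [pr rE]] := pl_pair (g := far P) (f := far E) g pq1W pq2 e.
exists W, r; split=> //.
- by move=> v /WV/VU.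
- have [r1 r2] := rE u Wu; apply: fprod_eq; rewrite ?r1 ?r2 //.
  have [e1 e2 e3] := q2E u Wu.
  by apply: (weq_inj w); rewrite ?e1 ?e2 ?e3 //= q1u; exact: (fpE g).
- move=> v Wv; apply: fprod_eq; have [r1 r2] := rE v Wv.
  + by rewrite -[LHS]/(gsrc (fp1 (r v))) r1 q1E //; exact: WV.
  + by rewrite -[LHS]/(gsrc (fp2 (r v))) r2; have [-> _ _] := q2E v Wv.
Qed.

Lemma pullback_lie : lie_groupoid (pullback P E).
Proof.
have [mL0 mL1 _ _] := lL; have [mM0 mM1 _ _] := lM; have [mH0 mH1 _ _] := lH.
have m0 : is_manifold true true (gob (pullback P E)).
  apply: fprod_manifold => //; first exact: smooth_fob.
  exact: (lsub_submersionP mM0 mH0).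
have m1 : is_manifold false false (garr (pullback P E)).
  exact: pullback_arr_manifold.
have ls := lsub_pullback_src.
split=> //; first exact: (lsub_submersionP m1 m0).
exact: (lsub_submersionP m1 m0 (lsub_gtgt ls)).
Qed.

End PullbackLie.

Lemma lie_id_ana (G : dgroupoid) : lie_groupoid G -> is_lie_anafunctor (id_ana G).
Proof.
move=> lG; apply/lie_anafunctorP => //; split=> //.
- exact: (proj1 (swe_id G)).
- exact: lsub_id.
- by move=> y; exists y.
Qed.

Lemma lie_comp_ana (G H K : dgroupoid) (a : anafunctor G H) (b : anafunctor H K) :
  lie_groupoid G -> lie_groupoid H ->
  is_lie_anafunctor a -> is_lie_anafunctor b -> is_lie_anafunctor (comp_ana a b).
Proof.
move=> lG lH /(lie_anafunctorP _ lG) [la wa lsa surja].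
move=> /(lie_anafunctorP _ lH) [lb wb lsb surjb].
apply/lie_anafunctorP => //; have [w [_ surj _]] := anaP (comp_ana a b).
split=> //; first exact: pullback_lie.
apply: (lsub_comp lsa); apply: lsub_fp1 => //; exact: smooth_fob.
Qed.

End LieAnafunctors.

(** * Replacing an anafunctor by a Lie anafunctor *)

Section InverseTransf.
Variable R : realType.
Local Notation dgroupoid := (dgroupoid R).

Section Inverse.
Variables (G H : dgroupoid) (a b : anafunctor G H) (S : transf a b).

Definition vinv_fun (z : fprod (fob (lleg b)) (fob (lleg a))) : garr H :=
  ginv (S (fpair (esym (fpE z)))).

Lemma vinv_smooth : @smooth R (gob (pullback (lleg b) (lleg a))) (garr H) vinv_fun.
Proof.
move=> n U p [p1 p2]; apply: (smooth_plot (@smooth_ginv R H)).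
by apply: (smooth_plot (smooth_nt S)); split.
Qed.

Lemma vinv_src z : gsrc (vinv_fun z) = fob (rleg b) (fp1 z).
Proof. by rewrite gsrc_inv transf_tgt. Qed.

Lemma vinv_tgt z : gtgt (vinv_fun z) = fob (rleg a) (fp2 z).
Proof. by rewrite gtgt_inv transf_src. Qed.

Lemma vinv_natural (g : garr (pullback (lleg b) (lleg a))) :
  vinv_fun (gtgt g) ** far (rleg b) (fp1 g) =
  far (rleg a) (fp2 g) ** vinv_fun (gsrc g).
Proof.
apply: gcomp_swap; rewrite ?transf_src ?transf_tgt ?fsrc ?ftgt //.
exact: (transf_natural S (esym (fpE (gsrc g))) (esym (fpE (gtgt g))) (esym (fpE g))).
Qed.

Definition vinv : transf b a :=
  @NatTrans R _ _ (comp_functor (rleg b) (pr1 (lleg b) (lleg a)))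
     (comp_functor (rleg a) (pr2 (lleg b) (lleg a)))
     vinv_fun vinv_smooth vinv_src vinv_tgt vinv_natural.

Lemma vinvE x y e : vinv (@fpair _ _ _ _ _ _ y x e) = ginv (S (fpair (esym e))).
Proof. by congr (ginv (S _)); exact: fpair_irr. Qed.

(** Naturality of [S] along the arrow [g] over a unit, paired with the unit of the intermediate
    object [y], turns the composite into the image of [g], which is the identity transformation. *)
Lemma vcomp_vinv : vcomp S vinv = id_transf a.
Proof.
apply: transf_eq => z; rewrite (fpair_eta z).
move: (fp1 z) (fp2 z) (fpE z) => x x' e.
have ey := esym (ob_preimageP b (fob (lleg a) x)).
move: (ob_preimage b _) ey => y ey.
have ey' : fob (lleg b) y = fob (lleg a) x' by rewrite -ey.
have es : gsrc (gunit (fob (lleg a) x')) = fob (lleg a) x by rewrite gsrc_unit e.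
have et : gtgt (gunit (fob (lleg a) x')) = fob (lleg a) x' by rewrite gtgt_unit.
have [g [g1 g2 g3]] := lift_ex es et.
rewrite [LHS](vcomp_funE S vinv e ey ey') vinvE.
rewrite [RHS](inducedE (m := id_span_map a) (z := fpair e) g1 g2 g3).
have nat := transf_natural S (g := g) (g' := gunit y) ey (esym ey')
  ltac:(by rewrite g3 funit ey') g1 g2 (gsrc_unit _) (gtgt_unit _).
rewrite funit gcomp1l ?transf_tgt // in nat.
have c : gsrc (S (fpair (esym ey'))) = gtgt (far (rleg a) g).
  by rewrite transf_src ftgt g2.
by rewrite -nat gcompA ?gsrc_inv // gcompVl gcomp1l.
Qed.

End Inverse.

Lemma vinvK (G H : dgroupoid) (a b : anafunctor G H) (S : transf a b) :
  vinv (vinv S) = S.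
Proof.
apply: transf_eq => z; rewrite (fpair_eta z) !vinvE ginvK.
by congr (S _); exact: fpair_irr.
Qed.

Lemma inverse2_vinv (G H : dgroupoid) (a b : anafunctor G H) (S : transf a b) :
  @inverse2 (DGpoid_ana_data R) G H a b S (vinv S).
Proof.
split; first exact: vcomp_vinv.
by rewrite -[X in bvcomp _ X](vinvK S); exact: vcomp_vinv.
Qed.

End InverseTransf.

(** * The groupoid induced along a map into the objects *)

Section InducedGroupoid.
Variable R : realType.
Local Notation dspace := (dspace R).
Local Notation dgroupoid := (dgroupoid R).
Variables (G : dgroupoid) (X : dspace) (f : X -> gob G) (sf : smooth f).

(* Arrows [((x, g), y)] with [g : f x -> f y]. *)
Definition ind_half : dspace := fprod f (@gsrc R G).
Definition ind_half_tgt (z : ind_half) : gob G := gtgt (fp2 z).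
Definition ind_arr : dspace := fprod ind_half_tgt f.

Definition ind_src (z : ind_arr) : X := fp1 (fp1 z).
Definition ind_tgt (z : ind_arr) : X := fp2 z.
Definition ind_val (z : ind_arr) : garr G := fp2 (fp1 z).

Lemma ind_val_src z : gsrc (ind_val z) = f (ind_src z).
Proof. exact: esym (fpE (fp1 z)). Qed.
Lemma ind_val_tgt z : gtgt (ind_val z) = f (ind_tgt z).
Proof. exact: fpE z. Qed.

Definition ind_mk x y g (es : gsrc g = f x) (et : gtgt g = f y) : ind_arr :=
  @fpair R _ _ _ ind_half_tgt f (fpair (esym es)) y et.

Lemma ind_eq (z w : ind_arr) : ind_src z = ind_src w -> ind_tgt z = ind_tgt w ->
  ind_val z = ind_val w -> z = w.
Proof. by move=> e1 e2 e3; apply: fprod_eq => //; exact: fprod_eq. Qed.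

Lemma smooth_ind_src : smooth ind_src.
Proof. by move=> n U p [[]]. Qed.
Lemma smooth_ind_tgt : smooth ind_tgt.
Proof. by move=> n U p []. Qed.
Lemma smooth_ind_val : smooth ind_val.
Proof. by move=> n U p [[]]. Qed.

Lemma plot_ind n (U : set 'rV[R]_n) (p : U -> ind_arr) :
  plot X (ind_src \o p) -> plot X (ind_tgt \o p) -> plot (garr G) (ind_val \o p) ->
  plot ind_arr p.
Proof. by move=> p1 p2 p3; split=> //; split. Qed.

Definition ind_unit (x : X) : ind_arr :=
  @ind_mk x x (gunit (f x)) (gsrc_unit _) (gtgt_unit _).

Lemma ind_inv_src z : gsrc (ginv (ind_val z)) = f (ind_tgt z).
Proof. by rewrite gsrc_inv ind_val_tgt. Qed.
Lemma ind_inv_tgt z : gtgt (ginv (ind_val z)) = f (ind_src z).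
Proof. by rewrite gtgt_inv ind_val_src. Qed.

Definition ind_inv (z : ind_arr) : ind_arr := ind_mk (ind_inv_src z) (ind_inv_tgt z).

Lemma ind_mul_comp z w : ind_src z = ind_tgt w ->
  gsrc (ind_val z) = gtgt (ind_val w).
Proof. by move=> e; rewrite ind_val_src ind_val_tgt e. Qed.
Lemma ind_mul_src z w (e : ind_src z = ind_tgt w) :
  gsrc (gmul (ind_mul_comp e)) = f (ind_src w).
Proof. by rewrite gsrc_mul ind_val_src. Qed.
Lemma ind_mul_tgt z w (e : ind_src z = ind_tgt w) :
  gtgt (gmul (ind_mul_comp e)) = f (ind_tgt z).
Proof. by rewrite gtgt_mul ind_val_tgt. Qed.

Definition ind_mul z w (e : ind_src z = ind_tgt w) : ind_arr :=
  ind_mk (ind_mul_src e) (ind_mul_tgt e).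

Lemma smooth_ind_unit : smooth ind_unit.
Proof.
move=> n U p pp; apply: plot_ind => //.
exact: (smooth_plot (@smooth_gunit R G) (sf pp)).
Qed.
Lemma smooth_ind_inv : smooth ind_inv.
Proof.
move=> n U p pp; apply: plot_ind.
- exact: smooth_ind_tgt pp.
- exact: smooth_ind_src pp.
- exact: (smooth_plot (@smooth_ginv R G) (smooth_ind_val pp)).
Qed.
Lemma smooth_ind_mul :
  smooth (fun zw : fprod ind_src ind_tgt => ind_mul (fpE zw)).
Proof.
move=> n U p [p1 p2]; apply: plot_ind.
- exact: smooth_ind_src p2.
- exact: smooth_ind_tgt p1.
- have -> : ind_val \o ((fun zw : fprod ind_src ind_tgt => ind_mul (fpE zw)) \o p)
      = (fun u => ind_val (fp1 (p u)) ** ind_val (fp2 (p u))).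
    by apply/funext => u; rewrite (gcompE (ind_mul_comp (fpE (p u)))).
  apply: plot_gcomp.
  + by move=> u; exact: ind_mul_comp (fpE (p u)).
  + exact: smooth_ind_val p1.
  + exact: smooth_ind_val p2.
Qed.

Lemma ind_src_unit x : ind_src (ind_unit x) = x. Proof. by []. Qed.
Lemma ind_tgt_unit x : ind_tgt (ind_unit x) = x. Proof. by []. Qed.
Lemma ind_src_inv z : ind_src (ind_inv z) = ind_tgt z. Proof. by []. Qed.
Lemma ind_tgt_inv z : ind_tgt (ind_inv z) = ind_src z. Proof. by []. Qed.
Lemma ind_src_mul z w (e : ind_src z = ind_tgt w) : ind_src (ind_mul e) = ind_src w.
Proof. by []. Qed.
Lemma ind_tgt_mul z w (e : ind_src z = ind_tgt w) : ind_tgt (ind_mul e) = ind_tgt z.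
Proof. by []. Qed.
Lemma ind_mulA z w v (zw : ind_src z = ind_tgt w) (wv : ind_src w = ind_tgt v)
    (zw_v : ind_src (ind_mul zw) = ind_tgt v) (z_wv : ind_src z = ind_tgt (ind_mul wv)) :
  ind_mul z_wv = ind_mul zw_v.
Proof. by apply: ind_eq => //; exact: gmulA. Qed.
Lemma ind_mul1l z (e : ind_src (ind_unit (ind_tgt z)) = ind_tgt z) : ind_mul e = z.
Proof.
apply: ind_eq => //; rewrite -[LHS]/(gmul (ind_mul_comp e)) -gcompE.
by apply: gcomp1l; exact: ind_val_tgt.
Qed.
Lemma ind_mul1r z (e : ind_src z = ind_tgt (ind_unit (ind_src z))) : ind_mul e = z.
Proof.
apply: ind_eq => //; rewrite -[LHS]/(gmul (ind_mul_comp e)) -gcompE.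
by apply: gcomp1r; exact: ind_val_src.
Qed.
Lemma ind_mulVl z (e : ind_src (ind_inv z) = ind_tgt z) :
  ind_mul e = ind_unit (ind_src z).
Proof.
apply: ind_eq => //; rewrite -[LHS]/(gmul (ind_mul_comp e)) -gcompE.
by rewrite -[RHS]/(gunit (f (ind_src z))) -ind_val_src; exact: gcompVl.
Qed.
Lemma ind_mulVr z (e : ind_src z = ind_tgt (ind_inv z)) :
  ind_mul e = ind_unit (ind_tgt z).
Proof.
apply: ind_eq => //; rewrite -[LHS]/(gmul (ind_mul_comp e)) -gcompE.
by rewrite -[RHS]/(gunit (f (ind_tgt z))) -ind_val_tgt; exact: gcompVr.
Qed.

Definition ind_groupoid : dgroupoid :=
  DGroupoid smooth_ind_src smooth_ind_tgt smooth_ind_unit smooth_ind_inv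
    smooth_ind_mul ind_src_unit ind_tgt_unit ind_src_inv ind_tgt_inv ind_src_mul
    ind_tgt_mul ind_mulA ind_mul1l ind_mul1r ind_mulVl ind_mulVr.

Lemma ind_val_comp (z w : garr ind_groupoid) : gsrc z = gtgt w ->
  ind_val (z ** w) = ind_val z ** ind_val w.
Proof. by move=> e; rewrite (gcompE e) (gcompE (ind_mul_comp e)). Qed.

Definition ind_functor : functor ind_groupoid G :=
  @Functor R ind_groupoid G f ind_val smooth_ind_val ind_val_src ind_val_tgt
    (fun=> erefl) ind_val_comp.

Lemma ind_functor_swe : subduction f -> subductive_weak_equivalence ind_functor.
Proof.
move=> subf; apply: swe_intro => //; split; first exact: smooth_Phi.
exists (fun z : Phi_cod ind_functor =>
  ind_mk (proj1 (svalP z)) (proj2 (svalP z)) : garr ind_groupoid); split.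
- by move=> n U p [[p1 p2] p3]; exact: plot_ind.
- by move=> z; exact: ind_eq.
- by move=> [[[x y] h] [ex ey]]; exact: eq_exist.
Qed.

Section IndLift.
Variables (K : dgroupoid) (F : functor K G) (w : weak_equivalence F).
Variables (t : X -> gob K) (st : smooth t) (tE : forall x, fob F (t x) = f x).

Lemma ind_lift_src z : gsrc (ind_val z) = fob F (t (ind_src z)).
Proof. by rewrite tE ind_val_src. Qed.
Lemma ind_lift_tgt z : gtgt (ind_val z) = fob F (t (ind_tgt z)).
Proof. by rewrite tE ind_val_tgt. Qed.

(** A lift [t] of [f] on objects extends to arrows by full faithfulness of [F]; functoriality is
    then the uniqueness of lifts. *)
Definition ind_lift_ar (z : garr ind_groupoid) : garr K :=
  Phi_lift w (ind_lift_src z) (ind_lift_tgt z).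

Lemma ind_lift_smooth : smooth ind_lift_ar.
Proof.
move=> n U p pp; apply: plot_lift.
- exact: (smooth_plot st (smooth_ind_src pp)).
- exact: (smooth_plot st (smooth_ind_tgt pp)).
- exact: smooth_ind_val pp.
Qed.

Lemma ind_lift_unit x : ind_lift_ar (gunit x) = gunit (t x).
Proof.
by apply: lift_uniq; rewrite ?gsrc_unit ?gtgt_unit // funit tE.
Qed.

Lemma ind_lift_comp z z' : gsrc z = gtgt z' ->
  ind_lift_ar (z ** z') = ind_lift_ar z ** ind_lift_ar z'.
Proof.
move=> e; have c : gsrc (ind_lift_ar z) = gtgt (ind_lift_ar z').
  by rewrite gsrc_lift gtgt_lift; congr t.
apply: lift_uniq.
- by rewrite gsrc_comp // gsrc_lift -[ind_src (z ** z')]/(gsrc (z ** z')) gsrc_comp.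
- by rewrite gtgt_comp // gtgt_lift -[ind_tgt (z ** z')]/(gtgt (z ** z')) gtgt_comp.
- by rewrite fcomp // !far_lift ind_val_comp.
Qed.

Definition ind_lift : functor ind_groupoid K :=
  @Functor R ind_groupoid K t ind_lift_ar ind_lift_smooth
    (fun z => gsrc_lift w (ind_lift_src z) (ind_lift_tgt z))
    (fun z => gtgt_lift w (ind_lift_src z) (ind_lift_tgt z))
    ind_lift_unit ind_lift_comp.

End IndLift.

Section IndLie.
Hypotheses (lG : lie_groupoid G) (mX : is_manifold true true X).
Hypothesis lf : local_subduction f.

(** The arrows are two successive fibre products, along [gsrc] and along [f]. Since [X] has both
    properties, the flags of [garr G] carry over. *)
Lemma ind_arr_manifold h s :
  is_manifold h s (garr G) -> is_manifold h s (garr ind_groupoid).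
Proof.
move=> mG1; have [mG0 _ sG _] := lG.
have mX' : is_manifold h s X by exact: is_manifold_weaken mX.
apply: fprod_manifold => //.
- by move=> n U p [_ p2]; exact: smooth_gtgt p2.
- exact: (lsub_submersionP mX mG0).
- exact: fprod_manifold.
Qed.

(** The image of the plot under [f] is first lifted to arrows along [gsrc]; the targets of these
    arrows are then lifted along [f]. *)
Lemma lsub_ind_src : local_subduction (@gsrc R ind_groupoid).
Proof.
split; first exact: smooth_ind_src.
have [_ _ /submersion_lsub [_ lift1] _] := lG; have [_ lift2] := lf.
move=> z n U p u pp Uu pu.
have pu' : (f \o p) u = gsrc (ind_val z) by rewrite /= pu ind_val_src.
have [V [g [Vu VU pg gu gE]]] := lift1 _ _ _ _ _ (pl_smooth sf pp) Uu pu'.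
have tu : (@gtgt R G \o g) u = f (ind_tgt z) by rewrite /= gu ind_val_tgt.
have [W [y [Wu WV py yu yE]]] :=
  lift2 _ _ _ _ _ (pl_smooth (@smooth_gtgt R G) pg) Vu tu.
have oW := pl_open py; have WU := subset_trans WV VU.
have [r1 [pr1 r1E]] := pl_pair (f := @gsrc R G) (fp1 z) (pl_sub oW WU pp)
  (pl_sub oW WV pg) (fun v Wv => esym (gE v (WV v Wv))).
have e v : W v -> ind_half_tgt (r1 v) = f (y v).
  by move=> Wv; rewrite /ind_half_tgt; have [_ ->] := r1E v Wv; rewrite yE.
have [r [pr rE]] := pl_pair z pr1 py e.
exists W, r; split=> // [|v Wv]; last first.
  by rewrite -[LHS]/(fp1 (fp1 (r v))); have [-> _] := rE v Wv; have [-> _] := r1E v Wv.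
have [e1 e2] := rE u Wu; have [e3 e4] := r1E u Wu.
apply: ind_eq; first by rewrite /ind_src e1 e3.
  by rewrite /ind_tgt e2.
by rewrite /ind_val e1 e4.
Qed.

Lemma ind_lie : lie_groupoid ind_groupoid.
Proof.
have [mG0 mG1 _ _] := lG; have m1 := ind_arr_manifold mG1.
have ls := lsub_ind_src.
split=> //; first exact: (lsub_submersionP m1 mX).
exact: (lsub_submersionP m1 mX (lsub_gtgt ls)).
Qed.

End IndLie.

End InducedGroupoid.

(** * The discrete diffeology *)

Section Discrete.
Variables (R : realType) (I : Type).

(** The plots are the locally constant parametrisations. *)
Definition disc_plot n (U : set 'rV[R]_n) (p : U -> I) : Prop :=
  open U /\ forall u : U, exists V, [/\ open V, V (set_val u) &
    forall v : U, V (set_val v) -> p v = p u].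

Lemma disc_plot_open n (U : set 'rV[R]_n) (p : U -> I) : disc_plot p -> open U.
Proof. by case. Qed.

Lemma disc_plot_cst n (U : set 'rV[R]_n) (i : I) : open U -> disc_plot (fun _ : U => i).
Proof. by move=> oU; split=> // u; exists setT; split=> //; exact: openT. Qed.

Lemma disc_plot_local n (U : set 'rV[R]_n) (p : U -> I) : open U ->
  (forall u : U, exists (V : set 'rV[R]_n) (VU : V `<=` U),
    [/\ open V, V (set_val u) & disc_plot (p \o set_incl VU)]) -> disc_plot p.
Proof.
move=> oU H; split=> // u; have [V [VU [oV Vu [_ pp]]]] := H u.
have [W [oW Wu WE]] := pp (set_mk Vu).
exists (V `&` W); split; [exact: openI|by []|move=> v [Vv Wv]].
have := WE (set_mk Vv) Wv.
have -> : (p \o set_incl VU) (set_mk Vv) = p v by congr p; exact: val_inj.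
by have -> : (p \o set_incl VU) (set_mk Vu) = p u by congr p; exact: val_inj.
Qed.

Lemma disc_plot_comp n m (U : set 'rV[R]_n) (V : set 'rV[R]_m) (p : U -> I)
    (F : 'rV[R]_m -> 'rV[R]_n) (FVU : forall v : V, U (F (set_val v))) :
  disc_plot p -> open V -> smooth_on V F ->
  disc_plot (fun v : V => p (set_mk (FVU v))).
Proof.
move=> [oU H] oV sF; split=> // v.
have [W [oW Wv WE]] := H (set_mk (FVU v)).
exists (V `&` F @^-1` W); split; first exact: open_preim.
  by split=> //; exact: set_valP.
by move=> v' [_ Wv']; exact: WE.
Qed.

Definition disc : dspace R :=
  DSpace disc_plot_open disc_plot_cst disc_plot_local disc_plot_comp.

Lemma pl_discP n (U : set 'rV[R]_n) (p : 'rV[R]_n -> disc) : pl U p <->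
  open U /\ forall u, U u -> exists V, [/\ open V, V u, V `<=` U &
    forall v, V v -> p v = p u].
Proof.
split=> [[oU H]|[oU H]]; split=> // u.
- move=> Uu; have [V [oV Vu VE]] := H (set_mk Uu).
  exists (V `&` U); split; [exact: openI|by []|by move=> v []|move=> v [Vv Uv]].
  exact: (VE (set_mk Uv)).
- have [V [oV Vu VU VE]] := H _ (set_valP u).
  by exists V; split=> // v; exact: VE.
Qed.

Lemma dopen_disc (A : set disc) : dopen A.
Proof.
move=> n U p /pl_discP [oU H]; rewrite openE => u [Uu Au].
have [V [oV Vu VU VE]] := H u Uu; rewrite /interior.
apply: filterS (open_near oV Vu) => v Vv; split; first exact: VU.
by rewrite /= VE.
Qed.

Lemma dhausdorff_disc : dhausdorff disc.
Proof.
move=> i j ij; exists [set i], [set j].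
by split=> //; [exact: dopen_disc|exact: dopen_disc|move=> k -> /ij].
Qed.

End Discrete.

(** * The disjoint union of a family of D-open sets *)

Section CoverSpace.
Variables (R : realType) (X : dspace R) (I : Type) (A : I -> set X).
Hypothesis oA : forall i, dopen (A i).

(** The disjoint union of the [A i], written as a subspace of a product with a discrete space so
    that its diffeology comes from existing constructions. *)
Definition cover_space : dspace R :=
  @sub_dspace R (prod_dspace (disc R I) X) (fun z => A z.1 z.2).
Definition cover_idx (z : cover_space) : I := (sval z).1.
Definition cover_pt (z : cover_space) : X := (sval z).2.
Definition cover_mk i x (Aix : A i x) : cover_space := exist _ (i, x) Aix.

Lemma cover_eq (z w : cover_space) :
  cover_idx z = cover_idx w -> cover_pt z = cover_pt w -> z = w.
Proof.
case: z w => [[i x] a] [[j y] b]; rewrite /cover_idx /cover_pt /= => ei ex.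
by subst; congr exist; exact: Prop_irrelevance.
Qed.

Lemma cover_ptP z : A (cover_idx z) (cover_pt z).
Proof. exact: (svalP z). Qed.

Lemma smooth_cover_idx : @smooth R cover_space (disc R I) cover_idx.
Proof. by move=> n U p []. Qed.

Lemma smooth_cover_pt : smooth cover_pt.
Proof. by move=> n U p []. Qed.

Lemma pl_cover (z0 : cover_space) i n (U : set 'rV[R]_n) p : pl (X := X) U p ->
  (forall u, U u -> A i (p u)) ->
  exists q : 'rV[R]_n -> cover_space,
    pl U q /\ forall u, U u -> cover_idx (q u) = i /\ cover_pt (q u) = p u.
Proof.
move=> pp Ap.
pose q u := if pselect (A i (p u)) is left a then cover_mk a else z0.
have qE u : U u -> cover_idx (q u) = i /\ cover_pt (q u) = p u.
  by move=> Uu; rewrite /q; case: pselect => [//|/(_ (Ap u Uu))].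
exists q; split=> //.
have pi : pl (X := disc R I) U (fun u => cover_idx (q u)).
  by apply: (@pl_ext R (disc R I) n U (fun=> i)) => [u /qE []//|]; exact/pl_cst/pl_open/pp.
have px : pl U (fun u => cover_pt (q u)) by apply: (pl_ext _ pp) => u /qE [].
by split.
Qed.

(** A plot is lifted into the sheet of [z], after restriction to the preimage of the corresponding
    D-open set. *)
Lemma lsub_cover_pt : local_subduction cover_pt.
Proof.
split; first exact: smooth_cover_pt.
move=> z n U p u pp Uu pu; pose V := U `&` p @^-1` A (cover_idx z).
have oV : open V by exact: (@oA (cover_idx z) _ _ _ pp).
have [||q [pq qE]] := @pl_cover z (cover_idx z) n V p.
- by apply: pl_sub pp => // v [].
- by move=> v [].
have Vu : V u by split=> //; rewrite /= pu; exact: cover_ptP.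
exists V, q; split=> // [v []//||v /qE []//].
by have [e1 e2] := qE u Vu; apply: cover_eq; rewrite ?e1 ?e2.
Qed.

Section Chart.
Variables (z : cover_space) (n : nat) (c0 : lchart X n).
Let i := cover_idx z.
Let c := lrestr c0 (@oA i).

Let D : set cover_space := [set w | cover_idx w = i /\ lD c (cover_pt w)].

Lemma cover_pl_ex : exists q : 'rV[R]_n -> cover_space, pl (lU c) q /\
  forall u, lU c u -> cover_idx (q u) = i /\ cover_pt (q u) = lpar c u.
Proof. by apply: pl_cover z _ _ _ _ (lpar_pl c) _ => u /lparD []. Qed.

Let par := sval (cid cover_pl_ex).
Lemma cover_par_pl : pl (lU c) par.
Proof. by have [] := svalP (cid cover_pl_ex). Qed.
Lemma cover_parE u : lU c u -> cover_idx (par u) = i /\ cover_pt (par u) = lpar c u.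
Proof. by have [_] := svalP (cid cover_pl_ex); exact. Qed.

Lemma cover_D_open : dopen D.
Proof.
apply: dopenI.
- exact: (dopen_preimage smooth_cover_idx (@dopen_disc _ _ [set i])).
- exact: (dopen_preimage smooth_cover_pt (@lD_open R _ _ c)).
Qed.
Lemma cover_parD u : lU c u -> D (par u).
Proof.
by move=> Uu; have [e1 e2] := cover_parE Uu; split; rewrite ?e2 //; exact: lparD.
Qed.
Lemma cover_parK u : lU c u -> lcrd c (cover_pt (par u)) = u.
Proof. by move=> Uu; have [_ ->] := cover_parE Uu; exact: lparK. Qed.
Lemma cover_crdU w : D w -> lU c (lcrd c (cover_pt w)).
Proof. by case=> _; exact: lcrdU. Qed.
Lemma cover_crdK w : D w -> par (lcrd c (cover_pt w)) = w.
Proof.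
move=> [wi Dw]; have [e1 e2] := cover_parE (lcrdU Dw).
by apply: cover_eq; rewrite ?e1 ?e2 ?wi // lcrdK.
Qed.
Lemma cover_crd_smooth m (W : set 'rV[R]_m) q : pl W q ->
  (forall v, W v -> D (q v)) -> smooth_on W ((lcrd c \o cover_pt) \o q).
Proof.
move=> pq qD; apply: (lcrd_smooth (q := cover_pt \o q)).
  exact: pl_smooth smooth_cover_pt pq.
by move=> v /qD [].
Qed.

Definition cover_chart : lchart cover_space n :=
  @LChart R cover_space n (lU c) D par (lcrd c \o cover_pt) cover_D_open
    cover_par_pl cover_parD cover_parK cover_crdU cover_crdK cover_crd_smooth.

End Chart.

Lemma cover_space_manifold (k : I -> nat) : injective k ->
  is_manifold true true X -> is_manifold true true cover_space.
Proof.
move=> kI /is_manifoldP [[n lX] /(_ isT) hX /(_ isT) [B [oB bB]]].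
apply/is_manifoldP; split.
- exists n => z; have [c Dz] := lX (cover_pt z).
  by exists (cover_chart z c); do !split=> //; exact: cover_ptP.
- move=> _; apply: (@dhausdorff_inj R cover_space (prod_dspace (disc R I) X)
    (fun z => sval z)).
  + by move=> m U p.
  + by move=> z w E; apply: cover_eq; rewrite /cover_idx /cover_pt E.
  + by apply: dhausdorff_prod => //; exact: dhausdorff_disc.
- move=> _; apply: (@dbasis_countable _ _ (nat * nat)%type (fun ij =>
    cover_idx @^-1` [set i | k i = ij.1] `&` cover_pt @^-1` B ij.2)).
  split=> [[i j]|O z oO Oz] /=.
    apply: dopenI.
      exact: (dopen_preimage smooth_cover_idx (@dopen_disc _ _ [set i' | k i' = i])).
    exact: (dopen_preimage smooth_cover_pt (oB j)).
  pose i := cover_idx z.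
  (* The trace of [O] on the sheet of [z], seen in [X]. It is D-open because plots of [X] with
     values in [A i] lift into that sheet, so a basic set of [X] fits inside it. *)
  pose P : set X := [set x | exists w, [/\ O w, cover_idx w = i & cover_pt w = x]].
  have oP : dopen P.
    move=> m U p pp; rewrite openE => u [Uu [w [Ow wi wu]]].
    pose V := U `&` p @^-1` A i.
    have oV : open V by exact: (@oA i _ _ _ pp).
    have Vu : V u by split=> //; rewrite /= -wu -wi; exact: cover_ptP.
    have [||q [pq qE]] := @pl_cover z i m V p.
    - by apply: pl_sub pp => // v [].
    - by move=> v [].
    have qu : q u = w.
      by have [e1 e2] := qE u Vu; apply: cover_eq; rewrite ?e1 ?e2.
    have Ou : (V `&` q @^-1` O) u by split=> //; rewrite /= qu.
    rewrite /interior; apply: filterS (open_near (oO _ _ _ pq) Ou) => v [Vv Ov].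
    have [e1 e2] := qE v Vv.
    by split; [have [] := Vv|exists (q v)].
  have [|j [Bz BP]] := bB P (cover_pt z) oP; first by exists z.
  exists (k i, j); split=> // w [/= /kI wi /BP [w' [Ow' w'i w'w]]].
  by have -> : w = w' by apply: cover_eq; rewrite ?wi ?w'i.
Qed.

End CoverSpace.

(** * Countably many sections and the Lie replacement *)

Section EssentialFullness.
Variable R : realType.
Local Notation dgroupoid := (dgroupoid R).

(* The index type is a set of members of a countable basis of [Y], which keeps the
   cover space second-countable. *)
Lemma subduction_sections (X Y : dspace R) (f : X -> Y) :
  is_manifold true true Y -> subduction f ->
  exists (I : Type) (k : I -> nat) (A : I -> set Y) (s : I -> Y -> X),
  [/\ injective k, forall i, dopen (A i), forall y, exists i, A i y,
    forall i y, A i y -> f (s i y) = y &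
    forall i n (W : set 'rV[R]_n) q, pl W q -> (forall w, W w -> A i (q w)) ->
      pl W (s i \o q)].
Proof.
move=> /is_manifoldP [[n lY] _ /(_ isT) [B [oB bB]]] [sf surjf liftf].
pose sect (A : set Y) (s : Y -> X) := (forall y, A y -> f (s y) = y) /\
  forall m (W : set 'rV[R]_m) q, pl W q -> (forall w, W w -> A (q w)) ->
    pl W (s \o q).
pose I := {m : nat | exists s, sect (B m) s}.
have [s sP] := choice (fun i : I => svalP i : exists s, sect (B (sval i)) s).
exists I, sval, (fun i => B (sval i)), s; split.
- by move=> [i Pi] [j Pj] /= E; subst j; congr exist; exact: Prop_irrelevance.
- by move=> i; exact: oB.
- move=> y; have [c Dy] := lY y; have Uy := lcrdU Dy.
  have [V [VU [q [oV Vy pq qE]]]] := liftf _ _ _ (lpar_pl c) (set_mk Uy).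
  have [x0 _] := surjf y; have [q' pq' q'E] := pl_extend x0 pq.
  (* The lift of the inverse chart, preceded by the coordinates, is a section over [A]; it restricts
     to a basic set around [y], whose number is then an index in [I]. *)
  pose A := lD c `&` lcrd c @^-1` V.
  have oA : dopen A.
    rewrite /A -[lcrd c]/(id \o lcrd c).
    by apply: dopen_crd => //; exact: smooth_on_id.
  have [m [By BA]] := bB A y oA (conj Dy Vy).
  suff sm : exists s, sect (B m) s by exists (exist _ m sm).
  exists (q' \o lcrd c); split=> [y' /BA [Dy' Vy']|d W r pr rB].
    have Vy'' : V (lcrd c y') := Vy'.
    by have := qE (set_mk Vy''); rewrite -q'E /= => <-; exact: lcrdK.
  apply: (pl_comp (F := lcrd c \o r) pq' (pl_open pr)).
    by apply: lcrd_smooth => // w /rB/BA [].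
  by move=> w /rB/BA [].
- by move=> i y; have [H _] := sP i; exact: H.
- by move=> i; have [_ H] := sP i; exact: H.
Qed.

(** The construction of [b] does not refer to the flags, so one replacement serves the Lie case and
    all its restrictions. *)
Lemma lie_replacement (G H : dgroupoid) (a : anafunctor G H) : lie_groupoid G ->
  exists (b : anafunctor G H) (s : transf a b) (t : transf b a),
    [/\ is_lie_anafunctor b,
      forall h s, is_manifold h s (garr G) -> is_manifold h s (garr (mid b)) &
      @inverse2 (DGpoid_ana_data R) G H a b s t].
Proof.
move=> lG; have [mG0 _ _ _] := lG; have [w subl] := anaP a.
have [I [k [A [s [kI oA Acov sE sS]]]]] := subduction_sections mG0 subl.
pose X := cover_space A; pose f : X -> gob G := @cover_pt _ _ _ A.
have mX : is_manifold true true X := cover_space_manifold oA kI mG0.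
have lf : local_subduction f := lsub_cover_pt oA.
have surjf y : exists x, f x = y.
  by have [i Ay] := Acov y; exists (cover_mk Ay).
have sf : smooth f := proj1 lf.
pose t (z : X) : gob (mid a) := s (cover_idx z) (cover_pt z).
have tE z : fob (lleg a) (t z) = f z by apply: sE; exact: cover_ptP.
(* Along a plot of [X] the index is locally constant, so [t] is locally a single smooth section. *)
have st : smooth t.
  apply: smooth_pl => n U p pp; apply: pl_local; first exact: pl_open pp.
  move=> u Uu; have /pl_discP [_ /(_ u Uu)] := pl_smooth (@smooth_cover_idx _ _ _ A) pp.
  move=> [V [oV Vu VU VE]]; exists V; split=> //.
  have VE' v : V v -> cover_idx (p v) = cover_idx (p u) := @VE v.
  have pV : pl V (f \o p) := pl_smooth sf (pl_sub oV VU pp).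
  apply: (pl_ext _ (sS (cover_idx (p u)) _ _ _ pV _)) => v Vv.
    by rewrite /= /t VE'.
  by rewrite -(VE' v Vv); exact: cover_ptP.
have sweF := ind_functor_swe sf (lsub_subduction lf surjf).
pose T := ind_lift sf w st tE.
pose b : anafunctor G H :=
  @Anafunctor R G H (Span (ind_functor sf) (comp_functor (rleg a) T)) sweF.
have m_ar (z : garr (mid b)) : far (lleg a) (far T z) = far (lleg b) z.
  exact: far_lift.
pose m : span_map b a :=
  @SpanMap R G H b a T tE m_ar (fun=> erefl) (fun=> erefl).
(* The functor [T] over [G] gives a span map from [b] to [a], hence a transformation in that
   direction; the one out of [a] is its inverse. *)
exists b, (vinv (induced m)), (induced m); split.
- apply/lie_anafunctorP => //; split=> //.
  + exact: ind_lie.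
  + exact: (proj1 sweF).
- by move=> h ss mG1; exact: ind_arr_manifold.
- by have [] := inverse2_vinv (induced m).
Qed.

End EssentialFullness.

(** * Closure under the structure and essential fullness *)

Section SubBicategories.
Variable R : realType.

Lemma full_sub_bicategory (B : bicat_data) (S : subcells B) :
  (forall X Y (f g : cell1 X Y) (s : cell2 f g), in2 S s) ->
  (forall X, in0 S X -> mem1 S (bid1 X)) ->
  (forall X Y Z (f : cell1 X Y) (g : cell1 Y Z),
    mem1 S f -> mem1 S g -> mem1 S (bcomp1 f g)) ->
  is_sub_bicategory S.
Proof.
move=> S2 Sid Scomp; have Sid' X Y (f : cell1 X Y) : mem1 S f ->
    mem1 S (bid1 X) /\ mem1 S (bid1 Y).
  by move=> [SX SY _]; split; exact: Sid.
split=> //.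
- by move=> X Y f g h s t [Sf _ _] [_ Sh _].
- move=> X Y Z f f' g g' s t [Sf Sf' _] [Sg Sg' _].
  by split=> //; exact: Scomp.
- move=> X Y Z W f g h Sf Sg Sh.
  have Sl := Scomp _ _ _ _ _ (Scomp _ _ _ _ _ Sf Sg) Sh.
  have Sr := Scomp _ _ _ _ _ Sf (Scomp _ _ _ _ _ Sg Sh).
  by split=> [|t _]; split.
- by move=> X Y f Sf; have [SX SY] := Sid' _ _ _ Sf;
    split=> [|t _]; split=> //; exact: Scomp.
- by move=> X Y f Sf; have [SX SY] := Sid' _ _ _ Sf;
    split=> [|t _]; split=> //; exact: Scomp.
Qed.

Lemma LieGpoid_ana_sub : is_sub_bicategory (LieGpoid_ana R).
Proof.
apply: full_sub_bicategory => // [G lG|G H K a b [lG lH la] [_ lK lb]].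
  by split=> //; exact: lie_id_ana.
by split=> //; exact: lie_comp_ana.
Qed.

Lemma LieGpoid_ana_restr_sub h s : is_sub_bicategory (LieGpoid_ana_restr R h s).
Proof.
apply: full_sub_bicategory => // [G [lG mG]|G H K a b].
  by split=> //; split=> //; exact: lie_id_ana.
move=> [[lG mG] [lH mH] [la ma]] [_ [lK mK] [lb mb]]; split=> //.
split; first exact: lie_comp_ana.
have /(lie_anafunctorP _ lH) [lMb wb lsb _] := lb.
exact: pullback_arr_manifold.
Qed.

Lemma LieGpoid_ana_full :
  essentially_full_sub_bicategory (LieGpoid_ana R) (all_cells (DGpoid_ana R)).
Proof.
split=> //; first exact: LieGpoid_ana_sub.
move=> G H a lG lH _; have [b [s [t [lb _ st]]]] := lie_replacement a lG.
by exists b, s, t; split=> //; split.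
Qed.

(** Stated for any ambient [T] that contains the Lie cells, so that [LieGpoid_ana] and [all_cells]
    are both instances. *)
Lemma LieGpoid_ana_restr_full h s (T : subcells (DGpoid_ana R)) :
  is_sub_bicategory T -> (forall G, lie_groupoid G -> in0 T G) ->
  (forall G H (a : anafunctor G H), lie_groupoid G -> lie_groupoid H ->
     is_lie_anafunctor a -> @in1 _ T G H a) ->
  (forall G H (a b : anafunctor G H) (x : transf a b), @in2 _ T G H a b x) ->
  essentially_full_sub_bicategory (LieGpoid_ana_restr R h s) T.
Proof.
move=> subT T0 T1 T2; split=> //.
- exact: LieGpoid_ana_restr_sub.
- by move=> G [lG _]; exact: T0.
- move=> G H a [[lG _] [lH _] [la _]].
  by split; [exact: T0|exact: T0|exact: T1].
- move=> G H a b x [[[lG _] [lH _] [la _]] [_ _ [lb _]] _].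
  by split=> //; split; do ?[exact: T0|exact: T1].
- move=> G H a [lG mG] [lH mH] Ta.
  have [b [x [y [lb mb xy]]]] := lie_replacement a lG.
  have Tb : @mem1 _ T G H b by split; [exact: T0|exact: T0|exact: T1].
  exists b, x, y; split=> //; split=> //; first by split=> //; exact: mb.
Qed.

End SubBicategories.

(** [LieGpoid_ana] selects its 1-cells among [anafunctor] records; the first conjunct ensures that
    every Lie span between Lie groupoids gives such a record, so no Lie anafunctor is left out. *)
Theorem theorem5p9 (R : realType) :
  (forall (G H : dgroupoid R) (s : fspan G H),
     lie_groupoid G -> lie_groupoid H -> is_lie_anafunctor s ->
     is_anafunctor s) /\
  essentially_full_sub_bicategory (LieGpoid_ana R)
    (all_cells (DGpoid_ana R)) /\
  (forall hausdorff sndcount : bool, hausdorff || sndcount ->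
     essentially_full_sub_bicategory (LieGpoid_ana_restr R hausdorff sndcount)
       (LieGpoid_ana R) /\
     essentially_full_sub_bicategory (LieGpoid_ana_restr R hausdorff sndcount)
       (all_cells (DGpoid_ana R))).
Proof.
split; first by move=> G H s _ _; exact: lie_anafunctor_is_anafunctor.
split; first exact: LieGpoid_ana_full.
move=> h s _; split; apply: LieGpoid_ana_restr_full => //.
exact: LieGpoid_ana_sub.
Qed.
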